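(* Every planar graph without odd cycles of length at most $9$ has a homomorphism to the $5$-cycle $C_5$.
   Context: All graphs are finite and simple. A homomorphism from $G$ to $H$ is a function $f:V(G)\to V(H)$ such that $f(u)f(v)\in E(H)$ for every $uv\in E(G)$. *)

(* Defs.v *)
From HB Require Import structures.
From mathcomp Require Import all_boot all_order all_algebra.
From mathcomp Require Import all_classical all_reals all_analysis.
Import Order.TTheory GRing.Theory Num.Theory.
Import numFieldNormedType.Exports.

Set Implicit Arguments.
Unset Strict Implicit.
Unset Printing Implicit Defensive.

Local Open Scope classical_set_scope.
Local Open Scope ring_scope.

Record sgraph := SGraph {
  svertex :> finType;
  sedge : rel svertex;
  sedge_sym : symmetric sedge;
  sedge_irrefl : irreflexive sedge }.

Definition is_hom (G H : sgraph) (f : G -> H) : Prop :=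
  forall u v : G, sedge u v -> sedge (f u) (f v).

(* The cycle is listed without repeating its first vertex, so its length is
   [size c]; the bound excludes the degenerate [ucycle]s [::], [:: x] and
   [:: x; y]. *)
Definition is_cycle (G : sgraph) (c : seq G) : Prop :=
  (2 < size c)%N /\ ucycle (@sedge G) c.

Definition C5_edge : rel 'I_5 := fun i j => (j == ordS i) || (i == ordS j).

Fact C5_edge_sym : symmetric C5_edge.
Proof. by move=> i j; rewrite /C5_edge orbC. Qed.

Fact C5_edge_irrefl : irreflexive C5_edge.
Proof. by move=> [[|[|[|[|[|i]]]]] hi]. Qed.

Definition C5 : sgraph := SGraph C5_edge_sym C5_edge_irrefl.

Definition is_arc (R : realType) (A : set (R * R)) (p q : R * R) : Prop :=
  exists g : R -> R * R,
    [/\ {within `[0, 1], continuous g},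
        {in `[0, 1] &, injective g},
        g 0 = p, g 1 = q & A = g @` `[0, 1]].

(* [arc u v] is only meaningful when [u] and [v] are adjacent.  As no arc
   passes through the image of a third vertex, the last condition says that
   distinct edges meet at most in the images of their common ends. *)
Definition is_plane_drawing (R : realType) (G : sgraph)
    (pt : G -> R * R) (arc : G -> G -> set (R * R)) : Prop :=
  [/\ injective pt,
      forall u v, sedge u v ->
        arc u v = arc v u /\ is_arc (arc u v) (pt u) (pt v),
      forall u v w, sedge u v -> arc u v (pt w) -> w = u \/ w = v &
      forall u v x y, sedge u v -> sedge x y ->
        [set u; v]%SET != [set x; y]%SET ->
        arc u v `&` arc x y `<=` range pt].

Definition planar (R : realType) (G : sgraph) : Prop :=
  exists (pt : G -> R * R) (arc : G -> G -> set (R * R)),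
    is_plane_drawing pt arc.

(* Main.v *)
(* Identify the vertices of C_5 with Z/5, so that a homomorphism is a potential
   jumping by +1 or -1 along every edge.

   Planarity is used only through an algebraic dual: approximating a drawing on
   a fine square grid makes G a minor of the grid, and the parity with which a
   closed lattice chain winds around the unit squares turns the even edge sets
   of G into the cuts of a graph on a finite set of faces. The hypothesis on odd
   cycles says that odd cuts of the dual have at least 11 edges.

   Induct on the number of edges for all such pairs of a graph and a dual. If
   some face has degree at most 10, two consecutive edges of it can be folded
   onto each other: otherwise submodularity would make the whole face part of a
   cut of size 11 and leave an odd cut smaller than 11. If not, take an
   inclusion-minimal set X of faces whose cut has at most 10 edges and which
   contains both sides of some edge. Colour everything outside X and contract
   it; the edges inside X then form a graph with gains in Z/5. By minimality of
   X and Euler's formula every set A of its vertices satisfies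
   11 |A| - 9 e(A) >= 7, and such gain graphs can always be coloured: in a
   minimal counterexample proper subsets have the larger gap 12, which makes
   threads, folds and small configurations around vertices of degree at most 4
   reducible, and discharging 18 deg - 44 then gives a contradiction. *)
Require Import Defs.
From mathcomp Require Import all_boot all_order all_algebra zify ring lra.
Import Order.TTheory GRing.Theory Num.Theory.

Set Implicit Arguments.
Unset Strict Implicit.
Unset Printing Implicit Defensive.

(** * Sparse gain graphs over Z/5 *)

(** Folding and contracting would have to be redrawn in the plane, whereas [dual_pair] is linear
    algebra over the field with two elements and survives both, on fixed types of vertices, edges
    and faces. The constants come from one count. Let [n] contracted vertices span [e] inner edges
    that divide the region into [k > 1] parts. Each part has at least 11 cut edges and the region at
    most 10, so [11 k <= 2 e + 10]; Euler's formula gives [e <= k + n - 2], hence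
    [9 e + 12 <= 11 n]. The class is widened to the constant 7 because reductions lower the
    potential [11 n - 9 e]. A single vertex has potential 11, so sets of potential at most 11 can be
    contracted: this is the gap 12. Two simultaneous folds reach exactly 7 from it, and 7 still
    excludes triangles, whose potential is 6. Gains are forced by contraction: an outside component
    is coloured up to a constant, and an edge between two components prescribes the difference of
    their constants up to a shift and a sign. *)

Definition near5 (a b : 'Z_5) : bool := (a == b + 1)%R || (b == a + 1)%R.

Lemma near5C : symmetric near5.
Proof. by move=> a b; rewrite /near5 orbC. Qed.

Lemma near5D (d a b : 'Z_5) : near5 (a + d)%R (b + d)%R = near5 a b.
Proof. by rewrite /near5 ![(_ + d + 1)%R]addrAC !(inj_eq (addIr d)). Qed.

Section GainGraph.
Variables V E : finType.
Implicit Types (A B : {set V}) (s t : E -> V).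
Implicit Types (g : E -> 'Z_5) (c : V -> 'Z_5).

Definition inner_edges (E0 : {set E}) s t A := [set e in E0 | (s e \in A) && (t e \in A)].

Definition gain_ok s t g c e := near5 (c (t e)) (c (s e) + g e)%R.

Definition sparse (V0 : {set V}) E0 s t :=
  forall A, A \subset V0 -> A != set0 ->
    9 * #|inner_edges E0 s t A| + 7 <= 11 * #|A|.

Definition gain_colorable (V0 : {set V}) E0 s t g :=
  exists c, forall e, e \in inner_edges E0 s t V0 -> gain_ok s t g c e.

(** * Contractions in a minimal counterexample *)

Section MinimalCounterexample.
Variables (V0 : {set V}) (E0 : {set E}) (s t : E -> V) (g : E -> 'Z_5).
Hypothesis IH : forall (V1 : {set V}) (E1 : {set E}) s1 t1 g1, #|V1| < #|V0| ->
  sparse V1 E1 s1 t1 -> gain_colorable V1 E1 s1 t1 g1.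
Hypothesis sparse0 : sparse V0 E0 s t.
Hypothesis nocol : ~ gain_colorable V0 E0 s t g.

Local Notation ein := (inner_edges E0 s t).

Lemma ein_sub A B : A \subset B -> ein A \subset ein B.
Proof.
move=> AB; apply/subsetP=> e; rewrite !inE => /and3P[-> sA tA] /=.
by rewrite !(subsetP AB).
Qed.

(** Vertices are identified along [h] and gains are switched by [sh]; a colouring [c] of the
    quotient pulls back to [c (h x) + sh x]. A set of quotient vertices is the image of its full
    preimage, so sparsity has to be checked only for unions of fibres. The quotient lives on the
    same types, which lets [IH] apply to it. *)
Lemma quotient_colorable (V1 : {set V}) (E1 : {set E}) (h : V -> V) (sh : V -> 'Z_5) :
  #|h @: V1| < #|V0| ->
  (forall e, e \in E1 -> (s e \in V1) && (t e \in V1)) ->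
  (forall A, A \subset V1 -> A != set0 ->
     {in V1 &, forall x y, h x = h y -> x \in A -> y \in A} ->
     9 * #|inner_edges E1 s t A| + 7 <= 11 * #|h @: A|) ->
  exists c, forall e, e \in E1 -> gain_ok s t g (fun x => c (h x) + sh x)%R e.
Proof.
move=> ltV E1V spA.
have [|c cP] := @IH (h @: V1) E1 (h \o s) (h \o t)
   (fun e => g e + sh (s e) - sh (t e))%R ltV.
  move=> B BV B0.
  pose A := [set x in V1 | h x \in B].
  have hA : h @: A = B.
    apply/setP=> y; apply/imsetP/idP => [[x] | yB].
      by rewrite inE => /andP[_ hx] ->.
    have /imsetP[x xV xy] := subsetP BV y yB.
    by exists x; rewrite ?inE -?xy ?xV.
  have AV : A \subset V1 by apply/subsetP=> x; rewrite inE => /andP[].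
  have A0 : A != set0.
    by apply: contraNneq B0 => A0; rewrite -hA A0 imset0.
  have := spA A AV A0; rewrite hA.
  have -> : inner_edges E1 (h \o s) (h \o t) B = inner_edges E1 s t A.
    apply/setP=> e; rewrite !inE /=; case eE: (e \in E1) => //=.
    by have /andP[-> ->] := E1V e eE.
  apply=> x y xV yV hxy; rewrite !inE => /andP[_].
  by rewrite hxy yV => ->.
exists c => e eE.
have /(cP e) : e \in inner_edges E1 (h \o s) (h \o t) (h @: V1).
  by rewrite inE eE /=; have /andP[? ?] := E1V e eE; rewrite !imset_f.
rewrite /gain_ok /= -(near5D (sh (t e))) => ok_e.
by rewrite (_ : (_ + sh (s e) + _ = c (h (s e)) +
  (g e + sh (s e) - sh (t e)) + sh (t e))%R) //; ring.
Qed.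

Lemma colorable_sub A (E1 : {set E}) : A \proper V0 -> E1 \subset E0 ->
  exists c, forall e, e \in inner_edges E1 s t A -> gain_ok s t g c e.
Proof.
move=> Apr E1s.
apply: IH; first exact: proper_card.
move=> B BA B0; apply: leq_trans (sparse0 (subset_trans BA (proper_sub Apr)) B0).
rewrite leq_add2r leq_mul2l /=; apply: subset_leq_card.
by apply/subsetP=> e; rewrite !inE => /andP[/(subsetP E1s)-> ->].
Qed.

(** A set of potential at most 11 weighs no more than a single vertex, so contracting it to [a]
    leaves a sparse graph. The quotient and [A] are coloured separately, and adding the colouring of
    [A] to the constant [c a] would colour the whole graph. *)
Lemma gap A : A \proper V0 -> 1 < #|A| -> 9 * #|ein A| + 12 <= 11 * #|A|.
Proof.
move=> Apr A1; have AV := proper_sub Apr.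
have [cA cAP] := colorable_sub Apr (subxx E0).
have [a aA] : exists a, a \in A by apply/card_gt0P; apply: ltn_trans A1.
rewrite leqNgt; apply/negP=> small; apply: nocol.
pose h x := if x \in A then a else x.
pose E1 := [set e in ein V0 | ~~ ((s e \in A) && (t e \in A))].
have hV x : x \in V0 -> h x \in a |: (V0 :\: A).
  rewrite /h => xV; case: (boolP (x \in A)) => xA; rewrite !inE ?eqxx //.
  by rewrite xA xV orbT.
have cardq : #|a |: (V0 :\: A)| + #|A| = #|V0| + 1.
  rewrite cardsU1 !inE aA /= cardsD (setIidPr AV).
  by have := subset_leq_card AV; lia.
have [|e|B BV B0 satB|c cP] := @quotient_colorable V0 E1 h
    (fun x => if x \in A then cA x else 0%R).
- apply: (@leq_ltn_trans #|a |: (V0 :\: A)|); last by lia.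
  by apply: subset_leq_card; apply/subsetP=> _ /imsetP[x xV ->]; exact: hV.
- by rewrite !inE => /andP[/and3P[_ -> ->]].
(* A union of fibres either misses [A], and nothing changes, or contains it, and then trading [A]
   for [a] does not lower the potential. *)
- have [aB|aNB] := boolP (a \in B); last first.
    have dAB x : x \in B -> x \notin A.
      move=> xB; apply: contraNN aNB => xA.
      apply: (satB x a (subsetP BV x xB) (subsetP AV a aA)) => //.
      by rewrite /h xA aA.
    have -> : h @: B = B.
      apply/setP=> y; apply/imsetP/idP => [[x xB ->]|yB].
        by rewrite /h (negPf (dAB x xB)).
      by exists y; rewrite // /h (negPf (dAB y yB)).
    apply: leq_trans (sparse0 BV B0).
    rewrite leq_add2r leq_mul2l /=; apply: subset_leq_card.
    by apply/subsetP=> e; rewrite !inE => /andP[/andP[/and3P[-> _ _] _] ->].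
  have AB : A \subset B.
    apply/subsetP=> x xA; apply: (satB a x) => //; try exact: (subsetP AV).
    by rewrite /h xA aA.
  have hB : h @: B = a |: (B :\: A).
    apply/setP=> y; apply/imsetP/idP => [[x xB ->]|].
      rewrite /h; case: (boolP (x \in A)) => xA; rewrite !inE ?eqxx //.
      by rewrite xA xB orbT.
    rewrite !inE => /orP[/eqP-> | /andP[yA yB]].
      by exists a; rewrite // /h aA.
    by exists y; rewrite // /h (negPf yA).
  have cB : #|h @: B| + #|A| = #|B| + 1.
    rewrite hB cardsU1 !inE aA /= cardsD (setIidPr AB).
    by have := subset_leq_card AB; lia.
  have := sparse0 BV B0.
  have /(@leq_add _ _ _ _ (leqnn #|ein A|)) :
      #|inner_edges E1 s t B| <= #|ein B :\: ein A|.
    apply: subset_leq_card; apply/subsetP=> e; rewrite !inE.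
    by move=> /andP[/andP[/and3P[-> _ _] nA] ->]; rewrite nA.
  rewrite cardsD (setIidPr (ein_sub AB)) subnKC; last first.
    exact: subset_leq_card (ein_sub AB).
  by lia.
exists (fun x => c (h x) + (if x \in A then cA x else 0))%R => e eV.
have [eA|eNA] := boolP ((s e \in A) && (t e \in A)); last first.
  by apply: cP; rewrite inE eV eNA.
have /cAP : e \in ein A by move: eV; rewrite inE => /andP[eE _]; rewrite inE eE eA.
case/andP: eA => sA tA; rewrite /gain_ok /h sA tA => ok_e.
by rewrite ![(c a + _)%R]addrC addrAC near5D.
Qed.

(** Sparsity excludes loops, as [9 + 7 > 11], and parallel edges, as [18 + 7 > 22]. From here on the
    multigraph can be handled as a simple graph with gains on ordered pairs. *)
Definition adj x y := [exists e in ein V0,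
  ((s e == x) && (t e == y)) || ((s e == y) && (t e == x))].

Lemma adjC : symmetric adj.
Proof. by move=> x y; apply: eq_existsb => e; rewrite orbC. Qed.

Lemma adjV x y : adj x y -> (x \in V0) && (y \in V0).
Proof.
case/exists_inP=> e; rewrite inE => /and3P[_ sV tV].
by case/orP=> /andP[/eqP<- /eqP<-]; rewrite sV tV.
Qed.

Lemma noloop e : e \in ein V0 -> s e != t e.
Proof.
rewrite inE => /and3P[eE sV tV]; apply/eqP=> st.
have := @sparse0 [set s e]; rewrite sub1set sV cards1 => /(_ isT).
have -> : [set s e] != set0 by apply/set0Pn; exists (s e); rewrite inE.
have : 0 < #|ein [set s e]|.
  by apply/card_gt0P; exists e; rewrite !inE eE -st eqxx.
by move=> p /(_ isT); lia.
Qed.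

Lemma adj_irr : irreflexive adj.
Proof.
move=> x; apply/negbTE/exists_inP => -[e eV]; move: (noloop eV).
by move=> /eqP ne /orP[] /andP[/eqP a /eqP b]; apply: ne; rewrite a b.
Qed.

Lemma ein_uniq e1 e2 A : e1 \in ein V0 -> e2 \in ein V0 -> #|A| = 2 ->
  A \subset V0 ->
  e1 \in ein A -> e2 \in ein A -> e1 = e2.
Proof.
move=> e1V e2V A2 AV e1A e2A; apply/eqP; apply/negPn/negP => ne.
have A0 : A != set0 by rewrite -card_gt0 A2.
have := sparse0 AV A0; rewrite A2.
have : #|[set e1; e2]| <= #|ein A|.
  by apply: subset_leq_card; apply/subsetP=> e; rewrite !inE => /orP[]/eqP->; 
     [move: e1A|move: e2A]; rewrite inE.
by rewrite cards2 ne; lia.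
Qed.

Lemma adj_uniq e1 e2 : e1 \in ein V0 -> e2 \in ein V0 ->
  [set s e1; t e1] = [set s e2; t e2] -> e1 = e2.
Proof.
move=> e1V e2V E12.
have sV e : e \in ein V0 -> [set s e; t e] \subset V0.
  rewrite inE => /and3P[_ sV tV].
  by apply/subsetP=> x; rewrite !inE => /orP[]/eqP->.
have eA e : e \in ein V0 -> e \in ein [set s e; t e].
  by rewrite !inE => /and3P[-> _ _]; rewrite !eqxx orbT.
apply: (@ein_uniq e1 e2 [set s e1; t e1]) => //.
- by rewrite cards2 noloop.
- exact: sV.
- exact: eA.
- by rewrite E12; exact: eA.
Qed.

(** Each new edge is named by its end other than [x]. This recursion, with the value at the empty
    set, is all that the reducibility arguments know about the number of edges. *)
Lemma ein_addE x A : x \in V0 -> A \subset V0 -> x \notin A ->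
  #|ein (x |: A)| = #|ein A| + #|[set y in A | adj x y]|.
Proof.
move=> xV AV xA.
have sub : ein A \subset ein (x |: A) by apply: ein_sub; exact: subsetUr.
rewrite -(cardsID (ein A) (ein (x |: A))) (setIidPr sub); congr addn.
pose f e := if s e == x then t e else s e.
have DP e : e \in ein (x |: A) :\: ein A ->
   [/\ e \in ein V0, (f e \in A) & [set s e; t e] = [set x; f e]].
  move=> eD; have [eE nA sA tA] : [/\ e \in E0, ~~ ((s e \in A) && (t e \in A)),
      (s e == x) || (s e \in A) & (t e == x) || (t e \in A)].
    move: eD; rewrite !inE; case: (e \in E0) => //= /andP[nA /andP[sA tA]].
    by split.
  have eV : e \in ein V0.
    rewrite inE eE /=; apply/andP; split.
      by case/orP: sA => [/eqP->//|]; apply: (subsetP AV).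
    by case/orP: tA => [/eqP->//|]; apply: (subsetP AV).
  have ne := noloop eV; rewrite /f; split; first exact: eV.
    case: (s e =P x) sA ne => [-> _ ne|_ /= -> //].
    by case/orP: tA => [/eqP tx|//]; rewrite tx eqxx in ne.
  case: (s e =P x) sA nA => [-> //|sx /= -> /=].
  by case/orP: tA => [/eqP-> |->//]; rewrite setUC.
rewrite -(@card_in_imset _ _ f); last first.
  move=> e1 e2 /DP[e1V _ s1] /DP[e2V _ s2] f12.
  by apply: adj_uniq => //; rewrite s1 s2 f12.
apply: eq_card => y; rewrite [RHS]inE; apply/imsetP/andP => [[e /DP[eV fA sE] ->]|].
  split=> //; apply/exists_inP; exists e => //.
  have : x \in [set s e; t e] by rewrite sE !inE eqxx.
  rewrite /f !inE => /orP[]/eqP->; rewrite ?eqxx //.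
  by rewrite (negPf (noloop eV)) !eqxx orbT.
move=> [yA /exists_inP[e eV H]].
have yx : y != x by apply: contraNneq xA => <-.
exists e.
  move: eV; rewrite !inE => /and3P[-> _ _] /=.
  case/orP: H => /andP[/eqP-> /eqP->]; rewrite !eqxx yA (negPf xA) ?orbT //.
rewrite /f; case/orP: H => /andP[/eqP-> /eqP->]; rewrite ?eqxx //.
by rewrite (negPf yx).
Qed.

(** The gain is read from [y] to [x]: the edge asks for [c x] next to [c y + gain_of x y]. The value
    0 is a default for pairs that are not adjacent. *)
Definition gain_of x y : 'Z_5 :=
  if [pick e in ein V0 | (s e == y) && (t e == x)] is Some e then g e
  else if [pick e in ein V0 | (s e == x) && (t e == y)] is Some e then (- g e)%R
  else 0%R.

Lemma gain_ofE e : e \in ein V0 ->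
  gain_of (t e) (s e) = g e /\ gain_of (s e) (t e) = (- g e)%R.
Proof.
move=> eV; have ne := noloop eV; split.
  rewrite /gain_of; case: pickP => [e' /andP[e'V /andP[/eqP s' /eqP t']] | /(_ e)].
    by congr g; apply: adj_uniq => //; rewrite s' t'.
  by rewrite eV !eqxx.
rewrite /gain_of; case: pickP => [e' /andP[e'V /andP[/eqP s' /eqP t']] | _].
  have e12 : e' = e by apply: adj_uniq => //; rewrite s' t' setUC.
  by move: ne; rewrite -{1}e12 s' eqxx.
case: pickP => [e' /andP[e'V /andP[/eqP s' /eqP t']] | /(_ e)].
  by congr (- g _)%R; apply: adj_uniq => //; rewrite s' t'.
by rewrite eV !eqxx.
Qed.

Lemma gain_ofP e c : e \in ein V0 ->
  near5 (c (t e)) (c (s e) + gain_of (t e) (s e))%R = gain_ok s t g c e /\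
  near5 (c (s e)) (c (t e) + gain_of (s e) (t e))%R = gain_ok s t g c e.
Proof.
move=> eV; have [-> ->] := gain_ofE eV.
split=> //; rewrite /gain_ok -(near5D (g e)) subrK.
exact: near5C.
Qed.

Lemma adj_okP c (V1 : {set V}) : V1 \subset V0 ->
  (forall e, e \in ein V1 -> gain_ok s t g c e) <->
  {in V1 &, forall x y, adj x y -> near5 (c x) (c y + gain_of x y)%R}.
Proof.
move=> V1V; split=> [H x y xV yV /exists_inP[e eV] | H e eV1].
  case/orP=> /andP[/eqP sx /eqP ty]; subst x y.
    rewrite (gain_ofP c eV).2; apply: H.
    by move: eV; rewrite !inE xV yV => /andP[->].
  rewrite (gain_ofP c eV).1; apply: H.
  by move: eV; rewrite !inE xV yV => /andP[->].
have eV := subsetP (ein_sub V1V) _ eV1.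
rewrite -(gain_ofP c eV).1; move: eV1; rewrite inE => /and3P[_ sV tV].
by apply: H => //; apply/exists_inP; exists e => //; rewrite !eqxx orbT.
Qed.

Lemma gain_ofN x y : adj x y -> gain_of y x = (- gain_of x y)%R.
Proof.
case/exists_inP=> e /gain_ofE[p1 p2].
by case/orP=> /andP[/eqP <- /eqP <-]; rewrite p1 p2 ?opprK.
Qed.

Lemma identify_colorable (V1 : {set V}) (h : V -> V) (sh : V -> 'Z_5) : V1 \subset V0 ->
  #|h @: V1| < #|V0| ->
  (forall A, A \subset V1 -> A != set0 ->
     {in V1 &, forall x y, h x = h y -> x \in A -> y \in A} ->
     9 * #|ein A| + 7 <= 11 * #|h @: A|) ->
  exists c, {in V1 &, forall x y, adj x y ->
     near5 (c (h x) + sh x) (c (h y) + sh y + gain_of x y)}%R.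
Proof.
move=> V1V lt spA.
have einV1 A : A \subset V1 -> inner_edges (ein V1) s t A = ein A.
  move=> AV; apply/setP=> e; rewrite !inE -!andbA; congr (_ && _).
  case sA: (s e \in A); last by rewrite !andbF.
  case tA: (t e \in A); last by rewrite !andbF.
  by rewrite !(subsetP AV).
have [|A AV A0 sat|c cP] := @quotient_colorable V1 (ein V1) h sh lt.
- by move=> e; rewrite inE => /and3P[_ -> ->].
- by rewrite einV1 //; apply: spA.
exists c; exact: (adj_okP (fun x => c (h x) + sh x)%R V1V).1 cP.
Qed.

End MinimalCounterexample.
End GainGraph.

(** * Values in Z/5 that a thread leaves at its end *)

Lemma near5N (a b d : 'Z_5) : near5 a (b + d)%R = near5 b (a - d)%R.
Proof. by rewrite -(near5D (- d)%R a) addrK near5C. Qed.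

Definition grow (d : 'Z_5) (S : {set 'Z_5}) : {set 'Z_5} :=
  [set a | [exists b in S, near5 a (b + d)%R]].

Lemma growP d (S : {set _}) a : reflect (exists2 b, b \in S & near5 a (b + d)%R) (a \in grow d S).
Proof. by rewrite inE; exact: exists_inP. Qed.

Lemma mem_grow1 d a b : (a \in grow d [set b]) = near5 a (b + d)%R.
Proof.
apply/growP/idP => [[b' /set1P->] //|]; by exists b; rewrite ?inE.
Qed.

(** If the set did not grow, its shifts by [+1] and [-1] would coincide, so [S] would be invariant
    under adding 2, a generator of Z/5, and would be everything. Iterated, a thread of [k < 5] edges
    with one coloured end leaves at least [k + 1] values at the other. *)
Lemma card_grow d (S : {set _}) : S != set0 -> minn 5 #|S|.+1 <= #|grow d S|.
Proof.
move=> S0.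
have sub e : (e == 1 \/ e == -1)%R -> [set (b + d + e)%R | b in S] \subset grow d S.
  move=> eE; apply/subsetP=> _ /imsetP[b bS ->]; apply/growP; exists b => //.
  rewrite /near5; case: eE => /eqP->; first by rewrite eqxx.
  by rewrite subrK eqxx orbT.
have inj e : injective (fun b : 'Z_5 => b + d + e)%R.
  by move=> x y /addIr /addIr.
have sub1 := sub 1%R (or_introl (eqxx _)).
have sub2 := sub (-1)%R (or_intror (eqxx _)).
rewrite leqNgt; apply/negP => lt.
have le : #|grow d S| <= #|S| by move: lt; rewrite leq_min leq_eqVlt; lia.
have eqs e : [set (b + d + e)%R | b in S] \subset grow d S ->
    [set (b + d + e)%R | b in S] = grow d S.
  by move=> sb; apply/eqP; rewrite eqEcard sb card_imset.
have E12 := etrans (eqs _ sub1) (esym (eqs _ sub2)).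
have S2 b : b \in S -> (b + 1 + 1)%R \in S.
  move=> bS; have : (b + d + 1)%R \in [set (b + d + -1)%R | b in S].
    by rewrite -E12; apply/imsetP; exists b.
  case/imsetP=> b' b'S Eb; suff -> : (b + 1 + 1 = b')%R by [].
  by apply: (addIr d); apply: (addIr (-1)%R); rewrite -Eb; ring.
have [b0 b0S] := set0Pn _ S0.
have all x : x \in S.
  have H k : (b0 + (1 + 1) *+ k)%R \in S.
    elim: k => [|k IH]; first by rewrite mulr0n addr0.
    by rewrite mulrS addrCA addrC addrA; exact: S2.
  have -> : x = (b0 + (1 + 1) *+ (3 * (x - b0)%R))%R.
    rewrite mulrnA -mulr_natr natr_Zp.
    have -> : ((1 + 1) *+ 3 = 1 :> 'Z_5)%R by apply/val_inj.
    by rewrite mul1r addrC subrK.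
  exact: H.
have cS : #|S| = 5.
  have -> : S = setT by apply/setP=> x; rewrite !inE all.
  by rewrite cardsT card_ord.
have : #|S| <= #|[set (b + d + 1)%R | b in S]| by rewrite card_imset.
move/leq_trans/(_ (subset_leq_card sub1)); move: lt; rewrite cS /minn /=.
by rewrite ltnNge => /negP h /h.
Qed.

Lemma card_grow_geq k d (S : {set _}) : k < 5 -> 0 < k -> k <= #|S| -> k < #|grow d S|.
Proof.
move=> k5 k0 kS; have S0 : S != set0 by rewrite -card_gt0; apply: leq_trans kS.
by apply: leq_trans (card_grow d S0); rewrite leq_min k5 ltnS.
Qed.

Lemma card_grow1 d b : 1 < #|grow d [set b]|.
Proof. by apply: card_grow_geq; rewrite ?cards1. Qed.

Lemma cardI_Z5 (S T : {set 'Z_5}) : #|S| + #|T| <= #|S :&: T| + 5.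
Proof.
rewrite -cardsUI addnC leq_add2l.
by apply: leq_trans (max_card _) _; rewrite card_ord.
Qed.

Lemma common2 (S1 S2 : {set 'Z_5}) : 5 < #|S1| + #|S2| ->
  exists a, (a \in S1) && (a \in S2).
Proof.
move=> lt; have := cardI_Z5 S1 S2 => le.
have /card_gt0P[a] : 0 < #|S1 :&: S2| by lia.
by rewrite inE; exists a.
Qed.

Lemma common3 (S1 S2 S3 : {set 'Z_5}) : 10 < #|S1| + #|S2| + #|S3| ->
  exists a, [&& a \in S1, a \in S2 & a \in S3].
Proof.
move=> lt; have le := cardI_Z5 S2 S3.
have [|a] := @common2 S1 (S2 :&: S3); first by lia.
by rewrite inE; exists a.
Qed.

Lemma common4 (S1 S2 S3 S4 : {set 'Z_5}) : 15 < #|S1| + #|S2| + #|S3| + #|S4| ->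
  exists a, [&& a \in S1, a \in S2, a \in S3 & a \in S4].
Proof.
move=> lt; have le := cardI_Z5 S3 S4.
have [|a] := @common3 S1 S2 (S3 :&: S4); first by lia.
by rewrite inE; exists a.
Qed.

(** The sums of two signs: the discrepancies that a thread of two edges can absorb. *)
Definition dist2 : seq 'Z_5 := [:: 0; 1 + 1; - (1 + 1)]%R.

Lemma mem_grow2 d1 d2 a b : (a - (b + d2 + d1))%R \in dist2 ->
  a \in grow d1 (grow d2 [set b]).
Proof.
rewrite !inE => H.
have nearD (x e : 'Z_5) : e == 1%R \/ e == (-1)%R -> near5 (x + e)%R x.
  by rewrite /near5; case=> /eqP->; rewrite ?eqxx // subrK eqxx orbT.
have [e [e' [eP e'P aE]]] : exists e e' : 'Z_5, [/\ e == 1%R \/ e == (-1)%R,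
    e' == 1%R \/ e' == (-1)%R & a = (b + d2 + e' + d1 + e)%R].
  case/or3P: H => /eqP H; [exists 1%R, (-1)%R | exists 1%R, 1%R | exists (-1)%R, (-1)%R];
    split; rewrite ?eqxx; auto; rewrite -[LHS](subrK (b + d2 + d1)%R) H; ring.
apply/exists_inP; exists (b + d2 + e')%R; last by rewrite aE; exact: nearD.
by rewrite mem_grow1; exact: nearD.
Qed.

Lemma dist2N x : (- x)%R \in dist2 -> x \in dist2.
Proof. by rewrite !inE => /or3P[] /eqP/(canRL (@opprK _))->; apply/or3P;
  [apply: Or31 | apply: Or33 | apply: Or32]; rewrite ?opprK ?oppr0. Qed.

(** Three vertices, each tied by a two-edge thread to the outside and to the other two: [k1], [k2],
    [k3] are their offsets from the values suggested from outside. Only the three discrepancies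
    [f1], [f2], [f3] matter, and the 125 cases are checked by computation. *)
Lemma triangle_lists (f1 f2 f3 : 'Z_5) : exists k1 k2 k3,
  [/\ k1 \in dist2, k2 \in dist2, k3 \in dist2 &
   [/\ f1 + k1 - k3 \in dist2, f2 + k2 - k3 \in dist2 & f3 + k1 - k2 \in dist2]]%R.
Proof.
pose Z5 : seq 'Z_5 := [:: 0; 1; 1 + 1; 1 + 1 + 1; -1]%R.
have inZ5 x : x \in Z5 by case: x => [[|[|[|[|[|k]]]]] lt].
pose t (p : 'Z_5 * 'Z_5 * 'Z_5) := has (fun k1 => has (fun k2 => has (fun k3 =>
  [&& (p.1.1 + k1 - k3)%R \in dist2, (p.1.2 + k2 - k3)%R \in dist2
    & (p.2 + k1 - k2)%R \in dist2]) dist2) dist2) dist2.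
have : all t (allpairs pair (allpairs pair Z5 Z5) Z5) by vm_compute.
move/allP/(_ (f1, f2, f3)); rewrite !allpairs_f // => /(_ isT).
case/hasP=> [k1 k1d /hasP[k2 k2d /hasP[k3 k3d /and3P[]]]].
by exists k1, k2, k3.
Qed.

(** * Reducible configurations *)

Section Reducible.
Variables (V : finType) (V0 : {set V}) (adj : rel V) (gn : V -> V -> 'Z_5).
Variable ed : {set V} -> nat.
Implicit Types (A B : {set V}) (c : V -> 'Z_5).
Hypothesis adjC : symmetric adj.
Hypothesis adj_irr : irreflexive adj.
Hypothesis adjV : forall x y, adj x y -> (x \in V0) && (y \in V0).
Hypothesis gnN : forall x y, adj x y -> gn y x = (- gn x y)%R.
Hypothesis ed0 : ed set0 = 0.
Hypothesis edD : forall x A, x \in V0 -> A \subset V0 -> x \notin A ->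
  ed (x |: A) = ed A + #|[set y in A | adj x y]|.
Hypothesis sp : forall A, A \subset V0 -> A != set0 -> 9 * ed A + 7 <= 11 * #|A|.
Hypothesis gapA : forall A, A \proper V0 -> 1 < #|A| -> 9 * ed A + 12 <= 11 * #|A|.

Definition col c A :=
  {in A &, forall x y, adj x y -> near5 (c x) (c y + gn x y)%R}.

Hypothesis idc : forall A (h : V -> V) (sh : V -> 'Z_5), A \subset V0 ->
  #|h @: A| < #|V0| ->
  (forall B, B \subset A -> B != set0 ->
     {in A &, forall x y, h x = h y -> x \in B -> y \in B} ->
     9 * ed B + 7 <= 11 * #|h @: B|) ->
  exists c, col (fun x => c (h x) + sh x)%R A.
Hypothesis nocol : forall c, ~ col c V0.

Local Notation N x := [set y | adj x y].

Lemma col_sub c A B : A \subset B -> col c B -> col c A.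
Proof. by move=> /subsetP AB cB x y xA yA; apply: cB; exact: AB. Qed.

Lemma nocol_sub c A : V0 \subset A -> col c A -> False.
Proof. by move=> VA /(col_sub VA)/nocol. Qed.

Lemma adj_neq x y : adj x y -> x != y.
Proof. by apply: contraTneq => ->; rewrite adj_irr. Qed.

Lemma adjVl x y : adj x y -> x \in V0.
Proof. by case/adjV/andP. Qed.

Lemma adjVr x y : adj x y -> y \in V0.
Proof. by case/adjV/andP. Qed.

Lemma col_proper A : A \proper V0 -> exists c, col c A.
Proof.
move=> AV; have [||B BA B0 _|c cP] := @idc A id (fun=> 0%R).
- exact: proper_sub.
- by rewrite imset_id proper_card.
- by rewrite imset_id; apply: sp => //; apply: subset_trans (proper_sub AV).
by exists (fun x => c x + 0)%R.
Qed.

Definition upd c x a : V -> 'Z_5 := fun z => if z == x then a else c z.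

Lemma updE c x a : upd c x a x = a.
Proof. by rewrite /upd eqxx. Qed.

Lemma col_upd c A x a : col c A -> x \notin A ->
  (forall y, y \in A -> adj x y -> near5 a (c y + gn x y)%R) ->
  col (upd c x a) (x |: A) /\ {in A, upd c x a =1 c}.
Proof.
move=> cA xA H.
have out : {in A, upd c x a =1 c}.
  by move=> y yA; rewrite /upd; case: eqP => // yx; rewrite -yx yA in xA.
split=> // y z; rewrite !inE => /orP[/eqP->|yA] /orP[/eqP->|zA] ayz.
- by rewrite adj_irr in ayz.
- by rewrite updE out //; apply: H.
- rewrite updE out // near5N -gnN //; apply: H => //; by rewrite adjC.
- by rewrite !out //; apply: cA.
Qed.

Lemma col_step c A v m S : col c A -> m \notin A -> adj v m ->
  c v \in grow (gn v m) S ->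
  (forall y b, y \in A -> adj m y -> y != v -> b \in S ->
     near5 b (c y + gn m y)%R) ->
  exists c', [/\ col c' (m |: A), {in A, c' =1 c} & c' m \in S].
Proof.
move=> cA mA vm /growP[b bS nb] H.
have [|colb eqb] := @col_upd c A m b cA mA.
  move=> y yA my; have [->|yv] := eqVneq y v; last exact: H.
  by rewrite (gnN vm) -near5N.
by exists (upd c m b); split=> //; rewrite updE.
Qed.

Lemma col_thread2 c A v m x : col c A -> m \notin A -> v \in A ->
  N m = [set v; x] ->
  c v \in grow (gn v m) (grow (gn m x) [set c x]) ->
  exists c', col c' (m |: A) /\ {in A, c' =1 c}.
Proof.
move=> cA mA vA Nm cv.
have vm : adj v m by rewrite adjC; have := set21 v x; rewrite -Nm inE.
have [|c' [? ? _]] := col_step cA mA vm cv; last by exists c'.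
move=> y b yA my yv; rewrite mem_grow1.
have : y \in N m by rewrite inE.
by rewrite Nm !inE (negPf yv) => /eqP->.
Qed.

Lemma col_thread3 c A v m n x : col c A -> m \notin A -> n \notin A -> v \in A ->
  x \in A -> N m = [set v; n] -> N n = [set m; x] -> 
  c v \in grow (gn v m) (grow (gn m n) (grow (gn n x) [set c x])) ->
  exists c', col c' (n |: (m |: A)) /\ {in A, c' =1 c}.
Proof.
move=> cA mA nA vA xA Nm Nn cv.
have vm : adj v m by rewrite adjC; have := set21 v n; rewrite -Nm inE.
have mn : adj m n by have := set22 v n; rewrite -Nm inE.
have [|c1 [col1 eq1 c1m]] := col_step cA mA vm cv.
  move=> y b yA my yv _.
  have : y \in N m by rewrite inE.
  by rewrite Nm !inE (negPf yv) => /eqP yn; rewrite -yn yA in nA.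
have [|||c2 [col2 eq2]] := @col_thread2 c1 (m |: A) m n x col1 _ _ Nn.
- by rewrite !inE negb_or nA eq_sym adj_neq.
- by rewrite !inE eqxx.
- by rewrite (eq1 x xA).
exists c2; split=> // y yA.
by rewrite eq2 ?eq1 // inE yA orbT.
Qed.

(* Folding the edges [wp] and [wq] onto each other adds [11 - 2 * 9] to the
   potential of a set containing [p] and [q], which [gapA] can afford. *)
Lemma fold1 w p q A : adj w p -> adj w q -> p != q -> w \notin A ->
  p \in A -> q \in A -> w |: A \proper V0 ->
  exists2 c, col c A & (c p + gn w p = c q + gn w q)%R.
Proof.
move=> wp wq pq wA pA qA Apr.
pose h x := if x == q then p else x.
pose sh x : 'Z_5 := if x == q then (gn w p - gn w q)%R else 0%R.
have AV : A \subset V0 by apply: subset_trans (proper_sub Apr); exact: subsetUr.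
have ltA : #|A| < #|V0|.
  apply: leq_ltn_trans (proper_card Apr).
  by apply: subset_leq_card; exact: subsetUr.
have [|B BA B0 sat|c cP] := @idc A h sh AV.
- exact: leq_ltn_trans (leq_imset_card _ _) ltA.
- have hqp : h q = h p by rewrite /h eqxx (negPf pq).
  have [pB|pNB] := boolP (p \in B); last first.
    have qNB : q \notin B by apply: contraNN pNB; apply: sat.
    have -> : h @: B = B.
      apply/setP=> y; apply/imsetP/idP => [[x xB ->]|yB].
        by rewrite /h; case: eqP => // xq; rewrite -xq xB in qNB.
      by exists y; rewrite // /h; case: eqP => // xq; rewrite -xq yB in qNB.
    by apply: sp => //; apply: subset_trans BA AV.
  have qB : q \in B by apply: (sat p q).
  have hB : h @: B = B :\ q.
    apply/setP=> y; apply/imsetP/idP => [[x xB ->]|].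
      by rewrite /h !inE; case: (eqVneq x q) => [_|->]; rewrite ?pq ?pB.
    by rewrite !inE => /andP[yq yB]; exists y; rewrite // /h (negPf yq).
  have wB : w \notin B by apply: contraNN wA; exact: (subsetP BA).
  have BpV : w |: B \proper V0 by apply: sub_proper_trans Apr; apply: setUS.
  have := gapA BpV; rewrite edD ?(adjVl wp) ?(subset_trans BA AV) //.
  rewrite cardsU1 wB (cardsD1 q B) qB (cardsD1 p (B :\ q)) !inE pq pB /= => gp.
  have : #|[set p; q]| <= #|[set y in B | adj w y]|.
    apply: subset_leq_card; apply/subsetP=> y; rewrite !inE.
    by case/orP=> /eqP->; rewrite ?pB ?qB.
  rewrite cards2 pq; move: (gp isT).
  by rewrite hB (cardsD1 p (B :\ q)) !inE pq pB /=; clear; lia.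
exists (fun x => c (h x) + sh x)%R => //.
rewrite /sh /h eqxx (negPf pq); ring.
Qed.

Lemma small_cycle A : A \subset V0 -> #|A| < #|V0| -> 1 < #|A| -> 
  11 * #|A| < 9 * ed A + 12 -> False.
Proof.
move=> AV ltA A1 lt.
have Apr : A \proper V0 by rewrite properEcard AV ltA.
by move: (gapA Apr A1) lt; move: (ed A) #|A|; clear; lia.
Qed.

Lemma ed1 x : x \in V0 -> ed [set x] = 0.
Proof.
move=> xV; rewrite -[X in ed X]setU0 edD ?sub0set ?inE // ed0.
by apply: eq_card0 => y; rewrite !inE.
Qed.

Lemma ed_path x y A : adj x y -> A \subset V0 -> x \notin A -> y \in A ->
  ed A < ed (x |: A).
Proof.
move=> xy AV xA yA; rewrite edD ?(adjVl xy) // -addn1 leq_add2l.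
by apply/card_gt0P; exists y; rewrite !inE yA.
Qed.

Lemma ed_close x y z A : adj x y -> adj x z -> y != z -> A \subset V0 -> x \notin A ->
  y \in A -> z \in A -> ed A + 2 <= ed (x |: A).
Proof.
move=> xy xz yz AV xA yA zA; rewrite edD ?(adjVl xy) // leq_add2l.
have <- : #|[set y; z]| = 2 by rewrite cards2 yz.
apply: subset_leq_card; apply/subsetP=> t; rewrite !inE.
by case/orP=> /eqP->; rewrite ?yA ?zA.
Qed.

(** The potential would be [33 - 27 = 6], below 7. *)
Lemma triangle_free x y z : adj x y -> adj y z -> adj x z -> False.
Proof.
move=> xy yz xz.
have [nxy nyz nxz] := And3 (adj_neq xy) (adj_neq yz) (adj_neq xz).
have xV := adjVl xy; have yV := adjVl yz; have zV := adjVr yz.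
have sz : [set z] \subset V0 by rewrite sub1set.
have ez := ed1 zV.
have eyz := ed_path yz sz; rewrite !inE nyz eqxx in eyz.
have syz : y |: [set z] \subset V0.
  by apply/subsetP=> t; rewrite !inE => /orP[]/eqP->.
have exyz := ed_close xy xz nyz syz; rewrite !inE !negb_or nxy nxz !eqxx orbT in exyz.
have sxyz : x |: (y |: [set z]) \subset V0.
  by apply/subsetP=> t; rewrite !inE => /or3P[]/eqP->.
have := sp sxyz; have -> : x |: (y |: [set z]) != set0.
  by apply/set0Pn; exists x; rewrite !inE eqxx.
rewrite !cardsU1 !inE !negb_or nxy nxz nyz cards1 /= => /(_ isT).
by move: (eyz isT isT) (exyz isT isT isT) ez; clear; lia.
Qed.

(** The potential would be [44 - 36 = 8]. This contradicts only the gap for proper subsets, hence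
    the bound on the size of [V0]. *)
Lemma square_free x y z t : adj x y -> adj y z -> adj z t -> adj t x ->
  x != z -> y != t -> 4 < #|V0| -> False.
Proof.
move=> xy yz zt tx xz yt bigV.
have [nxy nyz nzt ntx] := And4 (adj_neq xy) (adj_neq yz) (adj_neq zt) (adj_neq tx).
have sz : [set z] \subset V0 by rewrite sub1set (adjVr yz).
have eyz := ed_path yz sz; rewrite !inE nyz eqxx in eyz.
have syz : y |: [set z] \subset V0.
  by apply/subsetP=> u; rewrite !inE => /orP[]/eqP->; rewrite ?(adjVr yz) ?(adjVl yz).
have etyz : ed (y |: [set z]) < ed (t |: (y |: [set z])).
  apply: (@ed_path t z); rewrite ?inE ?eqxx ?orbT //; first by rewrite adjC.
  by rewrite negb_or eq_sym yt eq_sym nzt.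
have styz : t |: (y |: [set z]) \subset V0.
  apply/subsetP=> u; rewrite !inE => /or3P[]/eqP->;
  by rewrite ?(adjVr yz) ?(adjVl yz) ?(adjVl tx).
have xt : adj x t by rewrite adjC.
have exx : ed (t |: (y |: [set z])) + 2 <= ed (x |: (t |: (y |: [set z]))).
  apply: (@ed_close x y t) => //; rewrite ?inE ?eqxx ?orbT //.
  by rewrite !negb_or eq_sym ntx nxy xz.
have xN : x \notin t |: (y |: [set z]) by rewrite !inE !negb_or eq_sym ntx nxy xz.
have tN : t \notin y |: [set z] by rewrite !inE !negb_or eq_sym yt eq_sym nzt.
have yN : y \notin [set z] by rewrite !inE.
have c4 : #|x |: (t |: (y |: [set z]))| = 4.
  by rewrite !cardsU1 xN tN yN cards1.
apply: (@small_cycle (x |: (t |: (y |: [set z])))); rewrite ?c4 //.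
  apply/subsetP=> u; rewrite !inE => /or4P[]/eqP->;
  by rewrite ?(adjVr yz) ?(adjVl yz) ?(adjVl tx) ?(adjVr tx).
by move: (eyz isT isT) etyz exx; clear; lia.
Qed.


Lemma ed_add_geq x A (l : seq V) : x \in V0 -> A \subset V0 -> x \notin A ->
  uniq l -> all [pred y | (y \in A) && adj x y] l -> ed A + size l <= ed (x |: A).
Proof.
move=> xV AV xA ul al; rewrite edD // leq_add2l -(card_uniqP ul).
apply: subset_leq_card; apply/subsetP=> y yl; rewrite inE.
exact: (allP al y yl).
Qed.

Lemma deg2E m v : #|N m| = 2 -> adj m v -> exists2 x, N m = [set v; x] & x != v.
Proof.
move=> /eqP/cards2P[x [y [xy Nm]]] mv.
have : v \in N m by rewrite inE.
rewrite Nm !inE => /orP[]/eqP->; first by exists y; rewrite // eq_sym.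
by exists x; rewrite // setUC.
Qed.

Lemma deg3E m v : #|N m| = 3 -> adj m v ->
  exists x y, [/\ N m = [set v; x; y], x != v, y != v & x != y].
Proof.
move=> c3 mv; have vN : v \in N m by rewrite inE.
have /cards2P[x [y [xy Nm]]] : #|N m :\ v| == 2.
  by rewrite (cardsD1 v) vN in c3; apply/eqP; case: c3.
exists x, y; split=> //.
- by rewrite -setUA -Nm setD1K.
- by move: (set21 x y); rewrite -Nm !inE => /andP[].
- by move: (set22 x y); rewrite -Nm !inE => /andP[].
Qed.

Lemma NE m v A : N m = A -> adj m v = (v \in A).
Proof. by move=> <-; rewrite inE. Qed.

Lemma deg_geq2 x : x \in V0 -> 1 < #|N x|.
Proof.
move=> xV; rewrite ltnNge; apply/negP=> le1.
have [|c cP] := @col_proper (V0 :\ x).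
  by rewrite properD1.
have [a aP] : exists a, forall y, y \in N x -> near5 a (c y + gn x y)%R.
  have [->|[y yN]] := set_0Vmem (N x); first by exists 0%R => y; rewrite inE.
  have /card_gt0P[a] := ltnW (card_grow1 (gn x y) (c y)).
  rewrite mem_grow1 => aP; exists a => z zN.
  by rewrite (card_le1_eqP le1 y z yN zN : z = y).
have [||cc _] := @col_upd c (V0 :\ x) x a cP.
- by rewrite !inE eqxx.
- by move=> y _ xy; apply: aP; rewrite inE.
by apply: nocol_sub cc; rewrite setD1K.
Qed.

Lemma card_grow2 d1 d2 b : 2 < #|grow d1 (grow d2 [set b])|.
Proof. by apply: card_grow_geq => //; exact: card_grow1. Qed.

Lemma card_grow3 d1 d2 d3 b : 3 < #|grow d1 (grow d2 (grow d3 [set b]))|.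
Proof. by apply: card_grow_geq => //; exact: card_grow2. Qed.

(** Once the three vertices are removed and the rest is coloured, [s1] has 2 values from [x] and 4
    from [y] across three edges, and [2 + 4 > 5]. The absence of triangles keeps [x] and [y] out of
    the removed set. *)
Lemma three_deg2 s1 s2 s3 : adj s1 s2 -> adj s2 s3 -> s1 != s3 ->
  #|N s1| = 2 -> #|N s2| = 2 -> #|N s3| = 2 -> False.
Proof.
move=> s12 s23 s13 d1 d2 d3.
have n12 := adj_neq s12; have n23 := adj_neq s23.
have s32 : adj s3 s2 by rewrite adjC.
have s21 : adj s2 s1 by rewrite adjC.
have [x N1 x2] := deg2E d1 s12.
have [y N3 y2] := deg2E d3 s32.
have [z N2 z1] := deg2E d2 s21.
have zs3 : z = s3.
  by apply/eqP; move: s23; rewrite (NE _ N2) !inE [s3 == s1]eq_sym (negPf s13) /= eq_sym.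
subst z.
have a1x : adj s1 x by rewrite (NE _ N1) set22.
have a3y : adj s3 y by rewrite (NE _ N3) set22.
have x1 : x != s1 by rewrite eq_sym adj_neq.
have y3 : y != s3 by rewrite eq_sym adj_neq.
have x3 : x != s3 by apply/eqP=> E; subst x; exact: (triangle_free s12 s23 a1x).
have y1 : y != s1 by apply/eqP=> E; subst y; apply: (triangle_free s12 s23); rewrite adjC.
pose A := V0 :\: [set s1; s2; s3].
have xA : x \in A by rewrite !inE !negb_or x1 x2 x3 (adjVr a1x).
have yA : y \in A by rewrite !inE !negb_or y1 y2 y3 (adjVr a3y).
have s1A : s1 \notin A by rewrite !inE eqxx.
have [|c cP] := @col_proper A.
  apply/properP; split; first exact: subsetDl.
  by exists s1; rewrite // (adjVl s12).
have [|a /andP[a1 a2]] := @common2 (grow (gn s1 x) [set c x])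
    (grow (gn s1 s2) (grow (gn s2 s3) (grow (gn s3 y) [set c y]))).
  by apply: (leq_add (card_grow1 _ _) (card_grow3 _ _ _ _)).
have [|c1 e1] := @col_upd c A s1 a cP s1A.
  move=> t tA; rewrite (NE _ N1) !inE => /orP[]/eqP E; subst t.
    by move: tA; rewrite !inE eqxx orbT.
  by rewrite -mem_grow1.
have [|||||||c2 [c2P _]] := @col_thread3 (upd c s1 a) (s1 |: A) s1 s2 s3 y c1.
- by rewrite !inE eqxx orbT /= orbF eq_sym.
- by rewrite !inE eqxx orbT /= orbF eq_sym.
- by rewrite !inE eqxx.
- by rewrite inE yA orbT.
- by rewrite N2.
- by rewrite N3 setUC.
- by rewrite updE (e1 y yA).
apply: nocol_sub c2P; apply/subsetP=> t tV; rewrite !inE tV.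
by do 3!case: (t == _).
Qed.

(** Folding [up] onto [uq] makes both edges ask the same of [u], which then behaves like a vertex of
    degree 2; the count [2 + 4 > 5] applies again. *)
Lemma thread3_deg3 u s1 s2 : #|N u| = 3 -> adj u s1 -> #|N s1| = 2 -> adj s1 s2 ->
  s2 != u -> #|N s2| = 2 -> False.
Proof.
move=> du us1 d1 s12 s2u d2.
have [p [q [Nu ps1 qs1 pq]]] := deg3E du us1.
have s1u : adj s1 u by rewrite adjC.
have s21 : adj s2 s1 by rewrite adjC.
have [z N1 zu] := deg2E d1 s1u.
have E : z = s2 by apply/eqP; move: s12; rewrite (NE _ N1) !inE (negPf s2u) /= eq_sym.
subst z.
have [y N2 ys1] := deg2E d2 s21.
have a2y : adj s2 y by rewrite (NE _ N2) set22.
have nus1 := adj_neq us1; have n12 := adj_neq s12.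
have yu : y != u by apply/eqP=> E; subst y; apply: (triangle_free us1 s12); rewrite adjC.
have ys2 : y != s2 by rewrite eq_sym adj_neq.
have up : adj u p by rewrite (NE _ Nu) !inE eqxx orbT.
have uq : adj u q by rewrite (NE _ Nu) !inE eqxx orbT.
have nus2 : ~~ adj u s2 by apply/negP=> us2; exact: (triangle_free us1 s12).
have ps2 : p != s2 by apply: contraTneq up => ->.
have qs2 : q != s2 by apply: contraTneq uq => ->.
pose A := V0 :\: [set u; s1; s2].
have uA : u \notin A by rewrite !inE eqxx.
have pA : p \in A by rewrite !inE !negb_or ps1 ps2 eq_sym adj_neq // (adjVr up).
have qA : q \in A by rewrite !inE !negb_or qs1 qs2 eq_sym adj_neq // (adjVr uq).
have yA : y \in A by rewrite !inE !negb_or ys1 ys2 yu (adjVr a2y).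
have [|c cP cpq] := @fold1 u p q A up uq pq uA pA qA.
  apply/properP; split.
    by apply/subsetP=> t; rewrite !inE => /orP[/eqP->|/andP[]//]; rewrite (adjVl up).
  by exists s1; rewrite ?(adjVr us1) // !inE eqxx orbT /= orbF eq_sym.
have [|a /andP[a1 a2]] := @common2 (grow (gn u p) [set c p])
    (grow (gn u s1) (grow (gn s1 s2) (grow (gn s2 y) [set c y]))).
  by apply: (leq_add (card_grow1 _ _) (card_grow3 _ _ _ _)).
rewrite mem_grow1 in a1.
have [|c1 e1] := @col_upd c A u a cP uA.
  move=> t tA; rewrite (NE _ Nu) !inE => /orP[/orP[]|] /eqP E; subst t => //.
    by move: tA; rewrite !inE eqxx orbT.
  by rewrite -cpq.
have [|||||||c2 [c2P _]] := @col_thread3 (upd c u a) (u |: A) u s1 s2 y c1.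
- by rewrite !inE eqxx orbT /= orbF eq_sym.
- by rewrite !inE eqxx orbT /= orbF.
- by rewrite !inE eqxx.
- by rewrite inE yA orbT.
- by rewrite N1.
- by rewrite N2.
- by rewrite updE (e1 y yA).
apply: nocol_sub c2P; apply/subsetP=> t tV; rewrite !inE tV.
by do 3!case: (t == _).
Qed.

(** The two further edges of [w] are folded and impose one and the same condition, so [w] acts as
    one more inner vertex of the thread. *)
Lemma col_fork c A v m w p q : col c A -> v \in A -> m \notin A -> w \notin A ->
  N m = [set v; w] -> N w = [set m; p; q] -> p \in A -> q \in A ->
  (c p + gn w p = c q + gn w q)%R ->
  c v \in grow (gn v m) (grow (gn m w) (grow (gn w p) [set c p])) ->
  exists c', col c' (w |: (m |: A)) /\ {in A, c' =1 c}.
Proof.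
move=> cA vA mA wA Nm Nw pA qA cpq cv.
have vm : adj v m by rewrite adjC (NE _ Nm) set21.
have mw : adj m w by rewrite (NE _ Nm) set22.
have [|c1 [col1 eq1 c1m]] := col_step cA mA vm cv.
  move=> y b yA; rewrite (NE _ Nm) !inE => /orP[/eqP->|/eqP yw]; first by rewrite eqxx.
  by rewrite yw (negPf wA) in yA.
have wmA : w \notin m |: A by rewrite !inE negb_or wA eq_sym adj_neq.
have [|c2 [col2 eq2 _]] := col_step col1 wmA mw c1m.
  move=> y b _; rewrite (NE _ Nw) in_setU in_set2 in_set1 => /orP[/orP[]|] /eqP->.
  - by rewrite eqxx.
  - by rewrite mem_grow1 (eq1 p pA).
  - by rewrite mem_grow1 (eq1 q qA) -cpq.
exists c2; split=> // y yA.
by rewrite eq2 ?eq1 // inE yA orbT.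
Qed.

(** The name counts edges; [a] and [b] are the inner vertices. Such a thread forbids at most one
    value of [u]. *)
Definition thread3 u a b :=
  [/\ adj u a, #|N a| = 2, adj a b, b != u & #|N b| = 2].

Lemma thread3E u a b : thread3 u a b ->
  exists y, [/\ N a = [set u; b], N b = [set a; y], adj b y, y != a & #|N y| != 2].
Proof.
case=> ua da ab bu db.
have au : adj a u by rewrite adjC.
have ba : adj b a by rewrite adjC.
have [z Na zu] := deg2E da au.
have E : z = b by apply/eqP; move: ab; rewrite (NE _ Na) !inE (negPf bu) /= eq_sym.
subst z; have [y Nb ya] := deg2E db ba.
have abY : adj b y by rewrite (NE _ Nb) set22.
exists y; split=> //; apply/negP=> /eqP dy.
by apply: (three_deg2 ab abY) => //; rewrite eq_sym.
Qed.

(** Each of the three threads leaves at least 4 values at [u], and so does [S]; four such sets in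
    Z/5 have a common element because [16 > 15]. *)
Lemma hub c A u a1 b1 y1 a2 b2 y2 a3 b3 y3 (S : {set 'Z_5}) : col c A ->
  uniq [:: u; a1; b1; a2; b2; a3; b3] ->
  all (fun x => x \notin A) [:: u; a1; b1; a2; b2; a3; b3] ->
  y1 \in A -> y2 \in A -> y3 \in A ->
  N a1 = [set u; b1] -> N b1 = [set a1; y1] ->
  N a2 = [set u; b2] -> N b2 = [set a2; y2] ->
  N a3 = [set u; b3] -> N b3 = [set a3; y3] ->
  (forall y, y \in A -> ~~ adj u y) -> 3 < #|S| ->
  exists c', [/\ col c' (b3 |: (a3 |: (b2 |: (a2 |: (b1 |: (a1 |: (u |: A))))))),
    {in A, c' =1 c} & c' u \in S].
Proof.
rewrite /= !inE !negb_or => cA.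
case/and5P=> /and5P[u1 u2 u3 u4 /andP[u5 u6]] /and5P[v1 v2 v3 v4 v5].
case/and4P=> w1 w2 w3 w4 /and3P[x1 x2 x3] /and3P[/andP[z1 z2] z3 _].
case/and5P=> uA a1A b1A a2A /and4P[b2A a3A b3A _] y1A y2A y3A.
move=> Na1 Nb1 Na2 Nb2 Na3 Nb3 Nu cS.
have [|a /and4P[aS g1 g2 g3]] := @common4 S
    (grow (gn u a1) (grow (gn a1 b1) (grow (gn b1 y1) [set c y1])))
    (grow (gn u a2) (grow (gn a2 b2) (grow (gn b2 y2) [set c y2])))
    (grow (gn u a3) (grow (gn a3 b3) (grow (gn b3 y3) [set c y3]))).
  apply: (@leq_trans (4 + 4 + 4 + 4)) => //.
  by rewrite !leq_add ?card_grow3.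
have [|c0 e0] := @col_upd c A u a cA uA.
  by move=> t tA; rewrite (negPf (Nu t tA)).
have cu : upd c u a u = a by rewrite updE.
set A0 := u |: A in c0; set f0 := upd c u a in c0 e0 cu.
have sA0 : {subset A <= A0} by move=> t tA; rewrite inE tA orbT.
have uA0 : u \in A0 by rewrite !inE eqxx.
have [||||f1 [c1 e1]] := @col_thread3 f0 A0 u a1 b1 y1 c0 _ _ uA0 _ Na1 Nb1.
- by rewrite /A0 !inE negb_or a1A eq_sym u1.
- by rewrite /A0 !inE negb_or b1A eq_sym u2.
- exact: sA0.
- by rewrite cu (e0 y1 y1A).
set A1 := b1 |: _ in c1.
have sA1 : {subset A0 <= A1} by move=> t tA; rewrite /A1 in_setU1 in_setU1 tA !orbT.
have [||||f2 [c2 e2]] := @col_thread3 f1 A1 u a2 b2 y2 c1 _ _ (sA1 _ uA0) _ Na2 Nb2.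
- by rewrite /A1 /A0 !inE !negb_or a2A ![a2 == _]eq_sym u3 v2 w1.
- by rewrite /A1 /A0 !inE !negb_or b2A ![b2 == _]eq_sym u4 v3 w2.
- exact/sA1/sA0.
- by rewrite (e1 u uA0) cu (e1 y2 (sA0 _ y2A)) (e0 y2 y2A).
set A2 := b2 |: _ in c2.
have sA2 : {subset A1 <= A2} by move=> t tA; rewrite /A2 in_setU1 in_setU1 tA !orbT.
have [||||f3 [c3 e3]] :=
  @col_thread3 f2 A2 u a3 b3 y3 c2 _ _ (sA2 _ (sA1 _ uA0)) _ Na3 Nb3.
- by rewrite /A2 /A1 /A0 !inE !negb_or a3A ![a3 == _]eq_sym u5 v4 w3 x2 z1.
- by rewrite /A2 /A1 /A0 !inE !negb_or b3A ![b3 == _]eq_sym u6 v5 w4 x3 z2.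
- exact/sA2/sA1/sA0.
- rewrite (e2 u (sA1 _ uA0)) (e1 u uA0) cu.
  by rewrite (e2 y3 (sA1 _ (sA0 _ y3A))) (e1 y3 (sA0 _ y3A)) (e0 y3 y3A).
exists f3; split=> [//|t tA|].
  by rewrite (e3 t (sA2 _ (sA1 _ (sA0 _ tA)))) (e2 t (sA1 _ (sA0 _ tA)))
    (e1 t (sA0 _ tA)) (e0 t tA).
by rewrite (e3 u (sA2 _ (sA1 _ uA0))) (e2 u (sA1 _ uA0)) (e1 u uA0) cu.
Qed.

Lemma thread3_nadj u a b : thread3 u a b -> ~~ adj u b.
Proof. by case=> ua _ ab _ _; apply/negP=> ub; exact: (triangle_free ua ab). Qed.

Lemma thread3_neq u a b a' b' : thread3 u a b -> thread3 u a' b' -> a != a' -> b != b'.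
Proof.
move=> [ua da ab bu db] [ua' da' ab' bu' db'] aa'; apply/eqP=> E; subst b'.
by apply: (three_deg2 ab _ aa') => //; rewrite adjC.
Qed.

Lemma adj_nadj_neq u x y : adj u x -> ~~ adj u y -> y != x.
Proof. by move=> ux; apply: contraNneq => ->. Qed.

Lemma deg_neq x y : #|N x| = 2 -> #|N y| != 2 -> y != x.
Proof. by move=> dx; apply: contraNneq => ->; rewrite dx. Qed.

(** The branch through [m] also forbids at most one value of [u]: it is a fourth thread of three
    edges if [w] has degree 2, and if [w] has degree 3 its two further edges are folded, so that [w]
    acts as an inner vertex. This caps what a vertex of degree 4 has to pay in the discharging. *)
Lemma hub_thread u a1 b1 a2 b2 a3 b3 m w : N u = m |: [set a1; a2; a3] ->
  uniq [:: m; a1; a2; a3] -> thread3 u a1 b1 -> thread3 u a2 b2 -> thread3 u a3 b3 ->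
  #|N m| = 2 -> adj m w -> w != u -> #|N w| = 2 \/ #|N w| = 3 -> False.
Proof.
move=> Nu; rewrite /= !inE !negb_or.
case/and4P=> /and3P[ma1 ma2 ma3] /andP[a12 a13] a23 _ T1 T2 T3 dm mw wu dw.
have um : adj u m by rewrite (NE _ Nu) !inE eqxx.
have mu : adj m u by rewrite adjC.
have [z Nm zu] := deg2E dm mu.
have E : z = w by apply/eqP; move: mw; rewrite (NE _ Nm) !inE (negPf wu) /= eq_sym.
subst z.
have nuw : ~~ adj u w by apply/negP=> uw; exact: (triangle_free um mw).
have [y1 [Na1 Nb1 by1 _ dy1]] := thread3E T1.
have [y2 [Na2 Nb2 by2 _ dy2]] := thread3E T2.
have [y3 [Na3 Nb3 by3 _ dy3]] := thread3E T3.
have nb1 := thread3_nadj T1; have nb2 := thread3_nadj T2; have nb3 := thread3_nadj T3.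
have b12 := thread3_neq T1 T2 a12; have b13 := thread3_neq T1 T3 a13.
have b23 := thread3_neq T2 T3 a23.
have wb i j : thread3 u i j -> m != i -> w != j.
  move=> T mi; case: dw => dw.
    by apply: (@thread3_neq u m w i j) => //; split.
  by case: T => _ _ _ _ dj; apply/eqP=> E; move: dw; rewrite E dj.
have wb1 := wb _ _ T1 ma1; have wb2 := wb _ _ T2 ma2; have wb3 := wb _ _ T3 ma3.
case: (T1) (T2) (T3) => [ua1 da1 ab1 bu1 db1] [ua2 da2 ab2 bu2 db2] [ua3 da3 ab3 bu3 db3].
have nub x y z : adj x z -> adj z y -> ~~ adj x y -> adj x y = false by move=> *; apply/negbTE.
have yu i y : ~~ adj u i -> adj i y -> y != u.
  by move=> ni iy; apply: contraNneq ni => yu; rewrite adjC -yu.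
have yu1 := yu _ _ nb1 by1; have yu2 := yu _ _ nb2 by2; have yu3 := yu _ _ nb3 by3.
have nadj2 := adj_nadj_neq.
pose A := V0 :\: (w |: (m |: (b3 |: (a3 |: (b2 |: (a2 |: (b1 |: (a1 |: [set u])))))))).
have inA y : y \in V0 -> #|N y| != 2 -> y != u -> y != w -> y \in A.
  move=> yV dy yu' yw; rewrite !inE yV !negb_or yu' yw.
  by rewrite !(@deg_neq _ y) //.
have uniqs : uniq [:: u; a1; b1; a2; b2; a3; b3].
  have [nua1 nua2 nua3] := And3 (adj_neq ua1) (adj_neq ua2) (adj_neq ua3).
  have [n11 n12 n13] := And3 (nadj2 _ _ _ ua1 nb1) (nadj2 _ _ _ ua1 nb2) (nadj2 _ _ _ ua1 nb3).
  have [n21 n22 n23] := And3 (nadj2 _ _ _ ua2 nb1) (nadj2 _ _ _ ua2 nb2) (nadj2 _ _ _ ua2 nb3).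
  have [n31 n32 n33] := And3 (nadj2 _ _ _ ua3 nb1) (nadj2 _ _ _ ua3 nb2) (nadj2 _ _ _ ua3 nb3).
  rewrite /= !inE !negb_or ?andbT.
  by do ![apply/andP; split]; first [assumption | rewrite eq_sym; assumption].
have notA : all (fun x => x \notin A) [:: u; a1; b1; a2; b2; a3; b3].
  by rewrite /= !inE !eqxx ?orbT.
have noNA y : y \in A -> ~~ adj u y.
  rewrite !inE !negb_or (NE _ Nu) !inE => /andP[].
  by case/andP=> _ /andP[/negPf-> /andP[_ /andP[/negPf-> /andP[_ /andP[/negPf-> /and3P[_ /negPf-> _]]]]]].
have AV : A \proper V0.
  apply/properP; split; first exact: subsetDl.
  by exists u; rewrite ?(adjVl um) // !inE eqxx !orbT.
set H := fun B => b3 |: (a3 |: (b2 |: (a2 |: (b1 |: (a1 |: (u |: B)))))).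
have notH x : x != u -> (forall i j, thread3 u i j -> m != i -> x != i) ->
    (forall i j, thread3 u i j -> m != i -> x != j) -> x \notin A -> x \notin H A.
  move=> xu xa xb xA; rewrite /H !in_setU1 !negb_or xu xA.
  by rewrite !(xa _ _ T1, xa _ _ T2, xa _ _ T3, xb _ _ T1, xb _ _ T2, xb _ _ T3).
have sH : {subset A <= H A} by move=> t tA; rewrite /H !in_setU1 tA !orbT.
have uH : u \in H A by rewrite /H !in_setU1 eqxx !orbT.
have mH : m \notin H A.
  apply: notH => [|//|i j T _|]; first by rewrite adj_neq.
    by rewrite eq_sym; apply: (nadj2 u) => //; exact: thread3_nadj T.
  by rewrite !inE eqxx orbT.
have wH : w \notin H A.
  apply: notH => [//|i j [ui _ _ _ _] _|//|]; first exact: (nadj2 u).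
  by rewrite !inE eqxx.
have cover : V0 \subset w |: (m |: H A).
  by apply/subsetP=> t tV; rewrite !inE tV; do 9!case: (t == _).
case: dw => dw.
  have T : thread3 u m w by split.
  have [y4 [_ Nw wy4 _ dy4]] := thread3E T.
  have y1A : y1 \in A by rewrite inA ?(adjVr by1) // deg_neq.
  have y2A : y2 \in A by rewrite inA ?(adjVr by2) // deg_neq.
  have y3A : y3 \in A by rewrite inA ?(adjVr by3) // deg_neq.
  have y4A : y4 \in A by rewrite inA ?(adjVr wy4) ?(yu w) // deg_neq.
  have [c cA] := col_proper AV.
  have [|f [fH ef fu]] := hub cA uniqs notA y1A y2A y3A Na1 Nb1 Na2 Nb2 Na3 Nb3 noNA
      (S := grow (gn u m) (grow (gn m w) (grow (gn w y4) [set c y4]))).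
    exact: card_grow3.
  have [|f2 [f2c _]] := col_thread3 fH mH wH uH (sH _ y4A) Nm Nw.
    by rewrite (ef y4 y4A).
  exact: nocol_sub f2c.
have wm : adj w m by rewrite adjC.
have [p [q [Nw pm qm pq]]] := deg3E dw wm.
(* The other threads cannot end in [w]: a vertex of degree 3 is the end of no thread of three
   edges. *)
have yw i j y : thread3 u i j -> m != i -> adj j y -> y != w.
  move=> T mi jy; have [ui di ij ju dj] := T.
  apply/eqP=> E; subst y.
  apply: (@thread3_deg3 w j i) => //; rewrite 1?adjC //.
  rewrite eq_sym; exact: (nadj2 u).
have y1A : y1 \in A by rewrite inA ?(adjVr by1) // (yw _ _ _ T1 ma1 by1).
have y2A : y2 \in A by rewrite inA ?(adjVr by2) // (yw _ _ _ T2 ma2 by2).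
have y3A : y3 \in A by rewrite inA ?(adjVr by3) // (yw _ _ _ T3 ma3 by3).
have inA2 x : adj w x -> x != m -> x \in A.
  move=> wx xm.
  have xi i j y : thread3 u i j -> m != i -> N i = [set u; j] -> N j = [set i; y] ->
      adj j y -> (x != i) && (x != j).
    move=> T mi Ni Nj jy; apply/andP; split; apply/eqP=> E; subst x.
      move: wx; rewrite adjC (NE _ Ni) !inE (negPf wu) /= => /eqP E.
      by have := wb _ _ T mi; rewrite E eqxx.
    move: wx; rewrite adjC (NE _ Nj) !inE => /orP[]/eqP E.
      by move: (nuw); case: T; rewrite -E => ->.
    by have := yw _ _ _ T mi jy; rewrite E eqxx.
  have /andP[x1 x2] := xi _ _ _ T1 ma1 Na1 Nb1 by1.
  have /andP[x3 x4] := xi _ _ _ T2 ma2 Na2 Nb2 by2.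
  have /andP[x5 x6] := xi _ _ _ T3 ma3 Na3 Nb3 by3.
  rewrite !inE (adjVr wx) !negb_or x1 x2 x3 x4 x5 x6 xm eq_sym adj_neq //= andbT.
  by apply: contraNneq nuw => <-; rewrite adjC.
have wp : adj w p by rewrite (NE _ Nw) !inE eqxx orbT.
have wq : adj w q by rewrite (NE _ Nw) !inE eqxx orbT.
have pA := inA2 _ wp pm; have qA := inA2 _ wq qm.
have wA : w \notin A by rewrite !inE eqxx.
have [|c cA cpq] := fold1 wp wq pq wA pA qA.
  apply/properP; split.
    by apply/subsetP=> t; rewrite in_setU1 => /orP[/eqP->|/(subsetP (proper_sub AV))//];
       rewrite (adjVl wp).
  exists u; rewrite ?(adjVl um) // in_setU1 negb_or eq_sym wu.
  by rewrite !inE eqxx !orbT.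
have [|f [fH ef fu]] := hub cA uniqs notA y1A y2A y3A Na1 Nb1 Na2 Nb2 Na3 Nb3 noNA
    (S := grow (gn u m) (grow (gn m w) (grow (gn w p) [set c p]))).
  exact: card_grow3.
have [||f2 [f2c _]] := col_fork fH uH mH wH Nm Nw (sH _ pA) (sH _ qA).
- by rewrite (ef p pA) (ef q qA).
- by rewrite (ef p pA).
exact: nocol_sub f2c.
Qed.

(** * Clusters of bad vertices *)

Lemma deg3E2 v m1 m2 : #|N v| = 3 -> adj v m1 -> adj v m2 -> m1 != m2 ->
  exists m3, [/\ N v = [set m1; m2; m3], m3 != m1 & m3 != m2].
Proof.
move=> dv v1 v2 n12; have [x [y [Nv x1 y1 xy]]] := deg3E dv v1.
move: v2; rewrite (NE _ Nv) !inE eq_sym (negPf n12) /= => /orP[]/eqP E; subst m2.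
  by exists y; split; rewrite // eq_sym.
by exists x; split; rewrite // Nv -!setUA [X in _ :|: X]setUC.
Qed.

Lemma uniq_leq_card (l : seq V) : uniq l -> {subset l <= V0} -> size l <= #|V0|.
Proof.
move=> ul sl; rewrite -(card_uniqP ul); apply: subset_leq_card.
exact/subsetP.
Qed.

(** The charge is [18 * 3 - 44 = 10], but three neighbours of degree 2 expect 4 each. These vertices
    are 2 short, which is why they are singled out. *)
Definition bad v := #|N v| = 3 /\ forall m, adj v m -> #|N m| = 2.

Lemma bad_thread v m u : bad v -> adj v m -> adj m u -> u != v -> #|N u| != 2.
Proof.
move=> [dv v2] vm mu uv; apply/eqP=> du.
exact: (thread3_deg3 dv vm (v2 _ vm) mu uv du).
Qed.

(** Supplies the fifth vertex that excluding 4-cycles asks for. *)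
Lemma bad_big v : v \in V0 -> bad v -> 4 < #|V0|.
Proof.
move=> vV [dv v2].
have /set0Pn[m] : N v != set0 by rewrite -card_gt0 dv.
rewrite inE => vm; have [x [y [Nv xm ym xy]]] := deg3E dv vm.
have mv : adj m v by rewrite adjC.
have [u Nm uv] := deg2E (v2 m vm) mv.
have vx : adj v x by rewrite (NE _ Nv) !inE eqxx orbT.
have vy : adj v y by rewrite (NE _ Nv) !inE eqxx orbT.
have mu : adj m u by rewrite (NE _ Nm) set22.
have nu : ~~ adj v u by apply/negP=> vu; exact: (triangle_free vm mu).
apply: (@uniq_leq_card [:: v; m; x; y; u]) => /=.
  have [nvm nvx nvy] := And3 (adj_neq vm) (adj_neq vx) (adj_neq vy).
  have nmu := adj_neq mu; have [ux uy] := (adj_nadj_neq vx nu, adj_nadj_neq vy nu).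
  rewrite /= !inE !negb_or ?andbT.
  by do ![apply/andP; split]; first [assumption | rewrite eq_sym; assumption].
move=> z; rewrite !inE => /or4P[|||/orP[]] /eqP->.
- by [].
- exact: adjVr vm.
- exact: adjVr vx.
- exact: adjVr vy.
- exact: adjVr mu.
Qed.

Lemma square_nadj x y z t : 4 < #|V0| -> adj x y -> adj y z -> adj x t ->
  x != z -> y != t -> ~~ adj z t.
Proof.
move=> V4 xy yz xt xz yt; apply/negP=> zt.
by apply: (square_free xy yz zt) => //; rewrite adjC.
Qed.

(** Nine vertices are removed: the three bad ones, the middles of the three threads between them,
    and the middles of their outer threads. Each outer thread leaves three values at its bad vertex,
    and [triangle_lists] matches these values along the inner threads. The case has to be settled
    before [bad_pair], whose folds need four distinct vertices. *)
Lemma bad_triangle v u1 u2 m1 m2 p : bad v -> bad u1 -> bad u2 ->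
  adj v m1 -> adj m1 u1 -> adj v m2 -> adj m2 u2 -> adj u1 p -> adj p u2 ->
  u1 != v -> u2 != v -> u1 != u2 -> m1 != m2 -> False.
Proof.
move=> bv bu1 bu2 vm1 m1u1 vm2 m2u2 u1p pu2 u1v u2v u12 m12.
have V4 := bad_big (adjVl vm1) bv; have sqn x y z t := @square_nadj x y z t V4.
have u1m1 : adj u1 m1 by rewrite adjC.
have u2m2 : adj u2 m2 by rewrite adjC.
have u2p : adj u2 p by rewrite adjC.
have m1v : adj m1 v by rewrite adjC.
have m2v : adj m2 v by rewrite adjC.
have pu1 : adj p u1 by rewrite adjC.
have [[dv v2] [d1 a1] [d2 a2]] := And3 bv bu1 bu2.
have vu1 : v != u1 by rewrite eq_sym.
have vu2 : v != u2 by rewrite eq_sym.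
have u21 : u2 != u1 by rewrite eq_sym.
have m21 : m2 != m1 by rewrite eq_sym.
have n1 : ~~ adj u1 m2 := sqn _ _ _ _ vm1 m1u1 vm2 vu1 m12.
have n2 : ~~ adj u2 m1 := sqn _ _ _ _ vm2 m2u2 vm1 vu2 m21.
have pm1 : p != m1 by apply: contraNneq n2 => <-.
have pm2 : p != m2 by apply: contraNneq n1 => <-.
have np : ~~ adj v p by apply: (sqn u1 m1 v p) => //; rewrite eq_sym.
have [m3 [Nv m31 m32]] := deg3E2 dv vm1 vm2 m12.
have m1p : m1 != p by rewrite eq_sym.
have m2p : m2 != p by rewrite eq_sym.
have [q1 [N1 q1m q1p]] := deg3E2 d1 u1m1 u1p m1p.
have [q2 [N2 q2m q2p]] := deg3E2 d2 u2m2 u2p m2p.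
have vm3 : adj v m3 by rewrite (NE _ Nv) !inE eqxx orbT.
have u1q : adj u1 q1 by rewrite (NE _ N1) !inE eqxx orbT.
have u2q : adj u2 q2 by rewrite (NE _ N2) !inE eqxx orbT.
have n3 : ~~ adj u1 m3 by apply: (sqn v m1 u1 m3) => //; rewrite eq_sym.
have n4 : ~~ adj u2 m3 by apply: (sqn v m2 u2 m3) => //; rewrite eq_sym.
have n5 : ~~ adj v q1 by apply: (sqn u1 m1 v q1) => //; rewrite eq_sym.
have n6 : ~~ adj v q2 by apply: (sqn u2 m2 v q2) => //; rewrite eq_sym.
have n7 : ~~ adj u2 q1 by apply: (sqn u1 p u2 q1) => //; rewrite eq_sym.
have n8 : ~~ adj u1 q2 by apply: (sqn u2 p u1 q2) => //; rewrite eq_sym.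
have m3v : adj m3 v by rewrite adjC.
have q1u : adj q1 u1 by rewrite adjC.
have q2u : adj q2 u2 by rewrite adjC.
have [w3 Nm3 w3v] := deg2E (v2 _ vm3) m3v.
have [w1 Nq1 w1u] := deg2E (a1 _ u1q) q1u.
have [w2 Nq2 w2u] := deg2E (a2 _ u2q) q2u.
have E2 x y z : adj x y -> adj x z -> y != z -> #|N x| = 2 -> N x = [set y; z].
  move=> xy xz yz dx; have [t Nx ty] := deg2E dx xy.
  by move: xz; rewrite (NE _ Nx) !inE eq_sym (negPf yz) /= => /eqP->.
have Nm1 := E2 _ _ _ m1v m1u1 vu1 (v2 _ vm1).
have Nm2 := E2 _ _ _ m2v m2u2 vu2 (v2 _ vm2).
have Np := E2 _ _ _ pu1 pu2 u12 (a1 _ u1p).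
have mw3 : adj m3 w3 by rewrite (NE _ Nm3) set22.
have qw1 : adj q1 w1 by rewrite (NE _ Nq1) set22.
have qw2 : adj q2 w2 by rewrite (NE _ Nq2) set22.
pose S := [:: v; u1; u2; m3; q1; q2; m1; m2; p].
pose A := V0 :\: [set x in S].
have ne23 x y : #|N x| = 2 -> #|N y| = 3 -> x != y.
  by move=> dx dy; apply/eqP=> E; move: dx; rewrite E dy.
have [dm1 dm2 dm3] := And3 (v2 _ vm1) (v2 _ vm2) (v2 _ vm3).
have [dq1 dq2 dp] := And3 (a1 _ u1q) (a2 _ u2q) (a1 _ u1p).
have [h1 h2 h3] := And3 (adj_nadj_neq u1q n3) (adj_nadj_neq u2q n4) (adj_nadj_neq u2q n7).
have [h4 h5 h6] := And3 (adj_nadj_neq vm2 n5) (adj_nadj_neq vm1 n6) (adj_nadj_neq u1p n3).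
have outA x i j : bad i -> adj i j -> adj j x -> x != i -> x \notin [:: v; u1; u2] -> x \in A.
  move=> bi ij jx xi; rewrite !inE !negb_or => /and3P[-> -> ->] /=.
  have dx := bad_thread bi ij jx xi.
  by rewrite (adjVr jx) andbT !(deg_neq _ dx).
have w3A : w3 \in A.
  apply: (outA _ v m3) => //; rewrite !inE !negb_or w3v /=.
  by apply/andP; split; [apply: contraNneq n3 | apply: contraNneq n4] => <-; rewrite adjC.
have w1A : w1 \in A.
  apply: (outA _ u1 q1) => //; rewrite !inE !negb_or w1u /=.
  by apply/andP; split; [apply: contraNneq n5 | apply: contraNneq n7] => <-; rewrite adjC.
have w2A : w2 \in A.
  apply: (outA _ u2 q2) => //; rewrite !inE !negb_or w2u andbT /=.
  by apply/andP; split; [apply: contraNneq n6 | apply: contraNneq n8] => <-; rewrite adjC.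
have nSA x : x \in S -> x \notin A by move=> xS; rewrite !inE negb_and negbK in xS *; rewrite xS.
have [|c cA] := @col_proper A.
  apply/properP; split; first exact: subsetDl.
  by exists v; rewrite ?(adjVl vm1) // nSA // !inE eqxx.
(* The centres of the three lists: the values carried along the outer threads when their two signs
   cancel. *)
pose X3 := (c w3 + gn m3 w3 + gn v m3)%R.
pose X1 := (c w1 + gn q1 w1 + gn u1 q1)%R.
pose X2 := (c w2 + gn q2 w2 + gn u2 q2)%R.
have [k1 [k2 [k3 [k1d k2d k3d [r1 r2 r3]]]]] := triangle_lists
  (X1 - X3 + (gn m1 u1 + gn v m1))%R (X2 - X3 + (gn m2 u2 + gn v m2))%R
  (X1 - X2 - (gn p u2 + gn u1 p))%R.
set av := (X3 + k3)%R; set b1 := (X1 + k1)%R; set b2 := (X2 + k2)%R.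
have nA : [/\ v \notin A, u1 \notin A & u2 \notin A].
  by split; apply: nSA; rewrite !inE eqxx ?orbT.
have [vA u1A u2A] := nA.
have nmA : [/\ m1 \notin A, m2 \notin A & m3 \notin A].
  by split; apply: nSA; rewrite !inE eqxx ?orbT.
have [m1A m2A m3A] := nmA.
have nqA : [/\ q1 \notin A, q2 \notin A & p \notin A].
  by split; apply: nSA; rewrite !inE eqxx ?orbT.
have [q1A q2A pA] := nqA.
have hA x y : bad x -> adj x y -> y \in A -> y \in [:: m1; m2; m3; p; q1; q2] -> False.
  by move=> _ _ yA; rewrite !inE => /or4P[|||/or3P[]] /eqP E; subst y; move: yA; apply/negP.
have [|cv ev] := @col_upd c A v av cA vA.
  move=> y yA vy; case: (hA v y bv vy yA).
  by move: vy; rewrite (NE _ Nv) !inE => /orP[/orP[]|] ->; rewrite ?orbT.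
set c1 := upd c v av in cv ev; set A1 := v |: A in cv.
have u1A1 : u1 \notin A1 by rewrite in_setU1 negb_or u1v.
have [|cu1 eu1] := @col_upd c1 A1 u1 b1 cv u1A1.
  move=> y; rewrite in_setU1 => /orP[/eqP-> u1v'|yA u1y].
    by have := a1 _ u1v'; rewrite dv.
  case: (hA u1 y bu1 u1y yA).
  by move: u1y; rewrite (NE _ N1) !inE => /orP[/orP[]|] ->; rewrite ?orbT.
set c2 := upd c1 u1 b1 in cu1 eu1; set A2 := u1 |: A1 in cu1.
have u2A2 : u2 \notin A2 by rewrite !in_setU1 !negb_or u21 u2v.
have [|cu2 eu2] := @col_upd c2 A2 u2 b2 cu1 u2A2.
  move=> y; rewrite !in_setU1 => /or3P[/eqP-> u2v'|/eqP-> u2v'|yA u2y].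
  - by have := a2 _ u2v'; rewrite d1.
  - by have := a2 _ u2v'; rewrite dv.
  case: (hA u2 y bu2 u2y yA).
  by move: u2y; rewrite (NE _ N2) !inE => /orP[/orP[]|] ->; rewrite ?orbT.
set c3 := upd c2 u2 b2 in cu2 eu2; set A3 := u2 |: A2 in cu2.
have vals : [/\ c3 v = av, c3 u1 = b1 & c3 u2 = b2].
  by rewrite /c3 /c2 /c1 /upd (negPf vu2) (negPf vu1) (negPf u12) !eqxx.
have c3A : {in A, c3 =1 c}.
  move=> y yA; have yA1 : y \in A1 by rewrite in_setU1 yA orbT.
  have yA2 : y \in A2 by rewrite in_setU1 yA1 orbT.
  by rewrite (eu2 y yA2) (eu1 y yA1) (ev y yA).
have A3s : [/\ v \in A3, u1 \in A3 & u2 \in A3].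
  by split; rewrite !in_setU1 eqxx ?orbT.
have [vA3 u1A3 u2A3] := A3s.
have AA3 : {subset A <= A3} by move=> y yA; rewrite !in_setU1 yA !orbT.
have ext f B m x y : col f B -> {subset A3 <= B} -> {in A3, f =1 c3} ->
    m \notin B -> x \in A3 -> y \in A3 -> N m = [set x; y] ->
    (c3 x - (c3 y + gn m y + gn x m))%R \in dist2 ->
    exists f', [/\ col f' (m |: B), {subset A3 <= m |: B} & {in A3, f' =1 c3}].
  move=> fB sB ef mB xA yA Nm H.
  have [|f' [f'B ef']] := col_thread2 fB mB (sB _ xA) Nm.
    by rewrite (ef x xA) (ef y yA); apply: mem_grow2.
  exists f'; split=> // z zA; first by rewrite in_setU1 sB ?orbT.
  by rewrite ef' ?ef ?sB.
have [eav eb1 eb2] := vals.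
have [||f1 [g1 s1 e1]] := ext c3 A3 m3 v w3 cu2
  (fun _ H => H) (fun _ _ => erefl) _ vA3 (AA3 _ w3A) Nm3 _.
- rewrite !in_setU1 !negb_or m3A andbT.
  by do ![apply/andP; split]; by apply: ne23.
- by rewrite eav (c3A _ w3A) /av /X3 addrC addKr.
have [||f2 [g2 s2 e2]] := ext f1 _ q1 u1 w1 g1 s1 e1 _ u1A3 (AA3 _ w1A) Nq1 _.
- rewrite !in_setU1 !negb_or q1A andbT.
  by do ![apply/andP; split]; first [assumption | rewrite eq_sym; assumption | by apply: ne23].
- by rewrite eb1 (c3A _ w1A) /b1 /X1 addrC addKr.
have [||f3 [g3 s3 e3]] := ext f2 _ q2 u2 w2 g2 s2 e2 _ u2A3 (AA3 _ w2A) Nq2 _.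
- rewrite !in_setU1 !negb_or q2A andbT.
  by do ![apply/andP; split]; first [assumption | rewrite eq_sym; assumption | by apply: ne23].
- by rewrite eb2 (c3A _ w2A) /b2 /X2 addrC addKr.
have [||f4 [g4 s4 e4]] := ext f3 _ m1 v u1 g3 s3 e3 _ vA3 u1A3 Nm1 _.
- rewrite !in_setU1 !negb_or m1A andbT.
  by do ![apply/andP; split]; first [assumption | rewrite eq_sym; assumption | by apply: ne23].
- apply: dist2N; rewrite eav eb1; rewrite /av /b1.
  rewrite (_ : (- _ = X1 - X3 + (gn m1 u1 + gn v m1) + k1 - k3)%R) //; ring.
have [||f5 [g5 s5 e5]] := ext f4 _ m2 v u2 g4 s4 e4 _ vA3 u2A3 Nm2 _.
- rewrite !in_setU1 !negb_or m2A andbT.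
  by do ![apply/andP; split]; first [assumption | rewrite eq_sym; assumption | by apply: ne23].
- apply: dist2N; rewrite eav eb2; rewrite /av /b2.
  rewrite (_ : (- _ = X2 - X3 + (gn m2 u2 + gn v m2) + k2 - k3)%R) //; ring.
have [||f6 [g6 _ _]] := ext f5 _ p u1 u2 g5 s5 e5 _ u1A3 u2A3 Np _.
- rewrite !in_setU1 !negb_or pA andbT.
  by do ![apply/andP; split]; first [assumption | rewrite eq_sym; assumption | by apply: ne23].
- rewrite eb1 eb2; rewrite /b1 /b2.
  rewrite [X in X \in _](_ : _ = X1 - X2 - (gn p u2 + gn u1 p) + k1 - k2)%R //; ring.
apply: nocol_sub g6; apply/subsetP=> t tV; rewrite !inE tV.
by do 9!case: (t == _).
Qed.

(** If [B] contains both pairs, identifying them costs [2 * 11]. Adding [u1], [u2], [m1], [m2] and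
    [v] brings 5 vertices and 8 edges, so by the gap the image has potential at least
    [12 + 8 * 9 - 5 * 11 - 22 = 7], without any slack. *)
Lemma fold2 v m1 m2 m3 u1 u2 u3 p1 q1 p2 q2 A :
  adj v m1 -> adj v m2 -> adj v m3 -> adj m1 u1 -> adj m2 u2 -> adj m3 u3 ->
  adj u1 p1 -> adj u1 q1 -> adj u2 p2 -> adj u2 q2 ->
  uniq [:: v; m1; m2; m3; u1; u2] -> uniq [:: p1; q1; p2; q2] ->
  A \subset V0 -> all (fun x => x \notin A) [:: v; m1; m2; m3; u1; u2] ->
  all (fun x => x \in A) [:: p1; q1; p2; q2] ->
  exists c, [/\ col c A, (c p1 + gn u1 p1 = c q1 + gn u1 q1)%R
    & (c p2 + gn u2 p2 = c q2 + gn u2 q2)%R].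
Proof.
move=> vm1 vm2 vm3 mu1 mu2 mu3 up1 uq1 up2 uq2.
rewrite /= !inE !negb_or => /and5P[/and5P[v1 v2 v3 v4 v5] /and4P[m12 m13 m14 m15]
  /and3P[m23 m24 m25] /andP[m34 m35] /andP[u12 _]].
case/and4P=> /and3P[pq1 p12 pq12] /andP[qp12 qq12] pq2 _ AV.
case/and5P=> vA m1A m2A m3A /and3P[u1A u2A _] /and5P[p1A q1A p2A q2A _].
pose h x := if x == q1 then p1 else if x == q2 then p2 else x.
pose sh x : 'Z_5 := if x == q1 then (gn u1 p1 - gn u1 q1)%R else
  if x == q2 then (gn u2 p2 - gn u2 q2)%R else 0%R.
have hq1 : h q1 = p1 by rewrite /h eqxx.
have hp1 : h p1 = p1 by rewrite /h (negPf pq1) (negPf pq12).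
have hq2 : h q2 = p2 by rewrite /h eqxx eq_sym (negPf qq12).
have hp2 : h p2 = p2 by rewrite /h (negPf pq2) eq_sym (negPf qp12).
have [|B BA B0 sat|c cP] := @idc A h sh AV.
- apply: leq_ltn_trans (leq_imset_card _ _) _; apply: proper_card.
  by apply/properP; split=> //; exists v; rewrite ?(adjVl vm1).
- have BV := subset_trans BA AV.
  have nB x : x \notin A -> x \notin B by apply: contraNN; exact: (subsetP BA).
  have q1B : (q1 \in B) = (p1 \in B) by apply/idP/idP; apply: sat; rewrite ?hq1 ?hp1.
  have q2B : (q2 \in B) = (p2 \in B) by apply/idP/idP; apply: sat; rewrite ?hq2 ?hp2.
  have cB : #|B| <= #|h @: B| + ((p1 \in B) + (p2 \in B)).
    have sub : B \subset h @: B :|: [set q1; q2] :&: B.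
      apply/subsetP=> x xB; rewrite !inE.
      have [x1|x1] := eqVneq x q1; first by rewrite /= xB orbT.
      have [x2|x2] := eqVneq x q2; first by rewrite /= xB orbT.
      by apply/orP; left; apply/imsetP; exists x; rewrite // /h (negPf x1) (negPf x2).
    apply: leq_trans (subset_leq_card sub) _; rewrite cardsU.
    apply: leq_trans (leq_subr _ _) _; rewrite leq_add2l setIUl cardsU.
    apply: leq_trans (leq_subr _ _) _; rewrite -q1B -q2B.
    have one q : #|[set q] :&: B| <= (q \in B).
      case qB: (q \in B); first by rewrite /= -(cards1 q) subset_leq_card // subsetIl.
      by rewrite leqn0 cards_eq0 setI_eq0 disjoints1 qB.
    exact: leq_add.
  have vB := nB _ vA; have m1B := nB _ m1A; have m2B := nB _ m2A; have m3B := nB _ m3A.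
  have u1B := nB _ u1A; have u2B := nB _ u2A.
  (* One identified pair is a single fold: [12 + 2 * 9 - 11 = 19] pays for the 11 that are lost and
     leaves 8. *)
  have single u p q : adj u p -> adj u q -> p != q -> u \notin B -> u != v ->
      p \in B -> q \in B -> 9 * ed B + 7 <= 11 * #|B| - 11.
    move=> up uq pq uB uv pB qB.
    have pr : u |: B \proper V0.
      apply/properP; split.
        by apply/subsetP=> x; rewrite in_setU1 => /orP[/eqP->|/(subsetP BV)//]; rewrite (adjVl up).
      by exists v; rewrite ?(adjVl vm1) // in_setU1 negb_or vB eq_sym uv.
    have := @ed_close u p q B up uq pq BV uB pB qB.
    have cU : #|u |: B| = #|B|.+1 by rewrite cardsU1 uB.
    have cB1 : 0 < #|B| by rewrite card_gt0.
    have := gapA pr; rewrite cU.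
    by move: (ed _) (ed _) #|B| cB1; clear; lia.
  move: q1B q2B cB; case p1B: (p1 \in B); case p2B: (p2 \in B) => q1B q2B cB.
  + have sB1 : u1 |: B \subset V0.
      by apply/subsetP=> x; rewrite in_setU1 => /orP[/eqP->|/(subsetP BV)//]; rewrite (adjVl up1).
    have e1 := @ed_add_geq u1 B [:: p1; q1] (adjVl up1) BV u1B.
    have sB2 : u2 |: (u1 |: B) \subset V0.
      by apply/subsetP=> x; rewrite in_setU1 => /orP[/eqP->|/(subsetP sB1)//]; rewrite (adjVl up2).
    have e2 := @ed_add_geq u2 (u1 |: B) [:: p2; q2] (adjVl up2) sB1.
    have sB3 : m1 |: (u2 |: (u1 |: B)) \subset V0.
      by apply/subsetP=> x; rewrite in_setU1 => /orP[/eqP->|/(subsetP sB2)//]; rewrite (adjVl mu1).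
    have e3 := @ed_add_geq m1 (u2 |: (u1 |: B)) [:: u1] (adjVl mu1) sB2.
    have sB4 : m2 |: (m1 |: (u2 |: (u1 |: B))) \subset V0.
      by apply/subsetP=> x; rewrite in_setU1 => /orP[/eqP->|/(subsetP sB3)//]; rewrite (adjVl mu2).
    have e4 := @ed_add_geq m2 (m1 |: (u2 |: (u1 |: B))) [:: u2] (adjVl mu2) sB3.
    have u2N : u2 \notin u1 |: B by rewrite !in_setU1 !negb_or u2B eq_sym u12.
    have m1N : m1 \notin u2 |: (u1 |: B) by rewrite !in_setU1 !negb_or m1B m14 m15.
    have m2N : m2 \notin m1 |: (u2 |: (u1 |: B)).
      by rewrite !in_setU1 !negb_or m2B m24 m25 eq_sym m12.
    have {e1} := e1 _ _; rewrite /= !inE pq1 p1B q1B up1 uq1 => /(_ isT isT) e1.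
    have {e2} := e2 u2N _ _; rewrite /= !inE pq2 p2B q2B up2 uq2 !orbT => /(_ isT isT) e2.
    have {e3} := e3 m1N _ _; rewrite /= !inE eqxx mu1 !orbT => /(_ isT isT) e3.
    have {e4} := e4 m2N _ _; rewrite /= !inE eqxx mu2 !orbT => /(_ isT isT) e4.
    have c4 : #|m2 |: (m1 |: (u2 |: (u1 |: B)))| = #|B| + 4.
      by rewrite !cardsU1 m2N m1N u2N u1B; move: #|B|; clear; lia.
    set B4 := m2 |: _ in sB4 e4 c4.
    have vB4 : v \notin B4.
      by rewrite !in_setU1 !negb_or vB v1 v2 v4 v5.
    have m3B4 : m3 \notin B4.
      by rewrite !in_setU1 !negb_or m3B m34 m35 eq_sym m23 eq_sym m13.
    have m1B4 : m1 \in B4 by rewrite !in_setU1 eqxx ?orbT.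
    have m2B4 : m2 \in B4 by rewrite !in_setU1 eqxx ?orbT.
    have BB4 : B \subset B4 by apply/subsetP=> x xB; rewrite !in_setU1 xB !orbT.
    (* With [u3] in [B] the vertex [m3] is added as well. This may exhaust [V0], where only the
       bound 7 holds, but two more edges make up for it: [7 + 10 * 9 - 6 * 11 - 22 = 9]. Otherwise
       [m3] stays outside and the set is proper. *)
    have [u3B|u3B] := boolP (u3 \in B).
      have sB5 : m3 |: B4 \subset V0.
        by apply/subsetP=> x; rewrite in_setU1 => /orP[/eqP->|/(subsetP sB4)//]; rewrite (adjVl mu3).
      have := @ed_add_geq m3 B4 [:: u3] (adjVl mu3) sB4 m3B4.
      rewrite /= (subsetP BB4) // mu3 => /(_ isT isT) e5.
      have vB5 : v \notin m3 |: B4 by rewrite in_setU1 negb_or v3.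
      have := @ed_add_geq v (m3 |: B4) [:: m1; m2; m3] (adjVl vm1) sB5 vB5.
      rewrite /= !(in_setU1 _ m3) eqxx m1B4 m2B4 !inE negb_or m12 m13 m23 vm1 vm2 vm3 !orbT.
      move=> /(_ isT isT) e6.
      have sB6 : v |: (m3 |: B4) \subset V0.
        by apply/subsetP=> x; rewrite in_setU1 => /orP[/eqP->|/(subsetP sB5)//]; rewrite (adjVl vm1).
      have := sp sB6; rewrite cardsU1 vB5 cardsU1 m3B4 c4.
      have -> : v |: (m3 |: B4) != set0 by apply/set0Pn; exists v; rewrite !inE eqxx.
      move/(_ isT); move: e1 e2 e3 e4 e5 e6 cB; clear.
      by move: #|B| #|h @: B|; lia.
    have := @ed_add_geq v B4 [:: m1; m2] (adjVl vm1) sB4 vB4.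
    rewrite /= m1B4 m2B4 !inE m12 vm1 vm2 => /(_ isT isT) e6.
    have sB6 : v |: B4 \proper V0.
      apply/properP; split.
        by apply/subsetP=> x; rewrite in_setU1 => /orP[/eqP->|/(subsetP sB4)//]; rewrite (adjVl vm1).
      by exists m3; rewrite ?(adjVr vm3) // in_setU1 negb_or m3B4 eq_sym v3.
    have := gapA sB6; rewrite cardsU1 vB4 c4.
    move: e1 e2 e3 e4 e6 cB; clear.
    by move: #|B| #|h @: B|; lia.
  + have uv : u1 != v by rewrite eq_sym.
    have := single u1 p1 q1 up1 uq1 pq1 u1B uv p1B q1B.
    have : 0 < #|B| by rewrite card_gt0.
    by move: cB; clear; move: #|B| #|h @: B|; lia.
  + have uv : u2 != v by rewrite eq_sym.
    have := single u2 p2 q2 up2 uq2 pq2 u2B uv p2B q2B.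
    have : 0 < #|B| by rewrite card_gt0.
    by move: cB; clear; move: #|B| #|h @: B|; lia.
  by have := sp BV B0; move: cB; clear; move: #|B| #|h @: B|; lia.
exists (fun x => c (h x) + sh x)%R; split=> //.
  by rewrite hp1 hq1 /sh eqxx (negPf pq1) (negPf pq12); ring.
by rewrite hp2 hq2 /sh eqxx (negPf pq2) eq_sym (negPf qp12) eq_sym (negPf qq12); ring.
Qed.

(** The outer edges at [u1] and at [u2] are folded. The threads towards them then leave 4 values
    each at [v], the third thread leaves 3, and [4 + 4 + 3 > 10]. The four outer neighbours are
    distinct by [bad_triangle]. *)
Lemma bad_pair v u1 u2 m1 m2 : bad v -> bad u1 -> bad u2 ->
  adj v m1 -> adj m1 u1 -> adj v m2 -> adj m2 u2 ->
  u1 != v -> u2 != v -> m1 != m2 -> False.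
Proof.
move=> bv bu1 bu2 vm1 m1u1 vm2 m2u2 u1v u2v m12.
have V4 := bad_big (adjVl vm1) bv; have sqn x y z t := @square_nadj x y z t V4.
have u1m1 : adj u1 m1 by rewrite adjC.
have u2m2 : adj u2 m2 by rewrite adjC.
have m1v : adj m1 v by rewrite adjC.
have m2v : adj m2 v by rewrite adjC.
have [[dv v2] [d1 a1] [d2 a2]] := And3 bv bu1 bu2.
have vu1 : v != u1 by rewrite eq_sym.
have vu2 : v != u2 by rewrite eq_sym.
have m21 : m2 != m1 by rewrite eq_sym.
have n1 : ~~ adj u1 m2 := sqn _ _ _ _ vm1 m1u1 vm2 vu1 m12.
have n2 : ~~ adj u2 m1 := sqn _ _ _ _ vm2 m2u2 vm1 vu2 m21.
have u12 : u1 != u2 by apply: contraNneq n1 => ->.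
have [m3 [Nv m31 m32]] := deg3E2 dv vm1 vm2 m12.
have [p1 [q1 [N1 p1m q1m pq1]]] := deg3E d1 u1m1.
have [p2 [q2 [N2 p2m q2m pq2]]] := deg3E d2 u2m2.
have vm3 : adj v m3 by rewrite (NE _ Nv) !inE eqxx orbT.
have u1p : adj u1 p1 by rewrite (NE _ N1) !inE eqxx orbT.
have u1q : adj u1 q1 by rewrite (NE _ N1) !inE eqxx orbT.
have u2p : adj u2 p2 by rewrite (NE _ N2) !inE eqxx orbT.
have u2q : adj u2 q2 by rewrite (NE _ N2) !inE eqxx orbT.
have np : ~~ adj u2 p1.
  apply/negP; rewrite adjC => pu2.
  exact: (bad_triangle bv bu1 bu2 vm1 m1u1 vm2 m2u2 u1p pu2).
have nq : ~~ adj u2 q1.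
  apply/negP; rewrite adjC => pu2.
  exact: (bad_triangle bv bu1 bu2 vm1 m1u1 vm2 m2u2 u1q pu2).
have n3 : ~~ adj u1 m3 by apply: (sqn v m1 u1 m3) => //; rewrite eq_sym.
have n4 : ~~ adj u2 m3 by apply: (sqn v m2 u2 m3) => //; rewrite eq_sym.
have m3v : adj m3 v by rewrite adjC.
have [u3 Nm3 u3v] := deg2E (v2 _ vm3) m3v.
have m3u3 : adj m3 u3 by rewrite (NE _ Nm3) set22.
have E2 x y z : adj x y -> adj x z -> y != z -> #|N x| = 2 -> N x = [set y; z].
  move=> xy xz yz dx; have [t Nx ty] := deg2E dx xy.
  by move: xz; rewrite (NE _ Nx) !inE eq_sym (negPf yz) /= => /eqP->.
have Nm1 := E2 _ _ _ m1v m1u1 vu1 (v2 _ vm1).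
have Nm2 := E2 _ _ _ m2v m2u2 vu2 (v2 _ vm2).
have ne23 x y : #|N x| = 2 -> #|N y| = 3 -> x != y.
  by move=> dx dy; apply/eqP=> E; move: dx; rewrite E dy.
have [dm1 dm2 dm3] := And3 (v2 _ vm1) (v2 _ vm2) (v2 _ vm3).
have [dp1 dq1] := (a1 _ u1p, a1 _ u1q).
have [dp2 dq2] := (a2 _ u2p, a2 _ u2q).
have [h1 h2 h3 h4] := And4 (adj_nadj_neq u2p np) (adj_nadj_neq u2q np)
  (adj_nadj_neq u2p nq) (adj_nadj_neq u2q nq).
have [h5 h6 h7 h8] := And4 (adj_nadj_neq u1p n1) (adj_nadj_neq u1p n3)
  (adj_nadj_neq u1q n1) (adj_nadj_neq u1q n3).
have [h9 h10 h11 h12] := And4 (adj_nadj_neq u2p n2) (adj_nadj_neq u2p n4)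
  (adj_nadj_neq u2q n2) (adj_nadj_neq u2q n4).
have uS : uniq [:: v; m1; m2; m3; u1; u2].
  rewrite /= !inE !negb_or ?andbT; do ![apply/andP; split];
  first [assumption | rewrite eq_sym; assumption | by apply: ne23 | by rewrite eq_sym; apply: ne23].
have uP : uniq [:: p1; q1; p2; q2].
  rewrite /= !inE !negb_or ?andbT; do ![apply/andP; split];
  by first [assumption | rewrite eq_sym; assumption].
pose A := V0 :\: [set x in [:: v; m1; m2; m3; u1; u2]].
have SA : all (fun x => x \notin A) [:: v; m1; m2; m3; u1; u2].
  by rewrite /= !inE !eqxx ?orbT.
have inA x : x \in V0 -> x != v -> x != m1 -> x != m2 -> x != m3 -> x != u1 ->
    x != u2 -> x \in A.
  by rewrite !inE !negb_or => -> -> -> -> -> -> ->.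
have PA : all (fun x => x \in A) [:: p1; q1; p2; q2].
  by rewrite /=; do ![apply/andP; split]; rewrite // inA //;
    first [assumption | rewrite eq_sym; assumption | exact: adjVr u1p | exact: adjVr u1q
      | exact: adjVr u2p | exact: adjVr u2q | by apply: ne23].
have u3A : u3 \in A.
  have du3 := bad_thread bv vm3 m3u3 u3v.
  apply: inA; rewrite ?(adjVr m3u3) //; try exact: deg_neq.
    by apply: contraNneq n3 => <-; rewrite adjC.
  by apply: contraNneq n4 => <-; rewrite adjC.
have [c [cA c1 c2]] := fold2 vm1 vm2 vm3 m1u1 m2u2 m3u3 u1p u1q u2p u2q uS uP
  (subsetDl _ _) SA PA.
have [|a /and3P[g3 g1 g2]] := @common3 (grow (gn v m3) (grow (gn m3 u3) [set c u3]))
    (grow (gn v m1) (grow (gn m1 u1) (grow (gn u1 p1) [set c p1])))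
    (grow (gn v m2) (grow (gn m2 u2) (grow (gn u2 p2) [set c p2]))).
  by apply: (@leq_trans (3 + 4 + 4)) => //; rewrite !leq_add ?card_grow3 ?card_grow2.
case/and5P: (SA) => vA m1A m2A m3A /and3P[u1A u2A _].
case/and5P: (PA) => p1A q1A p2A q2A _.
have [|cv ev] := @col_upd c A v a cA vA.
  move=> y yA; rewrite (NE _ Nv) !inE => /orP[/orP[]|] /eqP E; subst y.
  - by rewrite yA in m1A.
  - by rewrite yA in m2A.
  - by rewrite yA in m3A.
set f := upd c v a in cv ev; have fv : f v = a by rewrite /f updE.
set A1 := v |: A in cv.
have vA1 : v \in A1 by rewrite in_setU1 eqxx.
have s1 : {subset A <= A1} by move=> y yA; rewrite in_setU1 yA orbT.
have [||f1 [col1 e1]] := col_thread2 cv _ vA1 Nm3.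
- by rewrite in_setU1 negb_or m3A andbT; apply: ne23.
- by rewrite fv (ev u3 u3A).
set A2 := m3 |: A1 in col1.
have s2 : {subset A1 <= A2} by move=> y yA; rewrite in_setU1 yA orbT.
have [||||f2 [col2 e2]] :=
  col_fork col1 (s2 _ vA1) _ _ Nm1 N1 (s2 _ (s1 _ p1A)) (s2 _ (s1 _ q1A)).
- rewrite !in_setU1 !negb_or m1A andbT; do ![apply/andP; split];
  first [assumption | rewrite eq_sym; assumption | by apply: ne23].
- rewrite !in_setU1 !negb_or u1A andbT; do ![apply/andP; split];
  first [assumption | rewrite eq_sym; assumption | by rewrite eq_sym; apply: ne23].
- by rewrite (e1 p1 (s1 _ p1A)) (e1 q1 (s1 _ q1A)) (ev p1 p1A) (ev q1 q1A).
- by rewrite (e1 v vA1) (e1 p1 (s1 _ p1A)) fv (ev p1 p1A).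
set A3 := u1 |: _ in col2.
have s3 : {subset A2 <= A3} by move=> y yA; rewrite in_setU1 in_setU1 yA !orbT.
have f2E x : x \in A1 -> f2 x = f x by move=> xA; rewrite (e2 x (s2 _ xA)) (e1 x xA).
have [||||f3 [col3 _]] := col_fork col2 (s3 _ (s2 _ vA1)) _ _ Nm2 N2
  (s3 _ (s2 _ (s1 _ p2A))) (s3 _ (s2 _ (s1 _ q2A))).
- rewrite !in_setU1 !negb_or m2A andbT; do ![apply/andP; split];
  first [assumption | rewrite eq_sym; assumption | by apply: ne23].
- rewrite !in_setU1 !negb_or u2A andbT; do ![apply/andP; split];
  first [assumption | rewrite eq_sym; assumption | by rewrite eq_sym; apply: ne23].
- by rewrite (f2E p2 (s1 _ p2A)) (f2E q2 (s1 _ q2A)) (ev p2 p2A) (ev q2 q2A).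
- by rewrite (f2E v vA1) (f2E p2 (s1 _ p2A)) fv (ev p2 p2A).
apply: nocol_sub col3; apply/subsetP=> t tV; rewrite !inE tV.
by do 6!case: (t == _).
Qed.

(** * Discharging *)

Definition is2 m := #|N m| == 2.
Definition badb v := (#|N v| == 3) && [forall m, adj v m ==> is2 m].
Definition has2 m := [exists z, adj m z && is2 z].
Definition hasbad m u := [exists z, [&& adj m z, z != u & badb z]].

(* A vertex of degree at least 3 pays for half of the vertices of degree 2 on
   its threads; through a thread with a single inner vertex it pays one more
   unit to a bad vertex at the other end. *)
Definition give u m : nat :=
  if ~~ adj u m then 0 else
  if is2 m && (2 < #|N u|) then (if has2 m then 8 else 4) + (~~ badb u && hasbad m u)
  else is2 u && badb m && [exists z, [&& adj u z, z != m & ~~ badb z]].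

Lemma badP v : reflect (bad v) (badb v).
Proof.
apply: (iffP andP) => [[/eqP dv /forallP H] | [dv H]].
  by split=> // m vm; apply/eqP; have := H m; rewrite vm.
split; first exact/eqP.
by apply/forallP=> m; apply/implyP=> vm; apply/eqP; apply: H.
Qed.

Lemma badb_deg v : badb v -> #|N v| = 3.
Proof. by case/andP=> /eqP. Qed.

(** At a vertex of degree 2 the existential tests in [give] only ask about its second neighbour. *)
Lemma give_pay x y : adj x y -> is2 y -> 2 < #|N x| ->
  exists z, [/\ N y = [set x; z], z != x, has2 y = is2 z & hasbad y x = badb z].
Proof.
move=> xy /eqP dy dx; have yx : adj y x by rewrite adjC.
have [z Ny zx] := deg2E dy yx.
have yz : adj y z by rewrite (NE _ Ny) set22.
exists z; split=> //.
  apply/existsP/idP => [[t /andP[yt t2]]|z2]; last by exists z; rewrite yz.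
  move: yt; rewrite (NE _ Ny) !inE => /orP[]/eqP E; subst t => //.
  by move: dx; rewrite (eqP t2).
apply/existsP/idP => [[t /and3P[yt tx bt]]|bz]; last by exists z; rewrite yz zx.
by move: yt; rewrite (NE _ Ny) !inE (negPf tx) /= => /eqP <-.
Qed.

(** The unit meant for a bad vertex never comes on top of an 8: in that case the second neighbour of
    [y] has degree 2 and is not bad. *)
Lemma give_hi x y : 2 < #|N x| -> give x y <= 5 \/ (give x y = 8 /\ exists b, thread3 x y b).
Proof.
move=> dx; rewrite /give; case xy: (adj x y) => /=; last by left.
rewrite dx andbT; case y2: (is2 y); last by left; case: (_ && _).
have [z [Ny zx -> ->]] := give_pay xy y2 dx.
case z2: (is2 z); last by left; case: (_ && _).
right; split.
  by rewrite (_ : badb z = false) ?andbF //; apply/negP=> /badb_deg; rewrite (eqP z2).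
exists z; split=> //; first exact/eqP; last exact/eqP.
by rewrite (NE _ Ny) set22.
Qed.

Lemma sumN x (F : V -> nat) : (forall y, ~~ adj x y -> F y = 0) ->
  \sum_(y in V0) F y = \sum_(y in N x) F y.
Proof.
move=> F0; rewrite (big_setID (N x)) /= [X in _ + X]big1 ?addn0 => [|y].
  rewrite (setIidPr _) //; apply/subsetP=> y; rewrite inE; exact: adjVr.
by rewrite !inE => /andP[ny _]; apply: F0.
Qed.

Lemma give0 x y : ~~ adj x y -> give x y = 0.
Proof. by rewrite /give => ->. Qed.

Lemma sum_give_le x k : (forall y, adj x y -> give x y <= k) ->
  \sum_(y in N x) give x y <= k * #|N x|.
Proof.
move=> H; rewrite mulnC -sum_nat_const; apply: leq_sum => y.
by rewrite inE; apply: H.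
Qed.

Lemma give_to x y : 2 < #|N x| -> ~~ is2 y -> give x y = 0.
Proof.
move=> dx y2; rewrite /give (negPf y2) /= (_ : is2 x = false) /=; first by case: ifP.
by apply/negP=> /eqP E; move: dx; rewrite E.
Qed.

Lemma sum_pair (F : V -> nat) y z : y != z -> \sum_(t in [set y; z]) F t = F y + F z.
Proof. by move=> yz; rewrite big_setU1 ?big_set1 // inE. Qed.

(** The deficit is [44 - 36 = 8]. Next to another vertex of degree 2 it is covered by the other
    neighbour alone; otherwise both neighbours pay 4, and an additional unit from one end is handed
    on to the bad vertex at the other. *)
Lemma charge2 x : #|N x| = 2 ->
  44 + \sum_(y in N x) give x y <= 18 * #|N x| + \sum_(y in N x) give y x.
Proof.
move=> dx; rewrite dx.
have /cards2P[y [z [yz Nx]]] := introT eqP dx.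
have x2 : is2 x by apply/eqP.
rewrite Nx !(sum_pair _ yz).
have xy : adj x y by rewrite (NE _ Nx) set21.
have xz : adj x z by rewrite (NE _ Nx) set22.
have yx : adj y x by rewrite adjC.
have zx : adj z x by rewrite adjC.
have long a b : adj x a -> adj x b -> a != b -> is2 b ->
    44 + (give x a + give x b) <= 18 * 2 + (give a x + give b x).
  move=> xa xb ab b2; have ax : adj a x by rewrite adjC.
  have da : 2 < #|N a|.
    rewrite ltn_neqAle (deg_geq2 (adjVl ax)) andbT; apply/eqP=> E.
    exact: (three_deg2 ax xb ab (esym E) dx (eqP b2)).
  have ba : badb a = false.
    apply/negP=> /badb_deg da3; apply: (thread3_deg3 da3 ax dx xb _ (eqP b2)).
    by rewrite eq_sym.
  have bb : badb b = false by apply/negP=> /badb_deg; rewrite (eqP b2).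
  have -> : give x a = 0 by rewrite /give dx ba andbF /= andbF; case: ifP.
  have -> : give x b = 0 by rewrite /give dx bb andbF /= andbF; case: ifP.
  have : 8 <= give a x.
    rewrite /give ax x2 da /=; have -> : has2 x by apply/existsP; exists b; rewrite xb.
    exact: leq_addr.
  by move: (give a x) (give b x); clear; lia.
case z2: (is2 z); first exact: long.
case y2: (is2 y).
  rewrite [give x y + _]addnC [give y x + _]addnC; apply: long => //.
  by rewrite eq_sym.
have dz : 2 < #|N z| by rewrite ltn_neqAle (deg_geq2 (adjVl zx)) andbT eq_sym; apply/negbT.
have dy : 2 < #|N y| by rewrite ltn_neqAle (deg_geq2 (adjVl yx)) andbT eq_sym; apply/negbT.
have E2 a b : adj x a -> N x = [set a; b] -> a != b -> 2 < #|N a| -> is2 b = false ->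
    give a x = 4 + (~~ badb a && badb b) /\ give x a = (badb a && ~~ badb b).
  move=> xa Nx' ab da b2; have ax : adj a x by rewrite adjC.
  have [b' [Nb' _ h2 hb]] := give_pay ax x2 da.
  have E : b' = b.
    have : b' \in N x by rewrite Nb' set22.
    rewrite Nx' !inE => /orP[]/eqP // E; subst b'.
    by have := set22 a b; rewrite -Nx' Nb' !inE orbb => /eqP E; rewrite E eqxx in ab.
  subst b'; rewrite /give ax xa x2 da h2 hb b2 dx andbF /=; split=> //.
  case: (badb a) => //=; congr nat_of_bool.
  apply/existsP/idP => [[t /and3P[xt ta bt]]|nb]; last first.
    by exists b; rewrite nb andbT eq_sym ab andbT (NE _ Nb') set22.
  by move: xt; rewrite (NE _ Nb') !inE (negPf ta) /= => /eqP <-.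
have [g1 g2] := E2 y z xy Nx yz dy z2.
have [g3 g4] := E2 z y xz (etrans Nx (setUC _ _)) (etrans (congr1 negb (eq_sym z y)) yz) dz y2.
by rewrite g1 g2 g3 g4; case: (badb y); case: (badb z).
Qed.

(** It pays [3 * 4], two more than its 10. By [bad_pair] at most one of its threads leads to another
    bad vertex, so at least two threads bring a unit each. *)
Lemma charge_bad x : bad x ->
  44 + \sum_(y in N x) give x y <= 18 * #|N x| + \sum_(y in N x) give y x.
Proof.
move=> bx; have [dx x2] := bx; rewrite dx.
have out : \sum_(y in N x) give x y <= 4 * #|N x|.
  apply: sum_give_le => y xy; have := x2 y xy => dy.
  have y2 : is2 y by apply/eqP.
  have dx' : 2 < #|N x| by rewrite dx.
  have [z [Ny zx h2 hb]] := give_pay xy y2 dx'.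
  have yz : adj y z by rewrite (NE _ Ny) set22.
  have dz := bad_thread bx xy yz zx.
  have -> : give x y = 4; last by [].
  rewrite /give xy y2 dx' h2 hb /= (_ : is2 z = false); last exact/negbTE.
  by move/badP: bx => ->.
have inn : 2 <= \sum_(y in N x) give y x.
  have g1 m : adj x m -> (exists u, [/\ adj m u, u != x & bad u]) \/ give m x = 1.
    move=> xm; have y2 : is2 m by apply/eqP; exact: x2.
    have dx' : 2 < #|N x| by rewrite dx.
    have [u [Nm ux _ _]] := give_pay xm y2 dx'.
    have mu : adj m u by rewrite (NE _ Nm) set22.
    case bu: (badb u); first by left; exists u; split=> //; apply/badP.
    right; have mx : adj m x by rewrite adjC.
    rewrite /give mx y2 (_ : is2 x = false) /=; last by rewrite /is2 dx.
    have -> : badb x by apply/badP.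
    by rewrite (_ : [exists _, _] = true) //; apply/existsP; exists u; rewrite mu ux bu.
  have /set0Pn[m] : N x != set0 by rewrite -card_gt0 dx.
  rewrite inE => xm; have [m2 [m3 [Nx n2 n3 n23]]] := deg3E dx xm.
  have xm2 : adj x m2 by rewrite (NE _ Nx) !inE eqxx orbT.
  have xm3 : adj x m3 by rewrite (NE _ Nx) !inE eqxx orbT.
  rewrite Nx -setUA big_setU1 /=; last by rewrite !inE negb_or ![m == _]eq_sym n2 n3.
  rewrite (sum_pair _ n23).
  have pair a b : adj x a -> adj x b -> a != b ->
     (exists u, [/\ adj a u, u != x & bad u]) -> (exists u, [/\ adj b u, u != x & bad u]) -> False.
    move=> xa xb ab [u [au ux bu]] [w [bw wx bw']].
    exact: (bad_pair bx bu bw' xa au xb bw).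
  case: (g1 m xm) => [b1|->]; case: (g1 m2 xm2) => [b2|->]; case: (g1 m3 xm3) => [b3|->];
    rewrite ?addnA ?addn1 ?ltnS //.
  - by case: (pair m m2) => //; rewrite eq_sym.
  - by case: (pair m m2) => //; rewrite eq_sym.
  - by case: (pair m m3) => //; rewrite eq_sym.
  - by case: (pair m2 m3).
move: out inn; rewrite dx; move: (\sum_(y in N x) _) (\sum_(y in N x) _).
by clear; lia.
Qed.

(** A payment is 8 along a thread of three edges and at most 5 otherwise. Degree [k >= 5] affords 8
    everywhere, as [18 k - 44 >= 8 k]. Degree 3 has 10, makes no payment of 8, and some neighbour is
    not of degree 2 and gets nothing. Degree 4 has 28: with at most two payments of 8 the cost is at
    most [16 + 10], and with three of them [hub_thread] caps the fourth payment at 4. *)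
Lemma charge_big x : 2 < #|N x| -> ~~ badb x ->
  44 + \sum_(y in N x) give x y <= 18 * #|N x| + \sum_(y in N x) give y x.
Proof.
move=> dx nb; apply: (@leq_trans (18 * #|N x|)); last exact: leq_addr.
have [d5|d4] := leqP 5 #|N x|.
  have : \sum_(y in N x) give x y <= 8 * #|N x|.
    apply: sum_give_le => y _; case: (give_hi y dx) => [|[-> //]].
    by move/leq_trans; apply.
  by move: (\sum_(y in N x) _) #|N x| d5; clear; lia.
case: (eqVneq #|N x| 3) => [d3|n3].
  have le5 y : give x y <= 5.
    case: (give_hi y dx) => // -[_ [b [xy dy yb bx db]]].
    by case: (thread3_deg3 d3 xy dy yb bx db).
  have [y0 /andP[xy0 y02]] : exists y, adj x y && ~~ is2 y.
    apply/existsP; move: nb; rewrite /badb d3 eqxx /= negb_forall.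
    by under eq_existsb do rewrite negb_imply.
  have y0N : y0 \in N x by rewrite inE.
  rewrite (big_setD1 y0) //= give_to // add0n d3.
  have : \sum_(y in N x :\ y0) give x y <= 5 * #|N x :\ y0|.
    by rewrite mulnC -sum_nat_const; apply: leq_sum => y _; apply: le5.
  have : #|N x :\ y0| = 2 by move: d3; rewrite (cardsD1 y0) y0N => -[].
  by move=> ->; move: (\sum_(y in N x :\ y0) _); clear; lia.
have d : #|N x| = 4 by move: dx d4 n3; move: #|N x|; clear; lia.
pose T := [set y in N x | 5 < give x y].
have TN : T \subset N x by apply/subsetP=> y; rewrite !inE => /andP[].
have Tth y : y \in T -> give x y = 8 /\ exists b, thread3 x y b.
  by rewrite inE => /andP[_ g]; case: (give_hi y dx) => //; rewrite leqNgt g.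
have sumE : \sum_(y in N x) give x y =
    \sum_(y in T) give x y + \sum_(y in N x :\: T) give x y.
  by rewrite (big_setID T) /= (setIidPr TN).
have sT : \sum_(y in T) give x y = 8 * #|T|.
  by rewrite mulnC -sum_nat_const; apply: eq_bigr => y /Tth[].
have sR : \sum_(y in N x :\: T) give x y <= 5 * #|N x :\: T|.
  rewrite mulnC -sum_nat_const; apply: leq_sum => y.
  by rewrite !inE negb_and => /andP[/orP[/negPf->|] //]; rewrite -leqNgt.
have cD : #|N x :\: T| + #|T| = 4.
  by rewrite cardsD (setIidPr TN) subnK ?d // -d subset_leq_card.
have [T2|T3] := leqP #|T| 2.
  move: sumE sT sR cD; rewrite d => -> ->.
  by move: (\sum_(y in _ :\: _) _) #|T| T2 #|N x :\: T|; clear; lia.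
rewrite d.
(* Three neighbours in [T] and the remaining one, [m], which may lie in [T] too. *)
have [m mN [m1 [m2 [m3 [TE uT rest]]]]] : exists2 m, m \in N x & exists a1 a2 a3,
   [/\ N x = m |: [set a1; a2; a3], uniq [:: m; a1; a2; a3]
     & [/\ a1 \in T, a2 \in T & a3 \in T]].
  have eN : 0 < #|T| by apply: ltn_trans T3.
  have /card_gt0P[a1 a1T] := eN.
  have c1 : 1 < #|T :\ a1| by move: T3; rewrite (cardsD1 a1) a1T.
  have /card_gt0P[a2 a2T] := ltnW c1.
  have c2 : 0 < #|T :\ a1 :\ a2| by move: c1; rewrite (cardsD1 a2) a2T.
  have /card_gt0P[a3 a3T] := c2.
  move: a2T a3T; rewrite !inE => /andP[a21 a2T] /and3P[a32 a31 a3T].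
  have ET a : a \in N x -> 5 < give x a -> a \in T by rewrite !inE => -> ->.
  have a2T' : a2 \in T by case/andP: a2T => h1 h2; rewrite !inE h1.
  have a3T' : a3 \in T by case/andP: a3T => h1 h2; rewrite !inE h1.
  have cS : #|[set a1; a2; a3]| = 3.
    by rewrite setUC cardsU1 !inE negb_or a31 a32 cards2 eq_sym a21.
  have SN : [set a1; a2; a3] \subset N x.
    by apply/subsetP=> y; rewrite !inE => /orP[/orP[]|] /eqP->; have := subsetP TN;
       [move/(_ _ a1T)|move/(_ _ a2T')|move/(_ _ a3T')]; rewrite inE.
  have /cards1P[m mE] : #|N x :\: [set a1; a2; a3]| == 1.
    by rewrite cardsD (setIidPr SN) cS d.
  have : m \in N x :\: [set a1; a2; a3] by rewrite mE set11.
  rewrite in_setD !inE !negb_or => /andP[/andP[/andP[ma1 ma2] ma3] xm].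
  exists m; first by rewrite inE.
  exists a1, a2, a3; split=> //.
    by rewrite -[LHS](setID _ [set a1; a2; a3]) (setIidPr SN) -mE setUC.
  by rewrite /= !inE !negb_or ma1 ma2 ma3 eq_sym a21 eq_sym a31 eq_sym a32.
have [a1T a2T a3T] := rest.
have [g1 [b1 t1]] := Tth _ a1T; have [g2 [b2 t2]] := Tth _ a2T.
have [g3 [b3 t3]] := Tth _ a3T.
have xm : adj x m by move: mN; rewrite inE.
have gm : give x m <= 4.
  rewrite /give xm dx andbT /=; case y2: (is2 m); last first.
    by rewrite (_ : is2 x = false) //; apply/negP=> /eqP E; rewrite E in dx.
  have [w [Nm wx -> ->]] := give_pay xm y2 dx.
  have mw : adj m w by rewrite (NE _ Nm) set22.
  have H := hub_thread TE uT t1 t2 t3 (eqP y2) mw wx.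
  case w2: (is2 w); first by case: H; left; apply/eqP.
  case bw: (badb w); last by rewrite andbF.
  by case: H; right; apply: badb_deg.
move: uT; rewrite /= !inE !negb_or => /and4P[/and3P[ma1 ma2 ma3] /andP[a12 a13] a23 _].
rewrite TE big_setU1 ?inE ?negb_or ?ma1 ?ma2 //=.
rewrite -setUA big_setU1 ?inE ?negb_or ?a12 ?a13 //= sum_pair // g1 g2 g3.
by move: (give x m) gm; clear; lia.
Qed.

Lemma charge x : x \in V0 ->
  44 + \sum_(y in V0) give x y <= 18 * #|N x| + \sum_(y in V0) give y x.
Proof.
move=> xV; rewrite (@sumN x (give x)) ?(@sumN x (give ^~ x)); first last.
- by move=> y xy; apply: give0.
- by move=> y; rewrite adjC; apply: give0.
have := deg_geq2 xV; rewrite leq_eqVlt eq_sym => /orP[/eqP|dx]; first exact: charge2.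
by case bx: (badb x); [apply/charge_bad/badP | apply: charge_big; rewrite ?bx].
Qed.

(** The handshake count is done by adding one vertex at a time, since only [ed0] and [edD] are known
    about [ed]. *)
Lemma sum_deg A : A \subset V0 -> \sum_(x in A) #|[set y in A | adj x y]| = 2 * ed A.
Proof.
elim: {A}#|A| {-2}A (leqnn #|A|) => [|n IH] A.
  by rewrite leqn0 cards_eq0 => /eqP-> _; rewrite big_set0 ed0.
have [-> _ _|[x xA]] := set_0Vmem A; first by rewrite big_set0 ed0.
rewrite (cardsD1 x) xA => le AV.
have BV : A :\ x \subset V0 by apply: subset_trans AV; exact: subsetDl.
have xB : x \notin A :\ x by rewrite !inE eqxx.
rewrite -(setD1K xA) edD ?(subsetP AV) // big_setU1 //=.
set B := A :\ x in BV xB le *.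
have -> : #|[set y in x |: B | adj x y]| = #|[set y in B | adj x y]|.
  apply: eq_card => y; rewrite !inE.
  by case: (eqVneq y x) => [->|] //=; rewrite adj_irr andbF.
have -> : \sum_(i in B) #|[set y in x |: B | adj i y]| =
    \sum_(i in B) (#|[set y in B | adj i y]| + adj i x).
  apply: eq_bigr => z zB.
  case zx: (adj z x).
    have -> : [set y in x |: B | adj z y] = x |: [set y in B | adj z y].
      apply/setP=> y; rewrite !inE andb_orl; case: (eqVneq y x) => [->|] //=.
      by rewrite zx.
    have xN : x \notin [set y in B | adj z y] by rewrite in_set negb_and xB.
    by rewrite cardsU1 xN addnC.
  rewrite addn0; apply: eq_card => y; rewrite !inE.
  by case: (eqVneq y x) => [->|] //=; rewrite zx !andbF.
rewrite big_split /= IH // addnCA mulnDr; congr addn.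
rewrite mul2n -addnn; congr addn.
rewrite -sum1_card [RHS]big_mkcond [LHS]big_mkcond /=; apply: eq_bigr => y _.
by rewrite !inE [adj y x]adjC; case: (_ && _) => //=; case: (adj x y).
Qed.

(** Payments cancel in the total, which leaves [44 n <= 36 e] for [n] vertices and [e] edges,
    against [9 e + 7 <= 11 n]. *)
Lemma reducible_absurd : False.
Proof.
have V0n : V0 != set0.
  by apply/eqP=> V00; apply: (nocol (c := fun=> 0%R)) => x y; rewrite V00 inE.
have tot : \sum_(x in V0) (44 + \sum_(y in V0) give x y) <=
    \sum_(x in V0) (18 * #|N x| + \sum_(y in V0) give y x).
  by apply: leq_sum => x; apply: charge.
move: tot; rewrite big_split [leqRHS]big_split [X in _ <= _ + X]exchange_big leq_add2r.
rewrite sum_nat_const -big_distrr /=.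
have -> : \sum_(x in V0) #|N x| = 2 * ed V0.
  rewrite -(sum_deg (subxx _)); apply: eq_bigr => x _; apply: eq_card => y.
  rewrite !inE; case xy: (adj x y); rewrite ?andbF // (adjVr xy) //.
have := sp (subxx V0) V0n.
by move: (ed V0) #|V0|; clear; lia.
Qed.

End Reducible.

Theorem sparse_gain_colorable (V E : finType) (V0 : {set V}) (E0 : {set E})
    (s t : E -> V) (g : E -> 'Z_5) :
  sparse V0 E0 s t -> gain_colorable V0 E0 s t g.
Proof.
move: {2}#|V0| (erefl #|V0|) => n; elim/ltn_ind: n V0 E0 s t g.
move=> n IHn V0 E0 s t g cV sp0.
have IH (V1 : {set V}) (E1 : {set E}) s1 t1 g1 : #|V1| < #|V0| -> sparse V1 E1 s1 t1 ->
    gain_colorable V1 E1 s1 t1 g1.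
  by rewrite cV => lt; exact: (IHn #|V1| lt V1 E1 s1 t1 g1 erefl).
have [/existsP[c /forall_inP cP]|/existsPn nc] := boolP [exists c : {ffun V -> 'Z_5},
    [forall e in inner_edges E0 s t V0, gain_ok s t g c e]]; first by exists c.
have nocol : ~ gain_colorable V0 E0 s t g.
  case=> c cP; have := nc (finfun c); rewrite negb_forall => /existsP[e].
  by rewrite negb_imply => /andP[/cP ok]; rewrite /gain_ok !ffunE -/(gain_ok s t g c e) ok.
case: (@reducible_absurd V V0 (adj V0 E0 s t) (gain_of V0 E0 s t g)
  (fun A => #|inner_edges E0 s t A|)).
- exact: adjC.
- exact: adj_irr.
- exact: adjV.
- by move=> x y; apply: (gain_ofN g sp0).
- by apply: eq_card0 => e; rewrite inE in_set0 andbF.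
- by move=> x A; apply: (ein_addE sp0).
- exact: sp0.
- exact: (gap IH sp0 nocol).
- exact: (identify_colorable g IH sp0).
move=> c cP; apply: nocol; exists c.
exact/(adj_okP g sp0 c (subxx V0)).
Qed.

(** * Graphs with an algebraic dual *)

Definition symd (T : finType) (A B : {set T}) := [set x | (x \in A) (+) (x \in B)].

Lemma card_symd (T : finType) (A B : {set T}) : #|symd A B| + 2 * #|A :&: B| = #|A| + #|B|.
Proof.
rewrite -cardsUI mul2n -addnn addnA; congr addn.
have sI : A :&: B \subset A :|: B by apply: subset_trans (subsetIl _ _) (subsetUl _ _).
rewrite -[RHS](cardsID (A :&: B)) (setIidPr sI) addnC; congr addn.
by apply: eq_card => x; rewrite !inE; case: (x \in A); case: (x \in B).
Qed.

Lemma odd_symd (T : finType) (A B : {set T}) : odd #|symd A B| = odd #|A| (+) odd #|B|.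
Proof. by rewrite -oddD -card_symd oddD mul2n odd_double addbF. Qed.

Section Boundary.
Variables (V E : finType).
Implicit Types (s t : E -> V) (A B Z : {set E}) (v : V).

(** The boundary modulo 2; a loop contributes nothing to it. *)
Definition bd s t Z v := \big[addb/false]_(e in Z) ((s e == v) (+) (t e == v)).

Definition even_set s t Z := forall v, bd s t Z v = false.

Lemma bdE s t Z v : bd s t Z v = \big[addb/false]_e ((e \in Z) && ((s e == v) (+) (t e == v))).
Proof. by rewrite /bd big_mkcond; apply: eq_bigr => e _; case: (e \in Z). Qed.

Lemma bd_symd s t A B v : bd s t (symd A B) v = bd s t A v (+) bd s t B v.
Proof.
rewrite !bdE -big_split; apply: eq_bigr => e _; rewrite inE.
by case: (e \in A); case: (e \in B); case: (s e == v); case: (t e == v).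
Qed.

Lemma bd1 s t e v : bd s t [set e] v = (s e == v) (+) (t e == v).
Proof. by rewrite /bd big_set1. Qed.

Lemma bd0 s t v : bd s t set0 v = false.
Proof. by rewrite /bd big_set0. Qed.

Lemma even_symd s t A B : even_set s t A -> even_set s t B -> even_set s t (symd A B).
Proof. by move=> eA eB v; rewrite bd_symd eA eB. Qed.

Lemma bd_map s t (h : V -> V) Z w :
  bd (h \o s) (h \o t) Z w = \big[addb/false]_(v | h v == w) bd s t Z v.
Proof.
rewrite /bd exchange_big /=; apply: eq_bigr => e _.
rewrite big_split /=; congr addb.
  rewrite big_mkcond (bigD1 (s e)) //= eqxx big1 ?addbF => [|v]; first by case: ifP.
  by rewrite eq_sym => /negPf->; case: ifP.
rewrite big_mkcond (bigD1 (t e)) //= eqxx big1 ?addbF => [|v]; first by case: ifP.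
by rewrite eq_sym => /negPf->; case: ifP.
Qed.

Lemma even_map s t (h : V -> V) Z : even_set s t Z -> even_set (h \o s) (h \o t) Z.
Proof. by move=> eZ w; rewrite bd_map big1. Qed.

Lemma bd_total s t Z : \big[addb/false]_v bd s t Z v = false.
Proof.
rewrite /bd exchange_big big1 //= => e _; rewrite big_split /=.
rewrite (bigD1 (s e)) //= eqxx big1 => [|v]; last by rewrite eq_sym => /negPf.
rewrite (bigD1 (t e)) //= eqxx big1 // => v; by rewrite eq_sym => /negPf.
Qed.

End Boundary.

(** * Cuts and uncrossing *)

Section Cuts.
Variables (E F : finType) (E0 : {set E}) (l r : E -> F).
Implicit Types X Y : {set F}.

Definition cut X := [set e in E0 | (l e \in X) (+) (r e \in X)].

Lemma cut_symd X Y : cut (symd X Y) = symd (cut X) (cut Y).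
Proof.
apply/setP=> e; rewrite !inE; case: (e \in E0) => //=.
by case: (l e \in X); case: (r e \in X); case: (l e \in Y); case: (r e \in Y).
Qed.

Lemma cutC X : cut (~: X) = cut X.
Proof.
apply/setP=> e; rewrite !inE; case: (e \in E0) => //=.
by case: (l e \in X); case: (r e \in X).
Qed.

Lemma odd_cutD X Y : odd #|cut (symd X Y)| = odd #|cut X| (+) odd #|cut Y|.
Proof. by rewrite cut_symd odd_symd. Qed.

Lemma cut_cardE X : #|cut X| = \sum_(e in E0) ((l e \in X) (+) (r e \in X)).
Proof.
rewrite -sum1_card big_mkcond [RHS]big_mkcond; apply: eq_bigr => e _.
by rewrite inE; case: (e \in E0) => //=; case: (_ (+) _).
Qed.

Lemma cut_submod X Y : #|cut (X :&: Y)| + #|cut (X :|: Y)| <= #|cut X| + #|cut Y|.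
Proof.
rewrite !cut_cardE -!big_split; apply: leq_sum => e _ /=; rewrite !inE.
by case: (l e \in X); case: (r e \in X); case: (l e \in Y); case: (r e \in Y).
Qed.

(** The surplus 2 comes from [e], which joins the intersection to the outside of the union: it lies
    in both cuts on the right and in neither on the left. *)
Lemma cut_posimod X Y e : e \in E0 ->
  (l e \in X :&: Y) && (r e \notin X :|: Y) || (r e \in X :&: Y) && (l e \notin X :|: Y) ->
  #|cut (X :\: Y)| + #|cut (Y :\: X)| + 2 <= #|cut X| + #|cut Y|.
Proof.
move=> eE H; rewrite !cut_cardE -!big_split !(bigD1 e eE) /=.
have le : \sum_(i in E0 | i != e) (((l i \in X :\: Y) (+) (r i \in X :\: Y)) +
      ((l i \in Y :\: X) (+) (r i \in Y :\: X))) <=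
   \sum_(i in E0 | i != e) (((l i \in X) (+) (r i \in X)) + ((l i \in Y) (+) (r i \in Y))).
  apply: leq_sum => i _; rewrite !inE.
  by case: (l i \in X); case: (r i \in X); case: (l i \in Y); case: (r i \in Y).
have : (((l e \in X :\: Y) (+) (r e \in X :\: Y)) + ((l e \in Y :\: X) (+) (r e \in Y :\: X))) + 2
    <= ((l e \in X) (+) (r e \in X)) + ((l e \in Y) (+) (r e \in Y)).
  move: H; rewrite !inE.
  by case: (l e \in X); case: (r e \in X); case: (l e \in Y); case: (r e \in Y).
by move=> le2; rewrite addnAC; apply: leq_add.
Qed.

End Cuts.

Section Uncrossing.
Variables (E F : finType) (E0 : {set E}) (l r : E -> F).
Local Notation d X := #|cut E0 l r X|.
Hypothesis odd11 : forall X, odd (d X) -> 10 < d X.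

(* Submodularity of cuts; 11 is the least odd size of a cut. *)
Lemma tight_union X Y e : e \in E0 -> d X = 11 -> d Y = 11 ->
  (l e \in X :&: Y) && (r e \notin X :|: Y) || (r e \in X :&: Y) && (l e \notin X :|: Y) ->
  d (X :|: Y) = 11.
Proof.
move=> eE dX dY H.
have oXY : odd (d (X :|: Y)) = odd (d (X :&: Y)).
  have -> : X :|: Y = symd (X :&: Y) (symd X Y).
    by apply/setP=> f; rewrite !inE; case: (f \in X); case: (f \in Y).
  by rewrite !odd_cutD dX dY addbb addbF.
have oX : odd (d (X :\: Y)) = ~~ odd (d (X :&: Y)).
  have -> : X :\: Y = symd X (X :&: Y).
    by apply/setP=> f; rewrite !inE; case: (f \in X); case: (f \in Y).
  by rewrite odd_cutD dX.
have oY : odd (d (Y :\: X)) = ~~ odd (d (X :&: Y)).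
  have -> : Y :\: X = symd Y (X :&: Y).
    by apply/setP=> f; rewrite !inE; case: (f \in X); case: (f \in Y).
  by rewrite odd_cutD dY.
have := cut_submod E0 l r X Y; have := cut_posimod eE H; rewrite dX dY.
(* Either the intersection and the union both have odd cuts, and submodularity forces both to be 11,
   or both differences do, which posimodularity forbids because [11 + 11 + 2 > 22]. *)
case o: (odd (d (X :&: Y))); rewrite ?o in oXY oX oY.
  have := odd11 o; have := odd11 oXY.
  by move: (d _) (d _) (d _) (d _); clear; lia.
have := odd11 oX; have := odd11 oY.
by move: (d _) (d _) (d _) (d _); clear; lia.
Qed.

End Uncrossing.

Section DualPair.
Variables (V E F : finType).
Implicit Types (Z : {set E}) (s t : E -> V) (l r : E -> F) (X Y : {set F}).

(* [l e] and [r e] are the ends of [e] in the dual graph, the algebraic dual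
   over the field with two elements: its cuts are the even sets of [s, t]. *)
Definition dual_pair (E0 : {set E}) s t l r :=
  forall Z, Z \subset E0 -> even_set s t Z <-> exists Y, Z = cut E0 l r Y.

Definition odd_large (E0 : {set E}) s t :=
  forall Z, Z \subset E0 -> even_set s t Z -> odd #|Z| -> 10 < #|Z|.

Definition colorable5 (E0 : {set E}) s t :=
  exists c : V -> 'Z_5, forall e, e \in E0 -> near5 (c (t e)) (c (s e)).

Lemma cut_subset E0 l r X : cut E0 l r X \subset E0.
Proof. by apply/subsetP=> e; rewrite inE => /andP[]. Qed.

Lemma cut_even E0 s t l r X : dual_pair E0 s t l r -> even_set s t (cut E0 l r X).
Proof. by move=> dp; apply/(dp _ (cut_subset _ _ _ _)); exists X. Qed.

Lemma odd_cut E0 s t l r X : dual_pair E0 s t l r -> odd_large E0 s t ->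
  odd #|cut E0 l r X| -> 10 < #|cut E0 l r X|.
Proof. by move=> dp ol; apply: ol (cut_subset _ _ _ _) (cut_even _ dp). Qed.

Lemma noloop5 E0 s t e : odd_large E0 s t -> e \in E0 -> s e != t e.
Proof.
move=> ol eE; apply/eqP=> st; have := ol [set e]; rewrite sub1set eE cards1.
move=> /(_ isT) H; suff /H/(_ isT) : even_set s t [set e] by [].
by move=> v; rewrite bd1 st addbb.
Qed.

(** Meaningful when [u] is one of the ends of [e]; used for vertices and for faces alike. *)
Definition opposite (T : eqType) (p q : E -> T) e u : T := if p e == u then q e else p e.

Lemma bd_opposite s t e u x : (s e == u) || (t e == u) ->
  bd s t [set e] x = (u == x) (+) (opposite s t e u == x).
Proof.
rewrite bd1 /opposite; case: eqP => [-> //|_ /= /eqP <-].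
by rewrite addbC.
Qed.

(** * Folding two edges of a face *)

Section Fold.
Variables (E0 : {set E}) (s t : E -> V) (l r : E -> F) (e e' : E) (u : V) (f : F).
Hypothesis dp : dual_pair E0 s t l r.
Hypothesis ol : odd_large E0 s t.
Hypotheses (eE : e \in E0) (e'E : e' \in E0) (ee' : e != e').
Hypotheses (eu : (s e == u) || (t e == u)) (e'u : (s e' == u) || (t e' == u)).
Hypotheses (ef : (l e == f) (+) (r e == f)) (e'f : (l e' == f) (+) (r e' == f)).
Let a := opposite l r e f.
Let a' := opposite l r e' f.
Hypothesis safe : forall X, f \notin X -> a \in X -> a' \in X -> #|cut E0 l r X| <> 11.
Hypothesis IH : forall (E1 : {set E}) (s1 t1 : E -> V) (l1 r1 : E -> F),
  #|E1| < #|E0| -> dual_pair E1 s1 t1 l1 r1 -> odd_large E1 s1 t1 -> colorable5 E1 s1 t1.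

Let v := opposite s t e u.
Let w := opposite s t e' u.
(** [h] identifies the far ends of the two edges, [e'] is deleted and [e] stands for both. In the
    dual they leave [f], and [e] now joins the faces [a] and [a'] behind them. [mu] is the effect on
    edge sets modulo 2: [e] is present afterwards when exactly one of the two was before. *)
Let h x := if x == w then v else x.
Let l' x := if x == e then a else l x.
Let r' x := if x == e then a' else r x.
Let E1 := E0 :\ e'.
Let mu Z := [set x in E1 | if x == e then (e \in Z) (+) (e' \in Z) else x \in Z].

Lemma opposite_mem e0 Y : (l e0 == f) (+) (r e0 == f) ->
  (l e0 \in Y) (+) (r e0 \in Y) = (f \in Y) (+) (opposite l r e0 f \in Y).
Proof.
rewrite /opposite; case: eqP => [-> //|_ /= /eqP <-].
by rewrite addbC.
Qed.

Lemma cut_fold Y : cut E1 l' r' Y = mu (cut E0 l r Y).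
Proof.
apply/setP=> x; rewrite !inE /l' /r'; case: (eqVneq x e) => [->|xe].
  rewrite ee' eE e'E /= (opposite_mem Y ef) (opposite_mem Y e'f) -/a -/a'.
  by case: (f \in Y); case: (a \in Y); case: (a' \in Y).
by case: (x == e'); case: (x \in E0).
Qed.

Lemma muE Z : Z \subset E0 -> mu Z = if e' \in Z then symd Z [set e; e'] else Z.
Proof.
move=> ZE; apply/setP=> x; rewrite inE.
case: (eqVneq x e) => [->|xe].
  rewrite !inE ee' eE /=; case: ifP => _; last by rewrite addbF.
  by rewrite !inE eqxx.
rewrite !inE; have [->|xe'] := eqVneq x e'.
  by case: ifP => e'Z; rewrite ?inE ?e'Z ?eqxx ?orbT.
have -> : (x \in if e' \in Z then symd Z [set e; e'] else Z) = (x \in Z).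
  by case: ifP => // _; rewrite !inE (negPf xe) (negPf xe') addbF.
by case xZ: (x \in Z); rewrite ?andbF // (subsetP ZE).
Qed.

Lemma pair_symd : [set e; e'] = symd [set e] [set e'].
Proof.
apply/setP=> x; rewrite !inE; by case: (eqVneq x e) => [->|] //=; rewrite (negPf ee').
Qed.

Lemma bd_fold Z x : Z \subset E0 -> bd (h \o s) (h \o t) (mu Z) x = bd (h \o s) (h \o t) Z x.
Proof.
move=> ZE; rewrite muE //; case: ifP => // _; rewrite bd_symd.
rewrite pair_symd bd_symd.
have H e0 : (s e0 == u) || (t e0 == u) ->
   bd (h \o s) (h \o t) [set e0] x = (h u == x) (+) (h (opposite s t e0 u) == x).
  rewrite bd1 /= /opposite; case: eqP => [-> //|_ /= /eqP <-].
  by rewrite addbC.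
rewrite !H // -/v -/w /h eqxx (_ : (if v == w then v else v) = v); last by case: ifP.
by rewrite addbb addbF.
Qed.

(** In the original graph an even set of the folded graph has its boundary on [v] and [w] only, with
    equal parities. If they are odd, adding the path [e], [e'] from [v] to [w] repairs this, and
    [mu] does not see the addition. *)
Lemma dual_pair_fold : dual_pair E1 (h \o s) (h \o t) l' r'.
Proof.
move=> Z ZE1; have ZE : Z \subset E0 by apply: subset_trans ZE1 (subsetDl _ _).
have e'Z : e' \notin Z by apply/negP=> /(subsetP ZE1); rewrite !inE eqxx.
split=> [evZ|[Y ->]]; last first.
  rewrite cut_fold => x; rewrite bd_fold ?cut_subset //.
  exact: (even_map h (cut_even Y dp)).
suff [Z1 [Z1E ev1 Zmu]] : exists Z1, [/\ Z1 \subset E0, even_set s t Z1 & Z = mu Z1].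
  have [Y YE] := (dp Z1E).1 ev1.
  by exists Y; rewrite cut_fold -YE.
have muZ : mu Z = Z by rewrite muE // (negPf e'Z).
have [vw|vw] := eqVneq v w.
  exists Z; split=> // x; rewrite -(evZ x) /bd; apply: eq_bigr => y _ /=.
  have hid z : h z = z by rewrite /h; case: eqP => // ->.
  by rewrite !hid.
have hv : h v = v by rewrite /h (negPf vw).
have hw : h w = v by rewrite /h eqxx.
have hE x y : x != w -> (h y == x) = (y == x) || (x == v) && (y == w).
  move=> xw; rewrite /h; case: (eqVneq y w) => [->|yw]; last by rewrite andbF orbF.
  by rewrite [w == x]eq_sym (negPf xw) andbT eq_sym.
have out x : x != v -> x != w -> bd s t Z x = false.
  move=> xv xw; rewrite -(evZ x) bd_map (big_pred1 x) // => y.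
  by rewrite hE // (negPf xv) orbF.
have vw2 : bd s t Z v (+) bd s t Z w = false.
  rewrite -(evZ v) bd_map (bigD1 v) ?hv //= (big_pred1 w) // => y.
  rewrite hE // eqxx /=; case: (eqVneq y v) => [->|] /=; last by rewrite andbT.
  by rewrite (negPf vw).
have bdP x : bd s t [set e; e'] x = (v == x) (+) (w == x).
  rewrite pair_symd bd_symd !(@bd_opposite _ _ _ u) // -/v -/w.
  by case: (u == x); case: (v == x); case: (w == x).
case bv: (bd s t Z v) vw2 => /= bw.
  exists (symd Z [set e; e']); split.
  - apply/subsetP=> x; rewrite !inE; case xZ: (x \in Z) => /=.
      by rewrite (subsetP ZE).
    by case/orP=> /eqP->.
  - move=> x; rewrite bd_symd bdP.
    have [->|xv] := eqVneq x v; first by rewrite bv /= [w == v]eq_sym (negPf vw).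
    have [->|xw] := eqVneq x w; first by rewrite (negbFE bw).
    by rewrite out.
  - rewrite muE; last first.
      apply/subsetP=> x; rewrite !inE; case xZ: (x \in Z) => /=.
        by rewrite (subsetP ZE).
      by case/orP=> /eqP->.
    rewrite !inE eqxx orbT (negPf e'Z) /=; apply/setP=> x; rewrite !inE.
    by rewrite -addbA addbb addbF.
exists Z; split=> // x.
have [->|xv] := eqVneq x v; first exact: bv.
have [->|xw] := eqVneq x w; first exact: bw.
exact: out.
Qed.

(** A cut shrinks only if both [e] and [e'] belong to it, and then by 2. As odd cuts have at least
    11 edges, only one with exactly 11 could become too small, and [safe] excludes it. *)
Lemma odd_large_fold : odd_large E1 (h \o s) (h \o t).
Proof.
move=> Z ZE1 /(dual_pair_fold ZE1)[Y0 ->].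
(* Complementing puts [f] outside, which is where [safe] speaks. *)
have [Y fY ->] : exists2 Y : {set F}, f \notin Y & cut E1 l' r' Y0 = cut E1 l' r' Y.
  have [fY|fY] := boolP (f \in Y0); last by exists Y0.
  by exists (~: Y0); rewrite ?cutC // inE fY.
rewrite cut_fold muE ?cut_subset //.
case: ifP => [e'Y|_]; last exact: (odd_cut dp ol).
have [a'Y|a'Y] := boolP (a' \in Y); last first.
  by move: e'Y; rewrite inE e'E (opposite_mem Y e'f) -/a' (negPf fY) (negPf a'Y).
have eY : (e \in cut E0 l r Y) = (a \in Y).
  by rewrite inE eE (opposite_mem Y ef) -/a (negPf fY).
have c2 : #|[set e; e']| = 2 by rewrite cards2 ee'.
have [aY|aY] := boolP (a \in Y); rewrite ?aY ?(negPf aY) in eY.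
  have := card_symd (cut E0 l r Y) [set e; e'].
  have -> : cut E0 l r Y :&: [set e; e'] = [set e; e'].
    by apply/setIidPr; apply/subsetP=> x /set2P[]->.
  rewrite c2 => cS; have oS := odd_symd (cut E0 l r Y) [set e; e'].
  rewrite c2 /= addbF in oS; rewrite oS => oY.
  have := odd_cut dp ol oY; have := safe fY aY a'Y; move: cS oY.
  by move: #|_| #|_|; clear; lia.
have := card_symd (cut E0 l r Y) [set e; e'].
have -> : cut E0 l r Y :&: [set e; e'] = [set e'].
  apply/setP=> x; rewrite in_setI in_set2 in_set1.
  by case: (eqVneq x e) => [->|_] /=; [rewrite eY (negPf ee')|case: eqP => [->|]; rewrite ?e'Y ?andbF].
rewrite c2 cards1 => cS; have oS := odd_symd (cut E0 l r Y) [set e; e'].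
rewrite c2 /= addbF in oS; rewrite oS => oY.
have := odd_cut dp ol oY; move: cS.
by move: #|_| #|_|; clear; lia.
Qed.

Lemma colorable_fold : colorable5 E0 s t.
Proof.
have lt : #|E1| < #|E0| by rewrite /E1 [X in _ < X](cardsD1 e') e'E.
have [c cP] := IH lt dual_pair_fold odd_large_fold.
exists (c \o h) => x xE /=; have [xe'|xe'] := eqVneq x e'; last first.
  by apply: cP; rewrite !inE xe'.
have := cP e; rewrite !inE ee' eE => /(_ isT) /=; rewrite xe'.
have hvw : h v = h w by rewrite /h eqxx; case: ifP.
move: hvw; rewrite /v /w /opposite.
case: (s e =P u) eu => [-> _|_ /= /eqP->]; case: (s e' =P u) e'u => [-> _|_ /= /eqP->] -> //;
by rewrite near5C.
Qed.

End Fold.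
Lemma cut1E E0 l r e f : (e \in cut E0 l r [set f]) = (e \in E0) && ((l e == f) (+) (r e == f)).
Proof. by rewrite !inE. Qed.

(** If no pair is safe, any two edges of [f] with a common end have their far faces in a set with
    cut 11 that avoids [f]. Uncrossing merges such sets along chains of edges, so a maximal one,
    [X], contains the far faces of a whole component [K] of the boundary of [f]. A component
    replaces the full boundary because the latter need not be connected. [K] is an even set of even
    size, so taking it out of the cut of [X] leaves an odd cut with fewer than 11 edges. *)
Lemma safe_pair E0 s t l r f : dual_pair E0 s t l r -> odd_large E0 s t ->
  0 < #|cut E0 l r [set f]| <= 10 ->
  exists e e' u, [/\ e \in cut E0 l r [set f], e' \in cut E0 l r [set f], e != e',
    ((s e == u) || (t e == u)) && ((s e' == u) || (t e' == u)) &
    forall X, f \notin X -> opposite l r e f \in X -> opposite l r e' f \in X ->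
      #|cut E0 l r X| <> 11].
Proof.
move=> dp ol /andP[d0 d10]; set D := cut E0 l r [set f] in d0 d10 *.
pose a e := opposite l r e f.
pose inc e u := (s e == u) || (t e == u).
pose safe e e' := [forall X : {set F}, [&& f \notin X, a e \in X & a e' \in X] ==>
  (#|cut E0 l r X| != 11)].
have [/existsP[e /existsP[e' /existsP[u /and5P[eD e'D ee' eu sf]]]]|/existsPn nosafe] :=
  boolP [exists e, [exists e', [exists u, [&& e \in D, e' \in D, e != e',
    inc e u && inc e' u & safe e e']]]].
  exists e, e', u; split=> // X fX aX a'X; apply/eqP.
  by have /forallP/(_ X) := sf; rewrite fX aX a'X.
have DE e : e \in D -> (l e == f) (+) (r e == f) by rewrite cut1E => /andP[].
have DE0 e : e \in D -> e \in E0 by rewrite cut1E => /andP[].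
have {}nosafe e e' u : e \in D -> e' \in D -> e != e' -> inc e u -> inc e' u ->
    exists2 X : {set F}, #|cut E0 l r X| = 11 & [&& f \notin X, a e \in X & a e' \in X].
  move=> eD e'D ee' eu e'u; have := nosafe e; rewrite negb_exists => /forallP/(_ e').
  rewrite negb_exists => /forallP/(_ u); rewrite eD e'D ee' eu e'u /=.
  by rewrite negb_forall => /existsP[X]; rewrite negb_imply negbK => /andP[? /eqP]; exists X.
have af e : e \in D -> a e != f.
  by move/DE; rewrite /a /opposite; case: (eqVneq (l e) f).
have edge e X Y : e \in D -> a e \in X -> a e \in Y -> f \notin X -> f \notin Y ->
   (l e \in X :&: Y) && (r e \notin X :|: Y) || (r e \in X :&: Y) && (l e \notin X :|: Y).
  move=> /DE; rewrite /a /opposite; case: (l e =P f) => [-> _|_ /= /eqP->] aX aY fX fY.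
    by rewrite !inE aX aY (negPf fX) (negPf fY) orbT.
  by rewrite !inE aX aY (negPf fX) (negPf fY).
have cutX e X : e \in D -> f \notin X -> a e \in X -> e \in cut E0 l r X.
  move=> eD fX aX; rewrite inE (DE0 _ eD) /=; move: (DE _ eD) aX.
  by rewrite /a /opposite; case: (l e =P f) => [-> _ ->|_ /= /eqP-> ->]; rewrite (negPf fX).
have [e0 e0D] := card_gt0P d0.
pose sh e e' := [&& e \in D, e' \in D & [exists u, inc e u && inc e' u]].
have shC : symmetric sh.
  move=> e e'; rewrite /sh andbCA; congr [&& _, _ & _].
  by apply: eq_existsb => u; rewrite andbC.
pose K := [set e | connect sh e0 e].
have e0K : e0 \in K by rewrite inE connect0.
have KD : K \subset D.
  apply/subsetP=> e; rewrite inE => /connectP[p]; elim/last_ind: p => [_ -> //|p x _].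
  by rewrite rcons_path last_rcons => /andP[_ /and3P[_ xD _]] ->.
have evD : even_set s t D := cut_even _ dp.
(* At every vertex [K] contains all edges of [D] or none of them, so it inherits evenness. *)
have evK : even_set s t K.
  move=> v; rewrite -(evD v) !bdE.
  have [/existsP[e /andP[eK ev]]|/existsPn no] := boolP [exists e, (e \in K) && inc e v].
    apply: eq_bigr => x _; case xv: ((s x == v) (+) (t x == v)); rewrite ?andbF // !andbT.
    have xinc : inc x v by rewrite /inc; move: xv; case: (s x == v).
    apply/idP/idP => [|xD]; first exact: (subsetP KD).
    have ske : sh e x.
      by rewrite /sh (subsetP KD _ eK) xD; apply/existsP; exists v; rewrite ev.
    by move: eK; rewrite !inE => /connect_trans; apply; exact: connect1.
  have D0 : bd s t D v = bd s t D v by [].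
  rewrite [RHS](_ : _ = false); last by rewrite -bdE.
  rewrite big1 // => x _; have := no x; rewrite negb_and /inc.
  by case: (x \in K) => //=; rewrite negb_or => /andP[/negPf-> /negPf->].
have KE0 : K \subset E0 by apply: subset_trans KD _; exact: cut_subset.
have K10 : #|K| <= 10 by apply: leq_trans d10; exact: subset_leq_card.
have oK : odd #|K| = false.
  by apply/negP=> oK; have := ol K KE0 evK oK; rewrite ltnNge K10.
have [YK YKE] := (dp K KE0).1 evK.
(* [D] is even and [e0] is no loop, so a second edge of [D] meets [s e0]; this pair yields a first
   set with cut 11. *)
have [e1 [e1D ne1 e1s]] : exists e1, [/\ e1 \in D, e1 != e0 & inc e1 (s e0)].
  have [/existsP[e1 /and3P[]]|/existsPn no] :=
    boolP [exists e1, [&& e1 \in D, e1 != e0 & inc e1 (s e0)]]; first by exists e1.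
  have := evD (s e0); rewrite /bd (bigD1 e0) //= eqxx big1 => [|x /andP[xD xe]].
    by rewrite addbF eq_sym (negPf (noloop5 ol (DE0 _ e0D))).
  by have := no x; rewrite xD xe /inc negb_or => /andP[/negPf-> /negPf->].
have [||X1 dX1 /and3P[fX1 a0X1 _]] := nosafe e0 e1 (s e0) e0D e1D _ _ e1s.
- by rewrite eq_sym.
- by rewrite /inc eqxx.
pose dang (X : {set F}) := [&& #|cut E0 l r X| == 11, f \notin X & a e0 \in X].
have dang1 : dang X1 by rewrite /dang dX1 fX1 a0X1.
have [X maxX _] := @maxset_exists F dang X1 dang1.
have /and3P[/eqP dX fX a0X] := maxsetp maxX.
have closed e : connect sh e0 e -> a e \in X.
  case/connectP=> p; elim/last_ind: p e => [|p x IHp] e; first by move=> _ ->.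
  rewrite rcons_path last_rcons => /andP[pp /and3P[yD xD /existsP[u /andP[yu xu]]]] ->.
  have yX := IHp _ pp erefl; set y := last e0 p in yD yu yX.
  have [->//|yx] := eqVneq x y.
  have yx' : y != x by rewrite eq_sym.
  have [Y dY /and3P[fY yY xY]] := nosafe y x u yD xD yx' yu xu.
  have odd11 W : odd #|cut E0 l r W| -> 10 < #|cut E0 l r W|.
    exact: (odd_cut dp ol).
  have dU := tight_union odd11 (DE0 _ yD) dX dY (edge _ _ _ yD yX yY fX fY).
  have dangU : dang (X :|: Y).
    by rewrite /dang dU eqxx !inE negb_or fX fY a0X.
  by rewrite -(maxsetsup maxX dangU (subsetUl _ _)) inE xY orbT.
have KX : K \subset cut E0 l r X.
  apply/subsetP=> e eK; apply: cutX => //; first exact: (subsetP KD).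
  by apply: closed; move: eK; rewrite inE.
have sE : symd (cut E0 l r X) K = cut E0 l r (symd X YK) by rewrite cut_symd -YKE.
have := card_symd (cut E0 l r X) K; rewrite (setIidPr KX) dX sE => cS.
have := odd_symd (cut E0 l r X) K; rewrite dX oK sE /= => /(odd_cut dp ol).
have K0 : 0 < #|K| by apply/card_gt0P; exists e0.
by move: cS K0; clear; move: #|_| #|_|; lia.
Qed.

End DualPair.

(** * Even sets under contraction *)

Section Lift.
Variables (V E : finType).
Implicit Types (s t : E -> V).

Definition joined (E1 : {set E}) s t x y := [exists e in E1,
  ((s e == x) && (t e == y)) || ((s e == y) && (t e == x))].

Lemma joinedC E1 s t : symmetric (joined E1 s t).
Proof. by move=> x y; apply: eq_existsb => e; rewrite orbC. Qed.

Lemma path_chain (E1 : {set E}) s t x y : connect (joined E1 s t) x y ->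
  exists J : {set E}, J \subset E1 /\ forall v, bd s t J v = (x == v) (+) (y == v).
Proof.
case/connectP=> p; elim/last_ind: p y => [|p z IHp] y /=.
  by move=> _ ->; exists set0; split; [exact: sub0set|move=> v; rewrite bd0 addbb].
rewrite rcons_path last_rcons => /andP[pp /exists_inP[e eE1 H]] ->.
have [J [JE1 bJ]] := IHp _ pp erefl.
exists (symd J [set e]); split=> [|v].
  apply/subsetP=> x'; rewrite !inE; case xJ: (x' \in J) => /=; first by rewrite (subsetP JE1).
  by move/eqP->.
rewrite bd_symd bJ bd1; case/orP: H => /andP[/eqP-> /eqP->].
  by case: (x == v); case: (_ == v); case: (z == v).
by case: (x == v); case: (_ == v); case: (z == v).
Qed.

(** For each vertex [x] in the boundary of [W] the chain [J x] moves [x] to [h x]. After the move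
    the boundary is that of the contracted set, which is zero. *)
Lemma lift_even (E1 W : {set E}) s t (h : V -> V) :
  (forall x, exists J : {set E}, J \subset E1 /\
     forall v, bd s t J v = (x == v) (+) (h x == v)) ->
  even_set (h \o s) (h \o t) W ->
  exists Z : {set E}, Z \subset E1 /\ even_set s t (symd W Z).
Proof.
move=> /fin_all_exists[J JP] evW.
pose Z := [set e | \big[addb/false]_(x | bd s t W x) (e \in J x)].
exists Z; split=> [|v].
  apply/subsetP=> e; rewrite inE; apply: contraTT => eE1.
  rewrite big1 // => x _; apply: contraNF eE1.
  by have [/subsetP JE _] := JP x; exact: JE.
have -> : bd s t (symd W Z) v = bd s t W v (+) bd s t Z v := bd_symd _ _ _ _ _.
have -> : bd s t Z v = \big[addb/false]_(x | bd s t W x) bd s t (J x) v.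
  under [RHS]eq_bigr do rewrite bdE; rewrite exchange_big bdE /=.
  apply: eq_bigr => e _; rewrite inE; case: (_ (+) _); rewrite ?andbT ?andbF.
    by apply: eq_bigr => x _; rewrite andbT.
  by rewrite big1 // => x _; rewrite andbF.
have -> : \big[addb/false]_(x | bd s t W x) bd s t (J x) v =
   \big[addb/false]_(x | bd s t W x) (x == v) (+) \big[addb/false]_(x | bd s t W x) (h x == v).
  by rewrite -big_split; apply: eq_bigr => x _; rewrite (JP x).2.
have -> : \big[addb/false]_(x | bd s t W x) (x == v) = bd s t W v.
  rewrite big_mkcond (bigD1 v) //= eqxx big1 ?addbF => [|x xv]; first by case: ifP.
  by rewrite (negPf xv); case: ifP.
have -> : \big[addb/false]_(x | bd s t W x) (h x == v) = bd (h \o s) (h \o t) W v.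
  rewrite bd_map [LHS]big_mkcond [RHS]big_mkcond; apply: eq_bigr => x _.
  by case: (bd s t W x); case: (h x == v).
by rewrite evW addbF addbb.
Qed.

(** The lower bound [|W0| - |A| + 1] for the dimension of the cycle space, stated with
    cardinalities. One vertex is saved because the boundary at [a0] is the sum of all the others. *)
Lemma even_count s t (W0 : {set E}) (A : {set V}) a0 : a0 \in A ->
  (forall e, e \in W0 -> (s e \in A) && (t e \in A)) ->
  2 ^ #|W0| <= #|[set W in powerset W0 | [forall v, ~~ bd s t W v]]| * 2 ^ #|A :\ a0|.
Proof.
move=> a0A WA; set Ker := [set W in _ | _].
pose b (W : {set E}) := [set v in A :\ a0 | bd s t W v].
pose rep B := odflt set0 [pick W in powerset W0 | b W == B].
have repP W : W \in powerset W0 -> rep (b W) \in powerset W0 /\ b (rep (b W)) = b W.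
  move=> WW; rewrite /rep; case: pickP => [W' /andP[? /eqP]|/(_ W)] //=.
  by rewrite WW eqxx.
have outA W v : W \in powerset W0 -> v \notin A -> bd s t W v = false.
  rewrite powersetE => WW vA; rewrite /bd big1 // => e eW.
  have /andP[sA tA] := WA e (subsetP WW _ eW).
  have ne x : x \in A -> (x == v) = false.
    by move=> xA; apply: contraNF vA => /eqP <-.
  by rewrite !ne.
(* A set is recovered from its boundary and from its difference to a chosen set with the same
   boundary, which is an even set. *)
pose phi W := (b W, symd W (rep (b W))).
have inj : {in powerset W0 &, injective phi}.
  move=> W W' _ _ [eb]; rewrite eb => /setP E1; apply/setP=> e.
  by have := E1 e; rewrite !inE => /(congr1 (addb^~ (e \in rep (b W')))); rewrite /= !addbK.
rewrite mulnC -!card_powerset -cardsX -(card_in_imset inj).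
apply: subset_leq_card; apply/subsetP=> _ /imsetP[W WW ->].
have [rW rE] := repP W WW.
rewrite in_setX powersetE; apply/andP; split; first by apply/subsetP=> v; rewrite inE => /andP[].
have sub : symd W (rep (b W)) \in powerset W0.
  move: WW rW; rewrite !powersetE => /subsetP WW /subsetP rW; apply/subsetP=> e.
  by rewrite inE; case eW: (e \in W) => /= H; [exact: WW|exact: rW].
rewrite inE sub /=.
have zero v : v != a0 -> bd s t (symd W (rep (b W))) v = false.
  move=> va; have [vA|vA] := boolP (v \in A); last exact: outA.
  rewrite bd_symd; move/setP/(_ v): rE; rewrite !inE va vA /= => ->.
  by rewrite addbb.
apply/forallP=> v; have [->|va] := eqVneq v a0; last by rewrite zero.
have := bd_total s t (symd W (rep (b W))).
by rewrite (bigD1 a0) //= big1 => [|x]; [rewrite addbF => ->|exact: zero].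
Qed.

End Lift.

(** * A minimal region with a small cut *)

Section Peel.
Variables (V E F : finType) (E0 : {set E}) (s t : E -> V) (l r : E -> F).
Hypothesis dp : dual_pair E0 s t l r.
Hypothesis ol : odd_large E0 s t.
Hypothesis E0n : E0 != set0.
Hypothesis big_faces : forall f, #|cut E0 l r [set f]| = 0 \/ 10 < #|cut E0 l r [set f]|.
Hypothesis IH : forall (E1 : {set E}) (s1 t1 : E -> V) (l1 r1 : E -> F),
  #|E1| < #|E0| -> dual_pair E1 s1 t1 l1 r1 -> odd_large E1 s1 t1 -> colorable5 E1 s1 t1.

Let inside (X : {set F}) := [set e in E0 | (l e \in X) && (r e \in X)].
Let d (X : {set F}) := #|cut E0 l r X|.

(** Minimality is among sets with an inner edge, so a proper part [Y] with a small cut has none. If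
    an edge touches [Y], some face of [Y] has more than 10 edges, all of them in the cut of [Y]; if
    none does, [X] without [Y] is a smaller candidate. The set of all faces, with its empty cut,
    shows that candidates exist. *)
Lemma small_cut_region : exists X : {set F}, [/\ d X <= 10, inside X != set0 &
  forall Y : {set F}, Y \proper X -> Y != set0 -> 10 < d Y].
Proof.
pose q (X : {set F}) := (d X <= 10) && (inside X != set0).
have qT : q setT.
  apply/andP; split.
    by rewrite /d (_ : cut _ _ _ _ = set0) ?cards0 //; apply/setP=> e; rewrite !inE /= andbF.
  by apply: contraNneq E0n => E1; rewrite -E1; apply/eqP/setP=> e; rewrite !inE /= andbT.
have [X minX _] := minset_exists qT.
have /andP[dX iX] := minsetp minX.
exists X; split=> // Y YX Y0; rewrite ltnNge; apply/negP=> dY.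
have noq (Z : {set F}) : Z \proper X -> ~~ q Z.
  move=> ZX; apply/negP=> qZ; have := minsetinf minX qZ (proper_sub ZX).
  by move=> E1; move: ZX; rewrite E1 properxx.
have iY : inside Y = set0.
  by apply/eqP; have := noq Y YX; rewrite /q dY /= negbK.
have noY e : e \in E0 -> (l e \in Y) || (r e \in Y) -> False.
  move=> eE eY; have nin : ~~ ((l e \in Y) && (r e \in Y)).
    by apply/negP=> H; have : e \in inside Y; [rewrite inE eE | rewrite iY inE].
  have [f fY ef] : exists2 f, f \in Y & (l e == f) (+) (r e == f).
    case lY: (l e \in Y) eY nin => /= rY nY; [exists (l e)|exists (r e)] => //.
      by rewrite eqxx /=; apply: contraNneq nY => ->.
    by rewrite eqxx addbT; apply: contraFneq lY => ->.
  have sub : cut E0 l r [set f] \subset cut E0 l r Y.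
    apply/subsetP=> e'; rewrite !inE => /andP[e'E H]; rewrite e'E /=.
    have : ~~ ((l e' \in Y) && (r e' \in Y)).
      by apply/negP=> H'; have : e' \in inside Y; [rewrite inE e'E | rewrite iY inE].
    by move: H; case: (l e' =P f) => [->|_]; case: (r e' =P f) => [->|_] //= _; rewrite fY ?andbT ?addbT.
  have := subset_leq_card sub; have : 0 < #|cut E0 l r [set f]|.
    by apply/card_gt0P; exists e; rewrite cut1E eE.
  by case: (big_faces f) => [->//|lt _ le]; have := leq_trans lt (leq_trans le dY).
have YX' := proper_sub YX.
have : q (X :\: Y).
  rewrite /q /d (_ : cut E0 l r (X :\: Y) = cut E0 l r X); last first.
    apply/setP=> e; rewrite !inE; case eE: (e \in E0) => //=.
    have := noY e eE; case: (l e \in Y); case: (r e \in Y) => //= H; by case: H.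
  rewrite -/(d X) dX /=; apply: contraNneq iX => iE; rewrite -iE; apply/eqP/setP=> e.
  rewrite !inE; case eE: (e \in E0) => //=.
  have := noY e eE; case: (l e \in Y); case: (r e \in Y) => //= H; by case: H.
apply/negP/noq; apply/properP; split; first exact: subsetDl.
have /set0Pn[f fY] := Y0; exists f; first exact: (subsetP YX').
by rewrite inE fY.
Qed.

Section Region.
Variable X : {set F}.
Hypotheses (dX : d X <= 10) (iX : inside X != set0).
Hypothesis properX : forall Y : {set F}, Y \proper X -> Y != set0 -> 10 < d Y.

Let EX := inside X.
Let E1 := E0 :\: EX.

Lemma EX_sub : EX \subset E0.
Proof. by apply/subsetP=> e; rewrite inE => /andP[]. Qed.

Lemma X_neq0 : X != set0.
Proof.
apply: contraNneq iX => X0; apply/eqP/setP=> e.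
by rewrite inE X0 !inE !andbF.
Qed.

(** Deleting the inner edges of [X] contracts [X] to the face [x0] in the dual. A cut without inner
    edges cannot split [X]: the cut of [X :&: Y] would be contained in that of [X] and have at most
    10 edges, against [properX]. *)
Lemma outside_colorable : colorable5 E1 s t.
Proof.
have /set0Pn[x0 x0X] := X_neq0.
pose l1 e := if l e \in X then x0 else l e.
pose r1 e := if r e \in X then x0 else r e.
apply: (@IH E1 s t l1 r1).
- rewrite /E1 cardsD (setIidPr EX_sub) -subn_gt0 subKn ?subset_leq_card ?EX_sub //.
  by rewrite card_gt0.
- move=> Z ZE1; have ZE0 : Z \subset E0 by apply: subset_trans ZE1 (subsetDl _ _).
  split=> [/(dp ZE0)[Y ZY]|[Y ->]].
    exists Y; rewrite ZY.
    have sep : (forall f, f \in X -> (f \in Y) = (x0 \in Y)).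
      suff : X :&: Y = set0 \/ X :&: Y = X.
        case=> /setP H f fX; have := H f; have := H x0.
          by rewrite !inE fX x0X /= => -> ->.
        by rewrite !inE fX x0X /= => -> ->.
      have [XY0|XYn] := eqVneq (X :&: Y) set0; first by left.
      have [XYX|XYX] := eqVneq (X :&: Y) X; first by right.
      have pr : X :&: Y \proper X by rewrite properEneq XYX subsetIl.
      have := properX pr XYn; rewrite ltnNge (leq_trans _ dX) //.
      apply: subset_leq_card; apply/subsetP=> e; rewrite !inE.
      case eE: (e \in E0) => //=.
      have : (e \in EX) -> (l e \in Y) (+) (r e \in Y) = false.
        move=> eX; apply/negP=> H.
        have : e \in Z by rewrite ZY inE eE.
        by move/(subsetP ZE1); rewrite inE eX.
      rewrite inE eE /=; case: (l e \in X); case: (r e \in X) => //= H.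
      by rewrite (H isT).
    apply/setP=> e; rewrite !inE; case eE: (e \in E0); rewrite ?andbF //= andbT.
    have side x : (x \in Y) = ((if x \in X then x0 else x) \in Y).
      by case: ifP => // xX; rewrite sep.
    case eX: ((l e \in X) && (r e \in X)) => /=.
      by case/andP: eX => lX rX; rewrite !sep // addbb.
    by rewrite /l1 /r1 -!side.
  have -> : cut E1 l1 r1 Y = cut E0 l r [set f | (if f \in X then x0 else f) \in Y].
    apply/setP=> e; rewrite !inE; case eE: (e \in E0); rewrite ?andbF //= andbT.
    rewrite /l1 /r1; case: ifP => lX; case: ifP => rX //=.
    by rewrite addbb.
  exact: (cut_even _ dp).
- move=> Z ZE1; apply: ol; apply: subset_trans ZE1 (subsetDl _ _).
Qed.

(** Each component of [E1] is named by its root, so composing with [rt] contracts the outside part,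
    which is coloured already. *)
Let rt := fingraph.root (joined E1 s t).

Lemma rt_lift x : exists J : {set E}, J \subset E1 /\
     forall v, bd s t J v = (x == v) (+) (rt x == v).
Proof. by apply: path_chain; exact: connect_root. Qed.

Section Subregion.
Variables (A : {set V}) (a0 : V).
Hypothesis a0A : a0 \in A.
Let EA := inner_edges EX (rt \o s) (rt \o t) A.
(** Deleting the inner edges outside [EA] merges the faces that they separate. [T] lists the parts
    into which [X] is then divided, each named by its root. *)
Let near f g := joined (EX :\: EA) l r f g.
Let rho := fingraph.root near.
Let T := rho @: X.

Lemma near_sym : connect_sym near.
Proof. apply: sym_connect_sym; exact: joinedC. Qed.

(** With several parts each one is a nonempty proper subset of [X] and has at least 11 cut edges. An
    edge of [EA] is counted for at most two parts, an edge of the cut of [X] for at most one, any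
    other edge for none. *)
Lemma parts_card : 1 < #|T| -> 11 * #|T| <= 2 * #|EA| + 10.
Proof.
move=> T1.
pose P tau := [set f in X | rho f == tau].
have PT tau : tau \in T -> 10 < d (P tau).
  case/imsetP=> f fX ->; apply: properX; last first.
    by apply/set0Pn; exists f; rewrite inE fX eqxx.
  apply/properP; split; first by apply/subsetP=> g; rewrite inE => /andP[].
  have /card_gt0P[tau'] : 0 < #|T :\ rho f|.
    by move: T1; rewrite (cardsD1 (rho f)) imset_f.
  rewrite !inE => /andP[ne /imsetP[g gX E2]]; exists g => //.
  by rewrite inE gX /= -E2.
have : \sum_(tau in T) 11 <= \sum_(tau in T) d (P tau) by apply: leq_sum.
rewrite sum_nat_const mulnC => /leq_trans; apply.
apply: (@leq_trans (2 * #|EA| + d X)); last by rewrite leq_add2l.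
rewrite /d; under eq_bigr do rewrite cut_cardE.
rewrite exchange_big /= cut_cardE mulnC -sum_nat_const.
have -> : \sum_(i in EA) 2 = \sum_(e in E0) 2 * (e \in EA).
  rewrite big_mkcond [RHS]big_mkcond; apply: eq_bigr => e _.
  case eA: (e \in EA); last by rewrite muln0; case: ifP.
  by move: eA; rewrite !inE => /andP[/andP[-> _] _].
rewrite -big_split; apply: leq_sum => e eE /=.
have one f : \sum_(tau in T) (f \in P tau) <= (f \in X).
  case fX: (f \in X); last by rewrite big1 // => tau _; rewrite inE fX.
  rewrite (bigD1 (rho f)) ?imset_f //= big1 ?addn0 => [|tau /andP[_ ne]].
    by case: (_ \in _).
  by rewrite inE eq_sym (negPf ne) andbF.
have le2 : \sum_(tau in T) ((l e \in P tau) (+) (r e \in P tau)) <= (l e \in X) + (r e \in X).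
  apply: leq_trans (leq_add (one (l e)) (one (r e))).
  rewrite -big_split; apply: leq_sum => tau _ /=.
  by case: (_ \in _); case: (_ \in _).
case eA: (e \in EA).
  by apply: leq_trans le2 _; case: (_ \in _); case: (_ \in _).
case eX: (e \in EX); last first.
  rewrite muln0 add0n; move: eX; rewrite inE eE /= => eX.
  by apply: leq_trans le2 _; move: eX; case: (l e \in X); case: (r e \in X).
rewrite big1 // => tau _.
have E2 : rho (l e) = rho (r e).
  apply/(fingraph.rootP near_sym)/connect1/exists_inP; exists e; last by rewrite !eqxx.
  by rewrite inE eA eX.
have [_ lX rX] : [/\ e \in E0, l e \in X & r e \in X].
  by move: eX; rewrite inE => /and3P[].
by rewrite !inE lX rX E2 addbb.
Qed.

(** An even set of the contracted graph lifts through [E1] to an even set of the whole graph, hence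
    to the cut of some [Y]. No inner edge outside [EA] belongs to it, so [Y] is a union of parts as
    far as [X] is concerned, and complementing keeps one chosen part out of it. *)
Lemma cycles_card : 
  #|[set W in powerset EA | [forall v, ~~ bd (rt \o s) (rt \o t) W v]]| <= 2 ^ #|T|.-1.
Proof.
have /set0Pn[x0 x0X] := X_neq0.
have tT : rho x0 \in T by apply: imset_f.
have -> : #|T|.-1 = #|T :\ rho x0| by rewrite (cardsD1 (rho x0)) tT.
rewrite -card_powerset.
pose psi (tau : {set F}) := [set e in EA | (rho (l e) \in tau) (+) (rho (r e) \in tau)].
apply: (@leq_trans #|psi @: powerset (T :\ rho x0)|); last exact: leq_imset_card.
apply: subset_leq_card; apply/subsetP=> W; rewrite inE powersetE => /andP[WA /forallP evW].
have [|Z1 [Z1E evZ]] := @lift_even _ _ E1 W s t rt rt_lift.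
  by move=> v; apply/negbTE.
have EAX : EA \subset EX by apply/subsetP=> e; rewrite inE => /andP[].
have ZE0 : symd W Z1 \subset E0.
  apply/subsetP=> e; rewrite inE; case eW: (e \in W) => /= eZ.
    exact: (subsetP EX_sub _ (subsetP EAX _ (subsetP WA _ eW))).
  by have := subsetP Z1E _ eZ; rewrite inE => /andP[].
have [Y0 Y0E] := (dp ZE0).1 evZ.
have [Y x0Y YE] : exists2 Y : {set F}, rho x0 \notin Y & symd W Z1 = cut E0 l r Y.
  have [x0Y|x0Y] := boolP (rho x0 \in Y0); last by exists Y0.
  by exists (~: Y0); rewrite ?cutC // inE x0Y.
have WE e : e \in EX -> (e \in W) = ((l e \in Y) (+) (r e \in Y)).
  move=> eX; move/setP/(_ e): YE; rewrite !inE (subsetP EX_sub _ eX) /= => <-.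
  case eZ: (e \in Z1); last by rewrite addbF.
  by move/(subsetP Z1E): eZ; rewrite inE eX.
have cl : closed near (mem Y).
  apply: intro_closed; first exact: near_sym.
  move=> x y /exists_inP[e]; rewrite in_setD => /andP[eA eX] H.
  have := WE e eX; have -> : e \in W = false by apply: contraNF eA; exact: (subsetP WA).
  by case/orP: H => /andP[/eqP<- /eqP<-]; case: (l e \in Y); case: (r e \in Y).
have rhoY f : (rho f \in Y) = (f \in Y) by rewrite -(closed_connect cl (connect_root near f)).
apply/imsetP; exists (T :&: Y).
  rewrite powersetE; apply/subsetP=> f; rewrite !inE => /andP[fT fY]; rewrite fT andbT.
  by apply: contraNneq x0Y => <-.
apply/setP=> e; rewrite [RHS]inE; case eA: (e \in EA) => /=; last first.
  by apply: contraFF eA; exact: (subsetP WA).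
have eX := subsetP EAX _ eA; rewrite (WE _ eX).
have [_ lX rX] : [/\ e \in E0, l e \in X & r e \in X].
  by move: eX; rewrite inE => /and3P[].
by rewrite !in_setI !imset_f //= !rhoY.
Qed.

(** The cycle space has dimension at least [|EA| - |A| + 1] and at most [|T| - 1]. With several
    parts, [parts_card] turns this into [9 |EA| + 12 <= 11 |A|]; with one part there are no cycles
    and [|EA| < |A|]. *)
Lemma subregion_sparse : 9 * #|EA| + 7 <= 11 * #|A|.
Proof.
have T0 : 0 < #|T|.
  have /set0Pn[x0 x0X] := X_neq0.
  by apply/card_gt0P; exists (rho x0); apply: imset_f.
have : #|EA| <= #|T|.-1 + #|A :\ a0|.
  rewrite -(@leq_exp2l 2) // expnD.
  apply: leq_trans (leq_mul cycles_card (leqnn _)).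
  by apply: even_count => // e; rewrite inE => /andP[].
have : #|A| = #|A :\ a0|.+1 by rewrite (cardsD1 a0) a0A.
have := parts_card; move: #|EA| #|A| #|A :\ a0| #|T| T0; clear.
move=> a b c n; case: n => [|[|n]] // _ H -> le; first by lia.
by have := H isT; lia.
Qed.

End Subregion.

(** An outside component can be shifted by a constant without disturbing its edges. The constants
    are the values of [d0], and for the inner edges the outside colouring [c0] turns into the gain
    [g]. *)
Lemma region_colorable : colorable5 E0 s t.
Proof.
have [c0 c0P] := outside_colorable.
pose g e := (c0 (s e) - c0 (t e))%R.
have [|d0 d0P] := @sparse_gain_colorable V E [set rt x | x in V] EX (rt \o s) (rt \o t) g.
  by move=> A _ /set0Pn[a0 a0A]; apply: (@subregion_sparse A a0).
exists (fun x => d0 (rt x) + c0 x)%R => e eE.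
have [eX|eX] := boolP (e \in EX).
  have /d0P : e \in inner_edges EX (rt \o s) (rt \o t) [set rt x | x in V].
    by rewrite inE eX /= !imset_f.
  rewrite /gain_ok /= -(near5D (c0 (t e))) => H.
  by rewrite (_ : d0 (rt (s e)) + c0 (s e) = d0 (rt (s e)) + g e + c0 (t e))%R // /g; ring.
have eE1 : e \in E1 by rewrite inE eX.
have -> : rt (t e) = rt (s e).
  apply/(fingraph.rootP (sym_connect_sym (joinedC _ _ _)))/connect1/exists_inP.
  by exists e => //; rewrite !eqxx orbT.
by rewrite ![(d0 _ + _)%R]addrC near5D; exact: c0P.
Qed.

End Region.

Lemma peel_colorable : colorable5 E0 s t.
Proof. by have [X [dX iX pX]] := small_cut_region; exact: (region_colorable dX iX pX). Qed.

End Peel.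

Theorem dual_pair_colorable (V E F : finType) (E0 : {set E}) (s t : E -> V)
    (l r : E -> F) : dual_pair E0 s t l r -> odd_large E0 s t -> colorable5 E0 s t.
Proof.
move: {2}#|E0| (erefl #|E0|) => n; elim/ltn_ind: n E0 s t l r.
move=> n IHn E0 s t l r cE dp ol.
have IH (E1 : {set E}) (s1 t1 : E -> V) (l1 r1 : E -> F) : #|E1| < #|E0| ->
    dual_pair E1 s1 t1 l1 r1 -> odd_large E1 s1 t1 -> colorable5 E1 s1 t1.
  by rewrite cE => lt; exact: (IHn #|E1| lt E1 s1 t1 l1 r1 erefl).
have [->|E0n] := eqVneq E0 set0; first by exists (fun=> 0%R) => e; rewrite inE.
have [/existsP[f fd]|/existsPn big] := boolP [exists f, 0 < #|cut E0 l r [set f]| <= 10].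
  have [e [e' [u [eD e'D ee' /andP[eu e'u] safe]]]] := safe_pair dp ol fd.
  move: eD e'D; rewrite !cut1E => /andP[eE ef] /andP[e'E e'f].
  exact: (@colorable_fold V E F E0 s t l r e e' u f).
apply: (@peel_colorable V E F E0 s t l r) => // f.
have := big f; rewrite negb_and -leqNgt leqn0 -ltnNge.
by case/orP=> [/eqP|]; [left|right].
Qed.

(** * Minors of the square grid *)

Notation site := (int * int)%type.

Definition neighbours (p : site) : seq site :=
  [:: (p.1 + 1, p.2); (p.1 - 1, p.2); (p.1, p.2 + 1); (p.1, p.2 - 1)]%R.

Definition unit_step (p q : site) := q \in neighbours p.

(* The unit square with lower left corner [c] is named [c]; these are the two
   squares on the sides of the unit segment [pq]. *)
Definition corner (p q : site) : site := (Num.min p.1 q.1, Num.min p.2 q.2).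
Definition side (p q : site) : site :=
  if p.2 == q.2 then ((corner p q).1, (corner p q).2 - 1)%R
  else ((corner p q).1 - 1, (corner p q).2)%R.

Lemma unit_stepP p q : reflect
  ([\/ q = (p.1 + 1, p.2), q = (p.1 - 1, p.2), q = (p.1, p.2 + 1) | q = (p.1, p.2 - 1)])%R
  (unit_step p q).
Proof.
rewrite /unit_step /neighbours !inE; apply: (iffP or4P) => -[] => [/eqP|/eqP|/eqP|/eqP|||| ];
  by [constructor 1|constructor 2|constructor 3|constructor 4| move=> ->; rewrite ?eqxx; constructor].
Qed.

Lemma unit_stepC p q : unit_step p q = unit_step q p.
Proof.
by case: p q => [a b] [c d]; rewrite /unit_step !inE !xpair_eqE /=; lia.
Qed.

Lemma cornerC p q : corner p q = corner q p.
Proof. by rewrite /corner minC [Num.min p.2 _]minC. Qed.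

Lemma sideC p q : side p q = side q p.
Proof. by rewrite /side eq_sym cornerC. Qed.

(* The segments of a lattice chain that a leftward ray from the square [c] crosses. *)
Definition crossed (c : site) (a : site * site) : bool :=
  [&& a.1.2 != a.2.2, (corner a.1 a.2).2 == c.2 & (corner a.1 a.2).1 <= c.1]%R.

Definition winding (C : seq (site * site)) c := \big[addb/false]_(a <- C) crossed c a.

Definition same_seg (a b : site * site) := (a == b) || (a == (b.2, b.1)).

(** The lattice points that a leftward ray from the square [c] sweeps over when it moves down by one
    row. *)
Definition left_of (c p : site) : bool := (p.2 == c.2) && (p.1 <= c.1)%R.

Definition step_up (d : bool) (p : site) : site :=
  if d then (p.1 + 1, p.2)%R else (p.1, p.2 + 1)%R.

Lemma unit_step_up p q : unit_step p q -> exists d,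
  (q = step_up d p) \/ (p = step_up d q).
Proof.
case: p q => [a b] [x y] /unit_stepP /= [] [-> ->].
- by exists true; left.
- by exists true; right; rewrite /step_up /= subrK.
- by exists false; left.
- by exists false; right; rewrite /step_up /= subrK.
Qed.

Lemma corner_up d p : corner p (step_up d p) = p.
Proof.
by case: p => x y; case: d; rewrite /corner /step_up /= minxx;
   congr pair; apply: min_l; rewrite lerDl.
Qed.

Lemma crossed_side_up d d' a p :
  crossed (side p (step_up d p)) (a, step_up d' a) (+) crossed p (a, step_up d' a) =
  ((a == p) && (d == d')) (+) (d && (left_of p a (+) left_of p (step_up d' a))).
Proof.
rewrite /crossed /side !corner_up /left_of; case: a p => [x y] [z w].
have nS (i : int) : (i == i + 1)%R = false by lia.
rewrite /step_up xpair_eqE; case: d; case: d' => /=; rewrite ?nS ?eqxx /=; lia.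
Qed.

Lemma crossedC c p q : crossed c (p, q) = crossed c (q, p).
Proof. by rewrite /crossed [corner _ _]cornerC eq_sym. Qed.

Lemma same_segC a p q : same_seg a (p, q) = same_seg a (q, p).
Proof. by rewrite /same_seg orbC. Qed.

Lemma same_seg_swap a b p q : same_seg (a, b) (p, q) = same_seg (b, a) (p, q).
Proof. by rewrite /same_seg !xpair_eqE orbC ![(b == _) && _]andbC. Qed.

Lemma same_seg_up d d' a p :
  same_seg (a, step_up d' a) (p, step_up d p) = (a == p) && (d == d').
Proof.
case: a p => [x y] [z w]; rewrite /same_seg /step_up !xpair_eqE.
case: d; case: d' => /=;
  rewrite !xpair_eqE ?eqxx -?[true == false]/false -?[false == true]/false; lia.
Qed.

(** Across a vertical segment the two rays differ by that segment alone. Across a horizontal one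
    they run in neighbouring rows, and besides the segment itself there is the change of [left_of]
    along [a], which sums to zero over a closed chain. *)
Lemma crossed_side a p q : unit_step a.1 a.2 -> unit_step p q ->
  crossed (side p q) a (+) crossed (corner p q) a =
  same_seg a (p, q) (+)
   ((p.2 == q.2) && (left_of (corner p q) a.1 (+) left_of (corner p q) a.2)).
Proof.
have up d a' p' : unit_step a'.1 a'.2 ->
    crossed (side p' (step_up d p')) a' (+) crossed (corner p' (step_up d p')) a' =
    same_seg a' (p', step_up d p') (+) ((p'.2 == (step_up d p').2) &&
     (left_of (corner p' (step_up d p')) a'.1 (+) left_of (corner p' (step_up d p')) a'.2)).
  have -> : (p'.2 == (step_up d p').2) = d.
    by case: d => /=; [rewrite eqxx | lia].
  case: a' => [b c] /= /unit_step_up[d' [->|->]]; rewrite corner_up.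
    by rewrite crossed_side_up same_seg_up.
  rewrite ![crossed _ (step_up _ _, _)]crossedC crossed_side_up same_seg_swap same_seg_up.
  by rewrite [left_of p' (step_up _ _) (+) _]addbC.
move=> ua /unit_step_up[d [->|->]]; first exact: up.
by rewrite sideC cornerC same_segC eq_sym; exact: up.
Qed.

(** Zero boundary modulo 2, tested against predicates: every site is an end of an even number of
    segments. In this form it can be applied to [left_of] at once. *)
Definition closed_chain (C : seq (site * site)) :=
  forall Q : pred site, \big[addb/false]_(a <- C) (Q a.1 (+) Q a.2) = false.

Lemma winding_side C p q : all (fun a => unit_step a.1 a.2) C -> closed_chain C ->
  unit_step p q ->
  winding C (side p q) (+) winding C (corner p q) =
  \big[addb/false]_(a <- C) same_seg a (p, q).
Proof.
move=> uC clC pq; rewrite /winding -big_split /=.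
under eq_big_seq => a aC do rewrite crossed_side ?(allP uC a aC) //.
rewrite big_split /= [X in _ (+) X](_ : _ = false) ?addbF //.
case: (p.2 == q.2); first exact: (clC (left_of (corner p q))).
by rewrite big1.
Qed.

(* Around a lattice site every square is entered as often as it is left. *)
Lemma star_even (phi : site -> bool) p :
  \big[addb/false]_(q <- neighbours p) (phi (side p q) (+) phi (corner p q)) = false.
Proof.
case: p => x y; rewrite /neighbours !big_cons big_nil /side /corner /=.
have -> : (y == y + 1)%R = false by lia.
have -> : (y == y - 1)%R = false by lia.
rewrite eqxx /= !minxx.
have m1 (i : int) : Num.min i (i + 1)%R = i by apply: min_l; rewrite lerDl.
have m2 (i : int) : Num.min i (i - 1)%R = (i - 1)%R by apply: min_r; rewrite lerBlDr lerDl.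
rewrite !m1 !m2 /=.
by case: (phi _); case: (phi _); case: (phi _); case: (phi _).
Qed.

Section Linked.
Variable S : pred site.

(* [p] and [q] are the end points of a lattice chain in [S]. *)
Definition linked p q := exists C : seq (site * site),
  all (fun a => [&& unit_step a.1 a.2, S a.1 & S a.2]) C /\
  forall Q : pred site, \big[addb/false]_(a <- C) (Q a.1 (+) Q a.2) = Q p (+) Q q.

Lemma linked_refl p : linked p p.
Proof. by exists [::]; split=> // Q; rewrite big_nil addbb. Qed.

Lemma linked_sym p q : linked p q -> linked q p.
Proof. by case=> C [CS CQ]; exists C; split=> // Q; rewrite CQ addbC. Qed.

Lemma linked_trans q p r : linked p q -> linked q r -> linked p r.
Proof.
case=> [C [CS CQ]] [D [DS DQ]]; exists (C ++ D); split; first by rewrite all_cat CS.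
by move=> Q; rewrite big_cat /= CQ DQ addbA addbK.
Qed.

Lemma linked_step p q : unit_step p q -> S p -> S q -> linked p q.
Proof.
move=> pq Sp Sq; exists [:: (p, q)]; split; first by rewrite /= pq Sp Sq.
by move=> Q; rewrite big_seq1.
Qed.

End Linked.

(** * The dual of a minor of the grid *)

Section LatticeMinor.
Variables (V E : finType) (s t : E -> V) (B : V -> seq site) (x y : E -> site).
Hypothesis uniqB : forall v, uniq (B v).
Hypothesis disjB : forall v w p, p \in B v -> p \in B w -> v = w.
Hypothesis linkB : forall v p q, p \in B v -> q \in B v -> linked (mem (B v)) p q.
Hypothesis xB : forall e, x e \in B (s e).
Hypothesis yB : forall e, y e \in B (t e).
Hypothesis xy_step : forall e, unit_step (x e) (y e).
Hypothesis st_neq : forall e, s e != t e.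
Hypothesis st_inj : forall e e', [set s e; t e] = [set s e'; t e'] -> e = e'.

Lemma same_seg_inj e e' : same_seg (x e, y e) (x e', y e') -> e = e'.
Proof.
rewrite /same_seg !xpair_eqE /= => /orP[] /andP[/eqP xx /eqP yy]; apply: st_inj.
  have xs : x e \in B (s e') by rewrite xx.
  have yt : y e \in B (t e') by rewrite yy.
  by rewrite (disjB (xB e) xs) (disjB (yB e) yt).
have xt : x e \in B (t e') by rewrite xx.
have ys : y e \in B (s e') by rewrite yy.
by rewrite (disjB (xB e) xt) (disjB (yB e) ys) setUC.
Qed.

(* A closed lattice chain that contracts to the even set [Z]. *)
Lemma lift_chain (Z : {set E}) : even_set s t Z ->
  exists C : seq (site * site), [/\ all (fun a => unit_step a.1 a.2) C, closed_chain C,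
    forall e, \big[addb/false]_(a <- C) same_seg a (x e, y e) = (e \in Z) &
    forall p q, \big[addb/false]_(a <- C) same_seg a (p, q) ->
      (exists v, (p \in B v) && (q \in B v)) \/ exists e, same_seg (x e, y e) (p, q)].
Proof.
move=> evZ.
pose base v := head (0, 0)%R (B v).
have baseB v p : p \in B v -> base v \in B v.
  by rewrite /base; case: (B v) => //= a l _; rewrite mem_head.
have cx e : exists C : seq (site * site),
    all (fun a => [&& unit_step a.1 a.2, a.1 \in B (s e) & a.2 \in B (s e)]) C /\
    forall Q : pred site, \big[addb/false]_(a <- C) (Q a.1 (+) Q a.2) =
      Q (base (s e)) (+) Q (x e).
  exact: (linkB (baseB _ _ (xB e)) (xB e)).
have cy e : exists C : seq (site * site),
    all (fun a => [&& unit_step a.1 a.2, a.1 \in B (t e) & a.2 \in B (t e)]) C /\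
    forall Q : pred site, \big[addb/false]_(a <- C) (Q a.1 (+) Q a.2) =
      Q (base (t e)) (+) Q (y e).
  exact: (linkB (baseB _ _ (yB e)) (yB e)).
case/fin_all_exists: cx => Cx CxP; case/fin_all_exists: cy => Cy CyP.
(* Every edge of [Z] contributes its own segment and chains from the ends of the segment to base
   sites in the two branch sets. The base sites cancel because [Z] is even. *)
pose C := flatten [seq (x e, y e) :: (Cx e ++ Cy e) | e <- enum Z].
have bigC (f : site * site -> bool) : \big[addb/false]_(a <- C) f a =
   \big[addb/false]_(e in Z) (f (x e, y e) (+)
      (\big[addb/false]_(a <- Cx e) f a (+) \big[addb/false]_(a <- Cy e) f a)).
  rewrite big_flatten big_map big_enum; apply: eq_bigr => e _.
  by rewrite big_cons big_cat.
have inner v p q a : same_seg a (p, q) -> a.1 \in B v -> a.2 \in B v ->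
    (p \in B v) && (q \in B v).
  by rewrite /same_seg => /orP[] /eqP-> /= -> ->.
have no_inner e v a : a.1 \in B v -> a.2 \in B v -> same_seg a (x e, y e) = false.
  move=> a1 a2; apply/negP=> H; have /andP[p q] := inner _ _ _ _ H a1 a2.
  by have := st_neq e; rewrite (disjB (xB e) p) (disjB (yB e) q) eqxx.
exists C; split.
- apply/allP=> a /flattenP[_ /mapP[e _ ->]]; rewrite inE mem_cat => /or3P[/eqP->|aC|aC].
  + exact: xy_step.
  + by have /allP/(_ a aC)/and3P[] := (CxP e).1.
  + by have /allP/(_ a aC)/and3P[] := (CyP e).1.
- move=> Q; rewrite bigC.
  under eq_bigr do rewrite (CxP _).2 (CyP _).2 /=.
  have -> : \big[addb/false]_(e in Z) (Q (x e) (+) Q (y e) (+)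
      (Q (base (s e)) (+) Q (x e) (+) (Q (base (t e)) (+) Q (y e)))) =
      \big[addb/false]_(v | Q (base v)) bd s t Z v.
    rewrite /bd exchange_big /=; apply: eq_bigr => e _.
    have pick v : \big[addb/false]_(i | Q (base i)) (v == i) = Q (base v).
      rewrite big_mkcond (bigD1 v) //= eqxx big1 ?addbF => [|i]; first by case: ifP.
      by rewrite eq_sym => /negPf->; case: ifP.
    rewrite big_split /= !pick.
    by case: (Q (x e)); case: (Q (y e)); case: (Q _); case: (Q _).
  by rewrite big1.
- move=> e; rewrite bigC.
  have big0 e' : \big[addb/false]_(a <- Cx e') same_seg a (x e, y e) = false.
    rewrite big_seq big1 // => a /(allP (CxP e').1)/and3P[_ a1 a2]; exact: no_inner a1 a2.
  have big0' e' : \big[addb/false]_(a <- Cy e') same_seg a (x e, y e) = false.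
    rewrite big_seq big1 // => a /(allP (CyP e').1)/and3P[_ a1 a2]; exact: no_inner a1 a2.
  under eq_bigr do rewrite big0 big0' addbF.
  rewrite big_mkcond (bigD1 e) //= big1 => [|e' ee'].
    by case: (e \in Z) => //; rewrite !addbF /same_seg eqxx.
  by case: ifP => // _; rewrite addbF; apply: contraNF ee' => H; rewrite (same_seg_inj H).
move=> p q H.
have [a aC apq] : exists2 a, a \in C & same_seg a (p, q).
  apply/hasP; apply: contraTT H => /hasPn H; rewrite big_seq big1 // => a aC.
  by apply/negbTE; exact: H.
case/flattenP: aC => _ /mapP[e _ ->]; rewrite inE mem_cat => /or3P[/eqP aE|aC|aC].
- by right; exists e; rewrite -aE.
- have /allP/(_ a aC)/and3P[_ a1 a2] := (CxP e).1.
  by left; exists (s e); exact: inner apq a1 a2.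
- have /allP/(_ a aC)/and3P[_ a1 a2] := (CyP e).1.
  by left; exists (t e); exact: inner apq a1 a2.
Qed.

Lemma symmetric_xor (T : eqType) (S : seq T) (f : T -> T -> bool) :
  (forall p q, f p q = f q p) -> (forall p, f p p = false) ->
  \big[addb/false]_(p <- S) \big[addb/false]_(q <- S) f p q = false.
Proof.
move=> fC f0; elim: S => [|a S IHS]; first by rewrite big_nil.
rewrite big_cons big_cons f0 /=.
under [X in _ (+) X]eq_bigr do rewrite big_cons.
rewrite big_split /= IHS addbF.
by under [X in _ (+) X]eq_bigr do rewrite fC; rewrite addbb.
Qed.

(** A square is sent to the set [kappa] of all even sets whose lifted chain winds around it; squares
    with equal values form one face. An even set [Z] is then the cut given by the faces that contain
    it. Conversely [kappa] changes only across lifted chains, so a wall between different faces lies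
    in one branch set or is the segment of an edge, and a parity count around [B v] makes every cut
    even at [v]. *)
Theorem lattice_minor_dual : exists (F : finType) (l r : E -> F), dual_pair setT s t l r.
Proof.
have chain (Z : {set E}) : exists C : seq (site * site), even_set s t Z ->
   [/\ all (fun a => unit_step a.1 a.2) C, closed_chain C,
    forall e, \big[addb/false]_(a <- C) same_seg a (x e, y e) = (e \in Z) &
    forall p q, \big[addb/false]_(a <- C) same_seg a (p, q) ->
      (exists v, (p \in B v) && (q \in B v)) \/ exists e, same_seg (x e, y e) (p, q)].
  have [/forallP ev|nev] := boolP [forall v, ~~ bd s t Z v].
    have [|C CP] := @lift_chain Z; last by exists C.
    by move=> v; apply/negbTE.
  exists [::] => ev; case/negP: nev; apply/forallP=> v; by rewrite ev.
case/fin_all_exists: chain => C CP.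
pose kappa c : {set {set E}} := [set Z | [forall v, ~~ bd s t Z v] && winding (C Z) c].
have evP (Z : {set E}) : even_set s t Z -> [forall v, ~~ bd s t Z v].
  by move=> ev; apply/forallP=> v; rewrite ev.
have evP' (Z : {set E}) : [forall v, ~~ bd s t Z v] -> even_set s t Z.
  by move=> /forallP ev v; apply/negbTE.
exists {set {set E}}, (fun e => kappa (side (x e) (y e))), (fun e => kappa (corner (x e) (y e))).
move=> Z _; split=> [evZ|[Y ->]].
  exists [set X : {set {set E}} | Z \in X]; apply/setP=> e; rewrite !inE (evP _ evZ) /=.
  have [uC cC eC _] := CP Z evZ.
  by rewrite winding_side // eC.
pose phi c := kappa c \in Y.
pose delta p q := phi (side p q) (+) phi (corner p q).
have deltaC p q : delta p q = delta q p by rewrite /delta sideC cornerC.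
have delta0 p q : unit_step p q -> delta p q ->
    (exists v, (p \in B v) && (q \in B v)) \/ exists e, same_seg (x e, y e) (p, q).
  move=> pq dpq; have : kappa (side p q) != kappa (corner p q).
    by apply: contraTneq dpq => E1; rewrite /delta /phi E1 addbb.
  have [/existsP[W ne] _|/existsPn all] := boolP [exists W : {set E},
      (W \in kappa (side p q)) != (W \in kappa (corner p q))]; last first.
    by case/eqP; apply/setP=> W; apply/eqP; have := all W; rewrite negbK.
  move: ne; rewrite !inE; have [ev|//] := boolP [forall v, ~~ bd s t W v].
  have [uC cC _ iC] := CP W (evP' _ ev).
  rewrite /= => ne; apply: iC; rewrite -winding_side //.
  by move: ne; case: (winding _ _); case: (winding _ _).
move=> v.
pose inc e := (s e == v) (+) (t e == v).
have -> : bd s t (cut setT (fun e => kappa (side (x e) (y e)))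
      (fun e => kappa (corner (x e) (y e))) Y) v =
   \big[addb/false]_(e | inc e) delta (x e) (y e).
  rewrite bdE [RHS]big_mkcond; apply: eq_bigr => e _; rewrite !inE /= -/(phi _) -/(delta _ _).
  by rewrite -/(inc e); case: (inc e); rewrite ?andbT ?andbF.
have pick_seq (S : seq site) (a : site) (g : site -> bool) : uniq S -> a \in S ->
    \big[addb/false]_(p <- S) ((a == p) && g p) = g a.
  move=> uS aS; rewrite (bigD1_seq a) //= eqxx /= big1 ?addbF // => p.
  by rewrite eq_sym => /negPf->.
have unb p : uniq (neighbours p).
  by case: p => a b; rewrite /= !inE !xpair_eqE; lia.
(* The changes around one site cancel, and steps within [B v] are counted from both ends. Hence the
   changes across steps leaving [B v] sum to zero, and by [delta0] only the segments of edges at [v]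
   occur among them. *)
have total : \big[addb/false]_(p <- B v) \big[addb/false]_(q <- neighbours p) delta p q = false.
  by rewrite big1 // => p _; exact: star_even.
have inner : \big[addb/false]_(p <- B v)
    \big[addb/false]_(q <- neighbours p | q \in B v) delta p q = false.
  have -> : \big[addb/false]_(p <- B v)
     \big[addb/false]_(q <- neighbours p | q \in B v) delta p q =
     \big[addb/false]_(p <- B v) \big[addb/false]_(q <- B v) (unit_step p q && delta p q).
    apply: eq_bigr => p _; rewrite -big_filter.
    rewrite [RHS](_ : _ = \big[addb/false]_(q <- B v | unit_step p q) delta p q); last first.
      by rewrite [RHS]big_mkcond; apply: eq_bigr => q _; case: (unit_step p q).
    rewrite -[RHS]big_filter; apply: perm_big; apply: uniq_perm; rewrite ?filter_uniq //.
    by move=> q; rewrite !mem_filter andbC.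
  apply: symmetric_xor => [p q|p]; first by rewrite unit_stepC deltaC.
  case: p => a b; rewrite (_ : unit_step _ _ = false) //.
  by rewrite /unit_step !inE !xpair_eqE /=; lia.
(* The segment of [e], directed out of [B v]. *)
pose dart e := if s e == v then (x e, y e) else (y e, x e).
have dartP e : inc e -> [/\ (dart e).1 \in B v, (dart e).2 \notin B v,
    unit_step (dart e).1 (dart e).2 & delta (x e) (y e) = delta (dart e).1 (dart e).2].
  rewrite /inc /dart; case: (s e =P v) => [sv|sv] /=.
    move=> tv; split=> //; first by rewrite -sv xB.
    by apply: contraNN tv => yv; apply/eqP; apply: disjB (yB e) yv.
  move/eqP=> tv; split; rewrite 1?unit_stepC 1?deltaC //; first by rewrite -tv yB.
  by apply/negP => xv; apply: sv; apply: disjB (xB e) xv.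
have outer p q : p \in B v -> q \in neighbours p -> q \notin B v ->
    delta p q = \big[addb/false]_(e | inc e) ((dart e == (p, q)) && delta p q).
  move=> pB pq qB; case dpq: (delta p q); last by rewrite big1 // => e _; rewrite andbF.
  case: (delta0 p q pq dpq) => [[w /andP[pw qw]]|[e he]].
    by move: qB; rewrite (disjB pB pw) qw.
  have [ie de] : inc e /\ dart e = (p, q).
    move: he; rewrite /same_seg /inc /dart => /orP[]/eqP[xe ye]; subst p q.
      have sv := disjB (xB e) pB; rewrite sv eqxx /=; split=> //.
      by apply: contraNN qB => /eqP <-.
    have tv := disjB (yB e) pB; rewrite tv eqxx addbT.
    have ns : s e != v by apply: contraNN qB => /eqP <-.
    by rewrite ns (negPf ns).
  rewrite (bigD1 e) //= de eqxx /= big1 // => e' /andP[ie' ne]; rewrite andbT.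
  apply: contraNF ne => /eqP de'; apply/eqP; apply: same_seg_inj.
  move: de' de; rewrite /dart; case: ifP => _; case: ifP => _ <- [xx yy];
    by rewrite /same_seg ?xx ?yy eqxx ?orbT.
have := total.
have -> : \big[addb/false]_(p <- B v) \big[addb/false]_(q <- neighbours p) delta p q =
   \big[addb/false]_(p <- B v) (\big[addb/false]_(q <- neighbours p | q \in B v) delta p q
     (+) \big[addb/false]_(q <- neighbours p | q \notin B v) delta p q).
  by apply: eq_bigr => p _; rewrite (bigID (mem (B v))).
rewrite big_split /= inner /= => total2; rewrite -[RHS]total2 {total total2}.
have -> : \big[addb/false]_(p <- B v)
     \big[addb/false]_(q <- neighbours p | q \notin B v) delta p q =
   \big[addb/false]_(p <- B v) \big[addb/false]_(q <- neighbours p | q \notin B v)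
     \big[addb/false]_(e | inc e) ((dart e == (p, q)) && delta p q).
  rewrite big_seq [RHS]big_seq; apply: eq_bigr => p pB.
  rewrite big_seq_cond [RHS]big_seq_cond; apply: eq_bigr => q /andP[pq qB].
  exact: outer.
under [RHS]eq_bigr do rewrite exchange_big.
rewrite [RHS]exchange_big; apply: eq_bigr => e /dartP[d1 d2 d3 ->].
transitivity (\big[addb/false]_(p <- B v) (((dart e).1 == p) &&
   \big[addb/false]_(q <- neighbours p) (((dart e).2 == q) && ((q \notin B v) && delta p q)))).
  by rewrite pick_seq // pick_seq // d2.
have dE p q : (dart e == (p, q)) = ((dart e).1 == p) && ((dart e).2 == q).
  by rewrite -xpair_eqE -surjective_pairing.
apply: eq_bigr => p _; case: eqP => /= [dp|dp]; last first.
  by rewrite big1 // => q _; rewrite dE; case: eqP.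
rewrite [RHS]big_mkcond; apply: eq_bigr => q _; rewrite dE dp eqxx /=.
by case: (q \in B v); case: (_ == q).
Qed.

End LatticeMinor.

(** * Odd cycles in even sets of odd size *)

Section OddCycles.
Variables (V E : finType) (s t : E -> V).
Hypothesis st_neq : forall e, s e != t e.
Hypothesis st_inj : forall e e', [set s e; t e] = [set s e'; t e'] -> e = e'.

Section Extract.
Variables (Z : {set E}) (e0 : E).
Hypothesis evZ : even_set s t Z.
Hypothesis e0Z : e0 \in Z.

Let z := joined Z s t.

Definition edge_of x y := odflt e0 [pick e in Z |
  ((s e == x) && (t e == y)) || ((s e == y) && (t e == x))].

Lemma edge_ofP x y : z x y -> edge_of x y \in Z /\
  ((s (edge_of x y), t (edge_of x y)) = (x, y) \/ (s (edge_of x y), t (edge_of x y)) = (y, x)).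
Proof.
move=> /exists_inP[e eZ H]; rewrite /edge_of; case: pickP => [e' /andP[e'Z] | /(_ e)]; last first.
  by rewrite eZ H.
by case/orP=> /andP[/eqP-> /eqP->]; split; auto.
Qed.

Lemma edge_of_bd x y v : z x y ->
  (s (edge_of x y) == v) (+) (t (edge_of x y) == v) = (x == v) (+) (y == v).
Proof. by case/edge_ofP=> _ [] [-> ->] //; rewrite addbC. Qed.

Lemma edge_of_end x y v : z x y ->
  (v \in [set s (edge_of x y); t (edge_of x y)]) = (v == x) || (v == y).
Proof. by case/edge_ofP=> _ [] [-> ->]; rewrite !inE // orbC. Qed.

Lemma joined_neq x y : z x y -> x != y.
Proof.
move=> /edge_ofP[_ H]; apply/eqP=> E1; have := st_neq (edge_of x y).
by case: H => -[-> ->]; rewrite E1 eqxx.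
Qed.

Lemma path_edges_bd x p v : path z x p ->
  \big[addb/false]_(e <- pairmap edge_of x p) ((s e == v) (+) (t e == v)) =
  (x == v) (+) (last x p == v).
Proof.
elim: p x => [|y p IHp] x /=; first by rewrite big_nil addbb.
by case/andP=> xy yp; rewrite big_cons edge_of_bd // IHp // addbA addbK.
Qed.

Lemma path_edges_end x p v : path z x p -> v \notin x :: p ->
  forall e, e \in pairmap edge_of x p -> v \notin [set s e; t e].
Proof.
elim: p x => [|y p IHp] x //= /andP[xy yp]; rewrite inE negb_or => /andP[vx vyp] e.
rewrite inE => /orP[/eqP->|]; last exact: IHp.
by rewrite edge_of_end // negb_or vx; move: vyp; rewrite inE negb_or => /andP[].
Qed.

Lemma path_edges_uniq x p : path z x p -> uniq (x :: p) -> uniq (pairmap edge_of x p).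
Proof.
elim: p x => [|y p IHp] x //= /andP[xy yp] /andP[xyp up].
rewrite IHp // andbT; apply/negP=> /(path_edges_end yp xyp).
by rewrite edge_of_end // eqxx.
Qed.

Lemma path_edges_sub x p e : path z x p -> e \in pairmap edge_of x p -> e \in Z.
Proof.
elim: p x => [|y p IHp] x //= /andP[xy yp]; rewrite inE => /orP[/eqP->|]; last exact: IHp.
by have [] := edge_ofP xy.
Qed.

Lemma second_neighbour x y : z x y -> exists2 w, z x w & w != y.
Proof.
move=> xy; have [eZ _] := edge_ofP xy; set e := edge_of x y in eZ.
have ex : x \in [set s e; t e] by rewrite edge_of_end ?eqxx.
have [/existsP[e' /and3P[e'Z ee' xe']]|/existsPn no] :=
    boolP [exists e', [&& e' \in Z, e' != e & x \in [set s e'; t e']]].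
  have seE : [set s e; t e] = [set x; y].
    by case: (edge_ofP xy).2 => -[-> ->] //; rewrite setUC.
  case/set2P: xe' => xE; [exists (t e')|exists (s e')].
  - by apply/exists_inP; exists e'; rewrite // xE !eqxx.
  - by apply: contraNneq ee' => wy; apply/eqP/st_inj; rewrite seE wy xE.
  - by apply/exists_inP; exists e'; rewrite // xE !eqxx orbT.
  - by apply: contraNneq ee' => wy; apply/eqP/st_inj; rewrite seE wy xE setUC.
have := evZ x; rewrite /bd (bigD1 e) //= big1 => [|e' /andP[e'Z ee']].
  by rewrite addbF edge_of_bd // eqxx /= eq_sym (negPf (joined_neq xy)).
by have := no e'; rewrite e'Z ee' !inE negb_or ![x == _]eq_sym => /andP[/negPf-> /negPf->].
Qed.

(** All neighbours of the first vertex [x] of a longest path lie on the path. Evenness gives [x] a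
    second neighbour [w] besides the next vertex of the path, and the stretch from [x] to [w] closes
    up to a cycle. *)
Lemma cycle_in_even : exists c, [/\ 2 < size c, ucycle z c &
  exists C : {set E}, [/\ C \subset Z, #|C| = size c & even_set s t C]].
Proof.
pose P n := [exists x, [exists p : n.-tuple V, uniq (x :: p) && path z x p]].
have exP : exists n, P n.
  exists 0; apply/existsP; exists (s e0); apply/existsP; by exists [tuple].
have ubP n : P n -> n <= #|V|.
  case/existsP=> x /existsP[p /andP[/card_uniqP up _]].
  by have := max_card (mem (x :: p)); rewrite up /= size_tuple => /ltnW.
case: (ex_maxnP exP ubP) => n /existsP[x /existsP[p /andP[up pp]]] maxn.
have ext w : z x w -> w \in p.
  move=> xw; apply/negPn/negP=> wp.
  have xw' : w != x by rewrite eq_sym joined_neq.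
  have : P n.+1.
    apply/existsP; exists w; apply/existsP; exists (cons_tuple x p).
    rewrite /= inE negb_or xw' wp; move: up => /= ->; rewrite pp andbT /=.
    by rewrite /z joinedC.
  by move/maxn; rewrite ltnn.
have [y [p' [pE xy]]] : exists y p', p = y :: p' :> seq V /\ z x y.
  case pE: (tval p) pp => [|y p'] /=; last by case/andP=> xy _; exists y, p'.
  move=> _; have n0 : n = 0 by rewrite -(size_tuple p) pE.
  have : P 1.
    apply/existsP; exists (s e0); apply/existsP; exists [tuple t e0].
    rewrite /= !inE st_neq /= !andbT.
    by apply/exists_inP; exists e0; rewrite ?eqxx.
  by move/maxn; rewrite n0.
have [w xw wy] := second_neighbour xy.
have wp : w \in tval p := ext w xw.
have wp' : w \in p' by move: wp; rewrite pE inE (negPf wy).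
move: up pp; rewrite pE; case/splitPr: wp' => p1 p2 up pp.
pose q := y :: rcons p1 w.
have uq : uniq (x :: q).
  move: up; rewrite -cat_rcons -[x :: y :: _]/((x :: q) ++ p2) cat_uniq.
  by case/andP.
have pq : path z x q by move: pp; rewrite /q -cat_rcons /= cat_path => /and3P[-> ->].
have wx : z w x by rewrite /z joinedC.
have lq : last x q = w by rewrite /= last_rcons.
exists (x :: q); split; first by rewrite /= size_rcons.
  by rewrite /ucycle uq andbT /cycle rcons_path pq lq.
pose L := edge_of w x :: pairmap edge_of x q.
have uL : uniq L.
  rewrite /L cons_uniq path_edges_uniq // andbT /q /= inE negb_or; apply/andP; split.
    apply: contraNneq wy => E1; have := edge_of_end w wx; rewrite E1 edge_of_end // eqxx /=.
    case: (eqVneq w x) => [wx'|_] /=; last by move=> ->.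
    by move: uq; rewrite /= -wx' !inE mem_rcons inE eqxx !orbT.
  move: pq uq => /andP[_ yq] /andP[xq _].
  apply/negP=> /(path_edges_end yq xq).
  by rewrite edge_of_end // eqxx orbT.
exists [set e in L]; split.
- apply/subsetP=> e; rewrite inE /L inE => /orP[/eqP->|]; last exact: path_edges_sub.
  by have [] := edge_ofP wx.
- by rewrite cardsE (card_uniqP uL) /= size_pairmap.
move=> v; rewrite /bd.
have -> : \big[addb/false]_(e in [set e in L]) ((s e == v) (+) (t e == v)) =
    \big[addb/false]_(e <- L) ((s e == v) (+) (t e == v)).
  by rewrite big_uniq //=; apply: eq_bigl => e; rewrite inE.
rewrite big_cons edge_of_bd // path_edges_bd // lq.
by case: (w == v); case: (x == v).
Qed.

End Extract.

(** The set contains a cycle. An odd cycle has more than 9 edges, hence more than 10; removing an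
    even cycle leaves a smaller even set of odd size. *)
Lemma odd_large_cycles :
  (forall c, 2 < size c -> ucycle (joined setT s t) c -> odd (size c) -> 9 < size c) ->
  odd_large setT s t.
Proof.
move=> cyc Z _; elim: {Z}#|Z| {-2}Z (leqnn #|Z|) => [|n IHn] Z.
  by rewrite leqn0 => /eqP->.
move=> Zn evZ oZ.
have /card_gt0P[e0 e0Z] : 0 < #|Z| by case: #|Z| oZ.
have [c [c2 uc [C [CZ cC evC]]]] := cycle_in_even evZ e0Z.
have uc' : ucycle (joined setT s t) c.
  move: uc; rewrite /ucycle => /andP[cy ->]; rewrite andbT.
  apply: sub_cycle cy => x y /exists_inP[e _ H]; apply/exists_inP; exists e => //.
have [oc|oc] := boolP (odd (size c)).
  have c9 := cyc c c2 uc' oc; apply: leq_trans (subset_leq_card CZ); rewrite cC.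
  by move: c9 oc; rewrite leq_eqVlt => /orP[/eqP<-|].
have := card_symd Z C; rewrite (setIidPr CZ) cC => cS.
have oS := odd_symd Z C; rewrite oZ cC (negPf oc) /= in oS.
apply: (@leq_trans #|symd Z C|).
  apply: IHn => //; last exact: even_symd.
  by move: cS c2 Zn; clear; move: #|_| #|_| (size c); lia.
by move: cS c2; clear; move: #|_| #|_| (size c); lia.
Qed.

End OddCycles.

(** * From lattice walks to branch sets *)

Definition lazy_step (p q : site) := (p == q) || unit_step p q.

Section Walks.
Variables (P Q : pred site).
Hypothesis PQ : forall p, P p -> Q p -> False.

(** The scan stops at the first site in [Q] and starts anew at each site in [P] before it; [mid]
    collects the sites since the last restart. *)
Lemma last_exit_from a mid l : path lazy_step a (mid ++ l) -> P a ->
  all (fun p => ~~ (P p || Q p)) mid -> Q (last a (mid ++ l)) ->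
  exists a' mid' b, [/\ P a', Q b, all (fun p => ~~ (P p || Q p)) mid',
    path lazy_step a' (rcons mid' b) & {subset a' :: mid' <= a :: mid ++ l}].
Proof.
elim: l a mid => [|y l IHl] a mid.
  rewrite cats0 => _ Pa amid Qe; case/lastP: mid amid Qe => [|mid z] amid /=.
    by move/(PQ Pa).
  rewrite last_rcons => Qz; move: amid; rewrite all_rcons /= Qz.
  by rewrite orbT.
move=> pp Pa amid Ql.
have [Qy|nQy] := boolP (Q y).
  exists a, mid, y; split=> //.
    by move: pp; rewrite -cat_rcons cat_path => /andP[].
  by move=> z; rewrite !inE mem_cat => /orP[->//|->]; rewrite orbT.
have [Py|nPy] := boolP (P y).
  have [|//|//||a' [mid' [b [Pa' Qb am pb sub]]]] := IHl y [::].
  - by move: pp; rewrite cat_path /= => /and3P[].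
  - by move: Ql; rewrite last_cat.
  exists a', mid', b; split=> // z /sub /= zl.
  by rewrite inE mem_cat zl !orbT.
have [||||a' [mid' [b [Pa' Qb am pb sub]]]] := IHl a (rcons mid y).
- by rewrite cat_rcons.
- by [].
- by rewrite all_rcons amid /= negb_or nPy nQy.
- by rewrite cat_rcons.
by exists a', mid', b; split=> // z /sub; rewrite cat_rcons.
Qed.

Lemma last_exit a l : path lazy_step a l -> P a -> Q (last a l) ->
  exists a' mid b, [/\ P a', Q b, all (fun p => ~~ (P p || Q p)) mid,
    path lazy_step a' (rcons mid b) & {subset a' :: mid <= a :: l}].
Proof. by move=> pl Pa Ql; apply: (@last_exit_from a [::] l). Qed.

End Walks.

Lemma linked_sub (S S' : pred site) p q : {subset S <= S'} -> linked S p q -> linked S' p q.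
Proof.
move=> sub [C [CS CQ]]; exists C; split=> //; apply: sub_all CS => a /and3P[-> a1 a2].
by rewrite (sub _ a1 : S' _) (sub _ a2 : S' _).
Qed.

Lemma path_linked (S : pred site) a l p : path lazy_step a l -> S a -> all S l ->
  p \in a :: l -> linked S p (last a l).
Proof.
elim: l a p => [|b l IHl] a p /=; first by rewrite inE => _ _ _ /eqP->; exact: linked_refl.
case/andP=> ab bl Sa /andP[Sb Sl].
have ln : linked S a (last b l).
  case/orP: ab => [/eqP->|ab]; first by apply: IHl; rewrite ?mem_head.
  apply: linked_trans (linked_step ab Sa Sb) _; apply: IHl => //; exact: mem_head.
by rewrite inE => /orP[/eqP->//|pl]; apply: IHl.
Qed.

Section Block.
Variables (c : site) (m : nat).

Definition block (p : site) : bool := (`|p.1 - c.1| <= m)%N && (`|p.2 - c.2| <= m)%N.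

Definition block_list : seq site :=
  [seq (c.1 - m%:Z + i%:Z, c.2 - m%:Z + j%:Z)%R | i <- iota 0 (m.*2.+1), j <- iota 0 (m.*2.+1)].

Lemma mem_block_list p : (p \in block_list) = block p.
Proof.
have [n En] : exists n, n = m.*2.+1 by exists m.*2.+1.
rewrite /block_list -En.
apply/allpairsP/idP => [[[i j]] /= [] |]; rewrite /block.
  by rewrite !mem_iota => iI jJ -> /=; lia.
case: p => [a b] /= H.
exists (`|(a - c.1 + m%:Z)%R|%N, `|(b - c.2 + m%:Z)%R|%N); rewrite !mem_iota /=; split; try lia.
by congr pair; lia.
Qed.

Lemma block_linked p : block p -> linked block p c.
Proof.
have row n : forall a b, `|a - c.1|%N = n -> block (a, b) -> linked block (a, b) (c.1, b).
  elim: n => [|n IHn] a b an Bab.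
    have -> : a = c.1 by lia.
    exact: linked_refl.
  have [a' [an' st]] : exists a', `|a' - c.1|%N = n /\ unit_step (a, b) (a', b).
    have [lt|lt] : (a < c.1)%R \/ (c.1 < a)%R by lia.
      by exists (a + 1)%R; split; [lia | rewrite /unit_step !inE /= eqxx].
    by exists (a - 1)%R; split; [lia | rewrite /unit_step !inE /= eqxx !orbT].
  have Ba' : block (a', b) by move: Bab; rewrite /block /=; lia.
  exact: linked_trans (linked_step st Bab Ba') (IHn _ _ an' Ba').
have column n : forall b, `|b - c.2|%N = n -> block (c.1, b) -> linked block (c.1, b) c.
  elim: n => [|n IHn] b bn Bb.
    have -> : (c.1, b) = c by rewrite [RHS]surjective_pairing; congr pair; lia.
    exact: linked_refl.
  have [b' [bn' st]] : exists b', `|b' - c.2|%N = n /\ unit_step (c.1, b) (c.1, b').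
    have [lt|lt] : (b < c.2)%R \/ (c.2 < b)%R by lia.
      by exists (b + 1)%R; split; [lia | rewrite /unit_step !inE /= eqxx !orbT].
    by exists (b - 1)%R; split; [lia | rewrite /unit_step !inE /= eqxx !orbT].
  have Bb' : block (c.1, b') by move: Bb; rewrite /block /=; lia.
  exact: linked_trans (linked_step st Bb Bb') (IHn _ bn' Bb').
case: p => a b Bp; apply: linked_trans (row _ a b erefl Bp) (column _ b erefl _).
by move: Bp; rewrite /block /=; lia.
Qed.

End Block.

Section LatticeDrawing.
Variables (V E : finType) (s t : E -> V) (c : V -> site) (m : nat) (w : E -> seq site).
Hypothesis blocks_disj : forall u v p, block (c u) m p -> block (c v) m p -> u = v.
Hypothesis walk_path : forall e, path lazy_step (c (s e)) (w e).
Hypothesis walk_last : forall e, last (c (s e)) (w e) = c (t e).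
Hypothesis walk_block : forall e p v, p \in c (s e) :: w e -> block (c v) m p ->
  v = s e \/ v = t e.
Hypothesis walks_disj : forall e e' p, p \in c (s e) :: w e -> p \in c (s e') :: w e' ->
  (forall v, ~~ block (c v) m p) -> e = e'.
Hypothesis st_neq : forall e, s e != t e.
Hypothesis st_inj : forall e e', [set s e; t e] = [set s e'; t e'] -> e = e'.

(** The branch set of [v] is its block together with the middle parts of the walks that end in [v].
    Each walk is thus absorbed by its target, except for its step out of the block of the source,
    which represents the edge. *)
Lemma lattice_drawing_dual : exists (F : finType) (l r : E -> F), dual_pair setT s t l r.
Proof.
have center v : block (c v) m (c v) by rewrite /block !subrr.
have exits e : exists abm : site * seq site * site,
    [/\ block (c (s e)) m abm.1.1, block (c (t e)) m abm.2,
     all (fun p => ~~ (block (c (s e)) m p || block (c (t e)) m p)) abm.1.2,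
     path lazy_step abm.1.1 (rcons abm.1.2 abm.2) &
     {subset abm.1.1 :: abm.1.2 <= c (s e) :: w e}].
  have PQ p : block (c (s e)) m p -> block (c (t e)) m p -> False.
    by move=> ps pt; have := st_neq e; rewrite (blocks_disj ps pt) eqxx.
  have [||a [mid [b H]]] := last_exit PQ (walk_path e).
  - exact: center.
  - by rewrite walk_last center.
  by exists (a, mid, b).
case/fin_all_exists: exits => X XP.
pose mid e := (X e).1.2; pose y e := head (X e).2 (mid e).
pose B v := undup (block_list (c v) m ++ flatten [seq mid e | e <- enum E & t e == v]).
have memB v p : (p \in B v) = block (c v) m p || [exists e, (t e == v) && (p \in mid e)].
  rewrite mem_undup mem_cat mem_block_list; congr orb.
  apply/flattenP/existsP => [[l /mapP[e eE ->] pm]|[e /andP[te pm]]].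
    by move: eE; rewrite mem_filter => /andP[te _]; exists e; rewrite te.
  by exists (mid e) => //; apply: map_f; rewrite mem_filter te mem_enum.
have mid_out e p v : p \in mid e -> ~~ block (c v) m p.
  move=> pm; have [_ _ am _ sub] := XP e; apply/negP=> bp.
  have pw : p \in c (s e) :: w e by apply: sub; rewrite inE pm orbT.
  have /= := allP am p pm; rewrite negb_or.
  by case: (walk_block pw bp) => <-; rewrite bp ?andbF.
have mid_walk e p : p \in mid e -> p \in c (s e) :: w e.
  by move=> pm; have [_ _ _ _ sub] := XP e; apply: sub; rewrite inE pm orbT.
apply: (@lattice_minor_dual V E s t B (fun e => (X e).1.1) y).
- by move=> v; exact: undup_uniq.
- move=> u v p; rewrite !memB.
  case/orP=> [bu|/existsP[e /andP[/eqP<- pm]]]; case/orP=> [bv|/existsP[e' /andP[/eqP<- pm']]].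
  + exact: blocks_disj bu bv.
  + by have := mid_out e' p u pm'; rewrite bu.
  + by have := mid_out e p v pm; rewrite bv.
  + congr t; apply: walks_disj (mid_walk _ _ pm) (mid_walk _ _ pm') _ => v'.
    exact: mid_out pm.
- have to_center v p : p \in B v -> linked (mem (B v)) p (c v).
    rewrite memB.
    have blk q : block (c v) m q -> linked (mem (B v)) q (c v).
      move=> bq; apply: linked_sub (block_linked bq) => z bz.
      by rewrite -topredE /= memB (bz : block _ _ _).
    case/orP=> [|/existsP[e /andP[/eqP te pm]]]; first exact: blk.
    have [_ bt am pp _] := XP e.
    rewrite -/(mid e) in pp; case me: (mid e) pm pp => [|a l] // pm pp.
    have := @path_linked (mem (B v)) a (rcons l (X e).2) p.
    rewrite last_rcons => H; apply: linked_trans (H _ _ _ _) (blk _ _).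
    + by move: pp => /= /andP[].
    + by rewrite /= memB; apply/orP; right; apply/existsP; exists e; rewrite te eqxx me mem_head.
    + rewrite all_rcons /= memB -te bt /=; apply/allP=> z zl /=.
      rewrite memB; apply/orP; right; apply/existsP; exists e.
      by rewrite eqxx me inE zl orbT.
    + by rewrite -rcons_cons mem_rcons inE pm orbT.
    + by rewrite -te.
  move=> v p q pB qB; apply: linked_trans (to_center v p pB) (linked_sym (to_center v q qB)).
- by move=> e; rewrite memB; have [-> _ _ _ _] := XP e.
- move=> e; rewrite memB /y; have [_ bt _ _ _] := XP e.
  case me: (mid e) => [|a l] /=; first by rewrite bt.
  by apply/orP; right; apply/existsP; exists e; rewrite eqxx -/(mid e) me mem_head.
- move=> e; have [bs bt am pp _] := XP e.
  have nb : ~~ block (c (s e)) m (y e).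
    rewrite /y; case me: (mid e) => [|a l] /=; last by apply: (mid_out e); rewrite me mem_head.
    apply/negP=> bs'; have := st_neq e; by rewrite (blocks_disj bs' bt) eqxx.
  have : lazy_step (X e).1.1 (y e).
    by move: pp; rewrite -/(mid e) /y; case: (mid e) => [|a l] /= /andP[].
  by case/orP=> // /eqP E1; rewrite -E1 bs in nb.
- exact: st_neq.
- exact: st_inj.
Qed.

End LatticeDrawing.

From mathcomp Require Import all_classical all_reals all_analysis.
Import numFieldNormedType.Exports.
Local Open Scope classical_set_scope.
Local Open Scope ring_scope.

(** * Planar drawings *)

Section Curves.
Variable R : realType.
Implicit Types (f g : R -> R * R) (a b : R * R).

Definition dist a b : R := Num.max `|a.1 - b.1| `|a.2 - b.2|.

Lemma distC a b : dist a b = dist b a.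
Proof. by rewrite /dist distrC [`|a.2 - _|]distrC. Qed.

Lemma dist_triangle b a c : dist a c <= dist a b + dist b c.
Proof.
have := ler_distD b.1 a.1 c.1; have := ler_distD b.2 a.2 c.2.
rewrite /dist; move: (`|_|) (`|_|) (`|_|) (`|_|) (`|_|) (`|_|) => *.
by rewrite !maxEle; do ! case: ifP => ?; lra.
Qed.

Lemma dist_gt0 a b : (0 < dist a b) = (a != b).
Proof.
by rewrite /dist lt_max !normr_gt0 !subr_eq0 [a == b]/eq_op /= negb_and.
Qed.

Lemma near_curve f (x eps : R) : {within `[0, 1], continuous f} ->
  x \in `[0, 1] -> 0 < eps ->
  \forall y \near x, y \in `[0, 1] -> dist (f x) (f y) < eps.
Proof.
move=> /subspace_continuousP cf xI eps0.
have /cvgrPdist_lt/(_ _ eps0) := cf x xI.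
rewrite near_withinE; apply: filterS => y H yI.
by have := H yI; rewrite prod_normE.
Qed.

Lemma near0_witness (P : R -> Prop) : (\forall d \near 0^'+, P d) -> exists2 d : R, 0 < d & P d.
Proof.
move=> HP; have [d [d0 Pd]] := filter_ex (filterI (nbhs_right_gt (0 : R)) HP).
by exists d.
Qed.

(** Compactness of the interval: smallness conditions on [d] that hold locally hold for one range of
    [d] on the whole interval. *)
Lemma segment_near (P : R -> R -> Prop) :
  (forall x : R, x \in `[0, 1] -> \forall y \near x & d \near 0^'+, P d y) ->
  \forall d \near 0^'+, forall x : R, x \in `[0, 1] -> P d x.
Proof.
move=> H; have /compact_near_coveringP cov := @segment_compact R 0 1.
have {}H : \forall d \near 0^'+, `[0, 1] `<=` P d by apply: cov.
by apply: filterS H => d H x; apply: H.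
Qed.

Lemma curve_avoids f b : {within `[0, 1], continuous f} ->
  (forall x : R, x \in `[0, 1] -> f x != b) ->
  \forall d \near 0^'+, forall x : R, x \in `[0, 1] -> d < dist (f x) b.
Proof.
move=> cf fb; suff : \forall d \near 0^'+, forall x : R, x \in `[0, 1] ->
    x \in `[0, 1] -> d < dist (f x) b.
  by apply: filterS => d H x xI; apply: H.
apply: segment_near => x xI.
have d0 : 0 < dist (f x) b / 2 by rewrite divr_gt0 // dist_gt0 fb.
near=> y d => /=.
have : y \in `[0, 1] -> dist (f x) (f y) < dist (f x) b / 2.
  by near: y; apply: near_curve.
move=> /[swap] yI /(_ yI) fxy.
have dd : d < dist (f x) b / 2 by near: d; apply: nbhs_right_lt.
have := dist_triangle (f y) (f x) b; lra.
Unshelve. all: by end_near. Qed.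

Lemma curve_uniform f (eps : R) : {within `[0, 1], continuous f} -> 0 < eps ->
  \forall d \near 0^'+, forall x y : R, x \in `[0, 1] -> y \in `[0, 1] ->
    `|x - y| < d -> dist (f x) (f y) < eps.
Proof.
move=> cf eps0; suff : \forall d \near 0^'+, forall x : R, x \in `[0, 1] ->
    x \in `[0, 1] -> forall y : R, y \in `[0, 1] -> `|x - y| < d -> dist (f x) (f y) < eps.
  by apply: filterS => d H x y xI yI; apply: H.
apply: segment_near => x xI.
have eps20 : 0 < eps / 2 by rewrite divr_gt0.
have /nbhs_ballP[r /= r0 Hr] := near_curve cf xI eps20.
have r20 : 0 < r / 2 by rewrite divr_gt0.
near=> y d => /=.
have xy : `|x - y| < r / 2 by near: y; apply/nbhs_ballP; exists (r / 2).
move=> yI z zI yz.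
have dd : d < r / 2 by near: d; apply: nbhs_right_lt.
have f1 : dist (f x) (f y) < eps / 2 by apply: Hr => //; rewrite /ball /=; lra.
have f2 : dist (f x) (f z) < eps / 2.
  apply: Hr => //; rewrite /ball /=.
  have := ler_distD y x z; lra.
have := dist_triangle (f x) (f y) (f z); rewrite [dist (f y) (f x)]distC; lra.
Unshelve. all: by end_near. Qed.

(** The curves can come together only at drawn vertices, and near these the condition on [r] fails.
    At any other point the second curve keeps a positive distance, and compactness makes it
    uniform. *)
Lemma curves_apart (W : finType) (pt : W -> R * R) f g (r : R) :
  {within `[0, 1], continuous f} -> {within `[0, 1], continuous g} -> 0 < r ->
  (forall x y : R, x \in `[0, 1] -> y \in `[0, 1] -> f x = g y -> exists v, f x = pt v) ->
  \forall d \near 0^'+, forall x y : R, x \in `[0, 1] -> y \in `[0, 1] ->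
    (forall v, r <= dist (f x) (pt v)) -> d < dist (f x) (g y).
Proof.
move=> cf cg r0 fg; suff : \forall d \near 0^'+, forall x : R, x \in `[0, 1] ->
    x \in `[0, 1] -> forall y : R, y \in `[0, 1] ->
    (forall v, r <= dist (f x) (pt v)) -> d < dist (f x) (g y).
  by apply: filterS => d H x y xI yI; apply: H.
apply: segment_near => x xI.
have [[v fv]|nv] := pselect (exists v, f x = pt v).
  near=> y d => /=.
  have fxy : y \in `[0, 1] -> dist (f x) (f y) < r by near: y; apply: near_curve.
  by move=> yI z zI /(_ v); rewrite leNgt -fv distC fxy.
have gx y : y \in `[0, 1] -> g y != f x.
  by move=> yI; apply/eqP => gy; apply: nv; apply: (fg x y).
have [e e0 He] := near0_witness (curve_avoids cg gx).
have e20 : 0 < e / 2 by rewrite divr_gt0.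
near=> y d => /=.
have : y \in `[0, 1] -> dist (f x) (f y) < e / 2 by near: y; apply: near_curve.
move=> /[swap] yI /(_ yI) fxy z zI _.
have dd : d < e / 2 by near: d; apply: nbhs_right_lt.
have := He z zI; have := dist_triangle (f y) (g z) (f x).
rewrite [dist (f y) (f x)]distC [dist (g z) (f y)]distC; lra.
Unshelve. all: by end_near. Qed.


(** * Rounding curves to a fine grid *)

Section Grid.
Variable h : R.
Hypothesis h_gt0 : 0 < h.

Definition grid_floor a : site := (Num.floor (a.1 / h), Num.floor (a.2 / h)).
Definition grid_point (p : site) : R * R := (p.1%:~R * h, p.2%:~R * h).

Lemma floor_scaled (x : R) : (Num.floor (x / h))%:~R * h <= x < (Num.floor (x / h))%:~R * h + h.
Proof.
rewrite -ler_pdivlMr // floor_le_tmp /= -ltrBlDr -[X in _ - X]mul1r.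
have := lt_succ_floor (x / h); rewrite -(ltr_pM2r h_gt0) divfK ?gt_eqF // intrD mulrDl.
by rewrite ltrBlDr.
Qed.

Lemma floor_scaled_near (x y : R) : `|x - y| < h ->
  (`|Num.floor (y / h) - Num.floor (x / h)| <= 1)%N.
Proof.
have := floor_scaled x; have := floor_scaled y.
set i := Num.floor _; set j := Num.floor _.
move=> /andP[y1 y2] /andP[x1 x2]; rewrite ltr_norml => /andP[xy1 xy2].
have ij : i%:~R * h < (j + 2)%:~R * h by rewrite intrD mulrDl; lra.
have ji : j%:~R * h < (i + 2)%:~R * h by rewrite intrD mulrDl; lra.
by move: ij ji; rewrite !ltr_pM2r // !ltr_int => *; lia.
Qed.

Lemma grid_floor_dist a : dist (grid_point (grid_floor a)) a <= h.
Proof.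
rewrite /dist ge_max /= ![`|_| <= _]ler_norml.
have /andP[] := floor_scaled a.1; have /andP[] := floor_scaled a.2.
by move=> *; apply/andP; split; apply/andP; split; lra.
Qed.

Lemma block_dist a m p : block (grid_floor a) m p ->
  dist (grid_point p) a <= m%:R * h + h.
Proof.
have D i j : (`|i - j| <= m)%N -> `|i%:~R * h - j%:~R * h| <= m%:R * h.
  by rewrite -mulrBl normrM (gtr0_norm h_gt0) -intrB -intr_norm ler_pM2r // => ij; rewrite -[m%:R]/(m%:~R) ler_int; lia.
case/andP=> /D p1 /D p2; have := grid_floor_dist a.
have := dist_triangle (grid_point (grid_floor a)) (grid_point p) a.
suff : dist (grid_point p) (grid_point (grid_floor a)) <= m%:R * h by lra.
by rewrite /dist ge_max p1.
Qed.

Lemma dist_notin_block a m p : ~~ block (grid_floor a) m p ->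
  m%:R * h <= dist (grid_point p) a.
Proof.
have D i j : (m < `|i - j|)%N -> m%:R * h + h <= `|i%:~R * h - j%:~R * h|.
  rewrite -mulrBl normrM (gtr0_norm h_gt0) -intrB -intr_norm => ij.
  rewrite -[X in _ + X]mul1r -mulrDl ler_pM2r // natr1 -[_%:R]/(m.+1%:~R) ler_int; lia.
rewrite negb_and -!ltnNge => H; have := grid_floor_dist a.
have := dist_triangle a (grid_point p) (grid_point (grid_floor a)).
suff : m%:R * h + h <= dist (grid_point p) (grid_point (grid_floor a)).
  by rewrite (distC a); lra.
by rewrite /dist le_max; case/orP: H => /D -> //; rewrite orbT.
Qed.

Lemma lazy_step_fst i j k : (`|j - i| <= 1)%N -> lazy_step (i, k) (j, k).
Proof.
by rewrite /lazy_step /unit_step /neighbours !inE !xpair_eqE !eqxx /= => ?; lia.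
Qed.

Lemma lazy_step_snd i j k : (`|j - i| <= 1)%N -> lazy_step (k, i) (k, j).
Proof.
by rewrite /lazy_step /unit_step /neighbours !inE !xpair_eqE !eqxx /= => ?; lia.
Qed.

(** Consecutive samples are closer than the mesh [h], so each coordinate of the rounded site changes
    by at most one. A diagonal move is split at the intermediate site [q]; a coordinate that does
    not change is the reason for lazy steps. *)
Lemma grid_walk (a : nat -> R * R) n :
  (forall i, (i < n)%N -> dist (a i) (a i.+1) < h) ->
  exists l, [/\ path lazy_step (grid_floor (a 0%N)) l,
    last (grid_floor (a 0%N)) l = grid_floor (a n) &
    forall p, p \in grid_floor (a 0%N) :: l ->
      exists2 i, (i <= n)%N & dist (grid_point p) (a i) <= 2 * h].
Proof.
elim: n => [|n IHn] ha.
  exists [::]; split=> // p; rewrite inE => /eqP->; exists 0%N => //.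
  by have := grid_floor_dist (a 0%N); have := h_gt0; lra.
have [|l [pl ll nl]] := IHn; first by move=> i iin; apply: ha; apply: ltnW.
have := ha n (ltnSn n); rewrite /dist gt_max => /andP[d1 d2].
pose q : site := ((grid_floor (a n.+1)).1, (grid_floor (a n)).2).
exists (l ++ [:: q; grid_floor (a n.+1)]); split.
- rewrite cat_path pl ll /= andbT; apply/andP; split.
    by apply: lazy_step_fst; apply: floor_scaled_near.
  by apply: lazy_step_snd; apply: floor_scaled_near.
- by rewrite last_cat.
move=> p; rewrite -cat_cons mem_cat => /orP[/nl[i iin di]|].
  by exists i => //; apply: leqW.
rewrite !inE => /orP[/eqP->|/eqP->]; last first.
  by exists n.+1 => //; apply: le_trans (grid_floor_dist _) _; have := h_gt0; lra.
exists n => //; rewrite /dist ge_max /= !ler_norml.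
have := h_gt0; have /andP[] := floor_scaled (a n.+1).1; have /andP[] := floor_scaled (a n).2.
move: d1; rewrite ltr_norml => /andP[d3 d4].
by move=> *; apply/andP; split; apply/andP; split; lra.
Qed.

Lemma curve_walk f (d : R) : 0 < d ->
  (forall x y : R, x \in `[0, 1] -> y \in `[0, 1] -> `|x - y| < d -> dist (f x) (f y) < h) ->
  exists l, [/\ path lazy_step (grid_floor (f 0)) l,
    last (grid_floor (f 0)) l = grid_floor (f 1) &
    forall p, p \in grid_floor (f 0) :: l ->
      exists2 x : R, x \in `[0, 1] & dist (grid_point p) (f x) <= 2 * h].
Proof.
move=> d0 fd; pose n := (Num.truncn d^-1).+1.
have n0 : 0 < n%:R :> R by rewrite ltr0n.
have nd : n%:R^-1 < d.
  by rewrite -[d]invrK ltf_pV2 ?posrE ?invr_gt0 // truncnS_gt.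
have xI i : (i <= n)%N -> (i%:R / n%:R : R) \in `[0, 1].
  by move=> iin; rewrite in_itv /= divr_ge0 //= ler_pdivrMr // mul1r ler_nat.
have [|l [pl ll nl]] := @grid_walk (fun i => f (i%:R / n%:R)) n.
  move=> i iin; apply: fd; rewrite ?xI //; first exact: ltnW.
  by rewrite -mulrBl -natr1 opprD addNKr normrM normrN1 mul1r gtr0_norm ?invr_gt0.
move: pl ll nl; rewrite mul0r divff ?gt_eqF // => pl ll nl.
exists l; split=> // p /nl[i iin di]; exists (i%:R / n%:R) => //; exact: xI.
Qed.

End Grid.


(** * A dual from a drawing by curves *)

Section CurveDrawing.
Variables (V E : finType) (s t : E -> V) (pt : V -> R * R) (g : E -> R -> R * R).
Hypothesis pt_inj : injective pt.
Hypothesis g_cont : forall e, {within `[0, 1], continuous (g e)}.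
Hypothesis g0 : forall e, g e 0 = pt (s e).
Hypothesis g1 : forall e, g e 1 = pt (t e).
Hypothesis g_vertex : forall e v (x : R), x \in `[0, 1] -> g e x = pt v -> v = s e \/ v = t e.
Hypothesis g_cross : forall e e' (x y : R), e != e' -> x \in `[0, 1] -> y \in `[0, 1] ->
  g e x = g e' y -> exists v, g e x = pt v.
Hypothesis st_neq : forall e, s e != t e.
Hypothesis st_inj : forall e e', [set s e; t e]%SET = [set s e'; t e']%SET -> e = e'.

(** The factor 4 leaves room for two blocks of radius about [r] and for the errors of rounding. *)
Lemma vertex_gap : exists r : R, [/\ 0 < r,
  forall u v, u != v -> 4 * r < dist (pt u) (pt v) &
  forall e v (x : R), x \in `[0, 1] -> v != s e -> v != t e -> 4 * r < dist (g e x) (pt v)].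
Proof.
have H1 : \forall d \near 0^'+, forall u v, u != v -> d < dist (pt u) (pt v) :> R.
  apply: filter_forall => u; apply: filter_forall => v.
  have [->|uv] := eqVneq u v; first by near=> d; rewrite ?eqxx.
  near=> d => _; near: d; apply: nbhs_right_lt.
  by rewrite dist_gt0; apply: contra_neq uv; apply: pt_inj.
have H2 : \forall d \near 0^'+, forall e v (x : R), x \in `[0, 1] ->
    v != s e -> v != t e -> d < dist (g e x) (pt v) :> R.
  apply: filter_forall => e; apply: filter_forall => v.
  have [->|vs] := eqVneq v (s e); first by near=> d => x _; rewrite ?eqxx.
  have [->|vt] := eqVneq v (t e); first by near=> d => x _ _; rewrite ?eqxx.
  have : \forall d \near 0^'+, forall x : R, x \in `[0, 1] -> d < dist (g e x) (pt v).
    apply: curve_avoids => // x xI; apply/eqP => /(g_vertex xI)[E1|E1].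
      by rewrite E1 eqxx in vs.
    by rewrite E1 eqxx in vt.
  by apply: filterS => d Hd x xI _ _; apply: Hd.
have [d d0 [A B]] := near0_witness (filterI H1 H2).
exists (d / 4); rewrite mulrCA divff ?pnatr_eq0 // mulr1; split=> //.
by rewrite divr_gt0.
Unshelve. all: by end_near. Qed.

Lemma edge_gap (r : R) : 0 < r -> exists2 d : R, 0 < d &
  forall e e' (x y : R), e != e' -> x \in `[0, 1] -> y \in `[0, 1] ->
    (forall v, r <= dist (g e x) (pt v)) -> d < dist (g e x) (g e' y).
Proof.
move=> r0; have H : \forall d \near 0^'+, forall e e', e != e' ->
    forall x y : R, x \in `[0, 1] -> y \in `[0, 1] ->
    (forall v, r <= dist (g e x) (pt v)) -> d < dist (g e x) (g e' y).
  apply: filter_forall => e; apply: filter_forall => e'.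
  have [<-|ee] := eqVneq e e'; first by near=> d; rewrite ?eqxx.
  have := curves_apart (@g_cont e) (@g_cont e') r0 (fun x y xI yI => g_cross ee xI yI).
  by apply: filterS => d Hd _.
have [d d0 Hd] := near0_witness H; by exists d => // e e' x y ee; apply: Hd.
Unshelve. all: by end_near. Qed.

Lemma curve_drawing_dual :
  exists (F : finType) (l r : E -> F), dual_pair [set: E]%SET s t l r.
Proof.
have [r [r0 pt_gap pt_curve_gap]] := vertex_gap.
have [|d d0 cross_gap] := @edge_gap (r / 2); first by rewrite divr_gt0.
(* A site of a walk is within [2 * h] of its curve. With [h <= r / 8], a site outside all blocks
   comes from a curve point at distance at least [r / 2] from the vertices; with [h <= d / 8], two
   different walks cannot share such a site. *)
pose h := Num.min (r / 8) (d / 8).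
have h0 : 0 < h by rewrite lt_min !divr_gt0.
have hr : h <= r / 8 by rewrite ge_min lexx.
have hd : h <= d / 8 by rewrite ge_min lexx orbT.
have [z z0 Hz] : exists2 z : R, 0 < z & forall e (x y : R),
    x \in `[0, 1] -> y \in `[0, 1] -> `|x - y| < z -> dist (g e x) (g e y) < h.
  have H : \forall z \near 0^'+, forall e (x y : R),
      x \in `[0, 1] -> y \in `[0, 1] -> `|x - y| < z -> dist (g e x) (g e y) < h.
    by apply: filter_forall => e; apply: curve_uniform.
  exact: near0_witness H.
have walks e := curve_walk h0 z0 (Hz e).
pose w e := projT1 (cid (walks e)).
have wP e : [/\ path lazy_step (grid_floor h (pt (s e))) (w e),
    last (grid_floor h (pt (s e))) (w e) = grid_floor h (pt (t e)) &
    forall p, p \in grid_floor h (pt (s e)) :: w e ->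
      exists2 x : R, x \in `[0, 1] & dist (grid_point h p) (g e x) <= 2 * h].
  by rewrite -g0 -g1; exact: (projT2 (cid (walks e))).
(* The radius of the blocks is [r] measured in units of the mesh and rounded down. *)
pose m := Num.truncn (r / h).
have [m1 m2] : m%:R * h <= r /\ r < m%:R * h + h.
  have rh : 0 <= r / h by rewrite divr_ge0 // ltW.
  have /andP[] := truncn_itv rh; rewrite -/m ler_pdivlMr // ltr_pdivrMr // => A B.
  by split=> //; move: B; rewrite -natr1 mulrDl mul1r.
apply: (@lattice_drawing_dual V E s t (fun v => grid_floor h (pt v)) m w) => //.
- move=> u v p /(block_dist h0) up /(block_dist h0) vp; apply/eqP; apply: contraT => uv.
  have := pt_gap u v uv; have := dist_triangle (grid_point h p) (pt u) (pt v).
  rewrite [dist (pt u) (grid_point h p)]distC; lra.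
- by move=> e; have [] := wP e.
- by move=> e; have [] := wP e.
- move=> e p v; have [_ _ H] := wP e; move=> /H[x xI px] /(block_dist h0) vp.
  have [->|vs] := eqVneq v (s e); [by left|right]; apply/eqP; apply: contraT => vt.
  have := pt_curve_gap e v x xI vs vt; have := dist_triangle (grid_point h p) (g e x) (pt v).
  rewrite [dist (g e x) (grid_point h p)]distC; lra.
- move=> e e' p; have [_ _ H] := wP e; have [_ _ H'] := wP e'.
  move=> /H[x xI px] /H'[y yI py] out; apply/eqP; apply: contraT => ee.
  have far v : r / 2 <= dist (g e x) (pt v).
    have := dist_notin_block h0 (out v); have := dist_triangle (g e x) (grid_point h p) (pt v); lra.
  have := cross_gap e e' x y ee xI yI far.
  have := dist_triangle (grid_point h p) (g e x) (g e' y).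
  rewrite [dist (g e x) (grid_point h p)]distC; lra.
Unshelve. all: by end_near. Qed.

End CurveDrawing.

End Curves.

(** * Edges of a planar graph and the homomorphism *)

Section Edges.
Variable G : sgraph.

(** The ranks select one of the two orientations, so that every edge occurs exactly once. *)
Definition edge := {p : G * G | sedge p.1 p.2 && (enum_rank p.1 < enum_rank p.2)%N}.
Definition edge_src (e : edge) : G := (val e).1.
Definition edge_tgt (e : edge) : G := (val e).2.

Lemma edge_adj e : sedge (edge_src e) (edge_tgt e).
Proof. by case/andP: (valP e). Qed.

Lemma edge_neq e : edge_src e != edge_tgt e.
Proof.
by apply/eqP => E1; have := edge_adj e; rewrite E1 sedge_irrefl.
Qed.

Lemma edge_inj e e' :
  [set edge_src e; edge_tgt e]%SET = [set edge_src e'; edge_tgt e']%SET -> e = e'.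
Proof.
case: e => [[u v] euv]; case: e' => [[x y] exy].
have /andP[/= uv ruv] := euv; have /andP[/= xy rxy] := exy.
rewrite /edge_src /edge_tgt /= => H; apply: val_inj => /=.
have uP : u \in [set x; y]%SET by rewrite -H set21.
have vP : v \in [set x; y]%SET by rewrite -H set22.
move: uP vP ruv; rewrite !inE => /orP[]/eqP-> /orP[]/eqP->; rewrite ?ltnn // => ryx.
by rewrite ltnNge ltnW in rxy.
Qed.

Lemma joined_edge u v : joined [set: edge]%SET edge_src edge_tgt u v = sedge u v.
Proof.
apply/existsP/idP => [[e /andP[_]]|uv].
  by case/orP => /andP[/eqP<- /eqP<-]; last rewrite sedge_sym; exact: edge_adj.
have : u != v by apply: contraL uv => /eqP->; rewrite sedge_irrefl.
rewrite -(inj_eq enum_rank_inj) -val_eqE neq_ltn => /orP[r|r].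
  have P : sedge u v && (enum_rank u < enum_rank v)%N by rewrite uv.
  by exists (exist _ (u, v) P); rewrite inE /edge_src /edge_tgt /= !eqxx.
have P : sedge v u && (enum_rank v < enum_rank u)%N by rewrite sedge_sym uv.
by exists (exist _ (v, u) P); rewrite inE /edge_src /edge_tgt /= !eqxx orbT.
Qed.

Lemma planar_dual (R : realType) : planar R G ->
  exists (F : finType) (l r : edge -> F), dual_pair [set: edge]%SET edge_src edge_tgt l r.
Proof.
case=> pt [arc [pt_inj arcP arc_vertex arc_cross]].
have arcs e := (arcP _ _ (edge_adj e)).2.
pose g e := projT1 (cid (arcs e)).
have gP e : [/\ {within `[0, 1], continuous (g e)},
    {in `[0, 1] &, injective (g e)}, g e 0 = pt (edge_src e),
    g e 1 = pt (edge_tgt e) & arc (edge_src e) (edge_tgt e) = g e @` `[0, 1]].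
  exact: (projT2 (cid (arcs e))).
have g_arc e (x : R) : x \in `[0, 1] -> arc (edge_src e) (edge_tgt e) (g e x).
  by have [_ _ _ _ ->] := gP e; exists x.
apply: (@curve_drawing_dual R _ _ _ _ pt g) => //.
- by move=> e; have [] := gP e.
- by move=> e; have [] := gP e.
- by move=> e; have [] := gP e.
- move=> e v x xI gx; apply: arc_vertex (edge_adj e) _.
  by rewrite -gx; apply: g_arc.
- move=> e e' x y ee xI yI gxy.
  have ee' : [set edge_src e; edge_tgt e]%SET != [set edge_src e'; edge_tgt e']%SET.
    by apply: contra_neq ee; apply: edge_inj.
  have [|v _ <-] := arc_cross _ _ _ _ (edge_adj e) (edge_adj e') ee' (g e x); last by exists v.
  by split; [exact: g_arc | rewrite gxy; exact: g_arc].
- exact: edge_neq.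
- exact: edge_inj.
Qed.

End Edges.

Lemma near5_C5 (a b : 'Z_5) : near5 a b -> C5_edge a b.
Proof. by case: a b => [[|[|[|[|[|i]]]]] ?] [[|[|[|[|[|j]]]]] ?]. Qed.

Theorem corollary4 (R : realType) (G : sgraph)
    (planarG : planar R G)
    (no_short_odd_cycle : forall c : seq G,
       is_cycle c -> odd (size c) -> ~ (size c <= 9)%N) :
  exists f : G -> C5, is_hom f.
Proof.
have [F [l [r dual]]] := planar_dual planarG.
have odd10 : odd_large [set: edge G]%SET (@edge_src G) (@edge_tgt G).
  apply: odd_large_cycles => [e|e e'|c c2 cyc oc]; [exact: edge_neq|exact: edge_inj|].
  rewrite ltnNge; apply/negP; apply: no_short_odd_cycle oc; split=> //.
  move: cyc; rewrite /ucycle; case: (c) => // x p /= /andP[pp ->]; rewrite andbT.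
  by rewrite -(eq_path (@joined_edge G)).
have [f fP] := dual_pair_colorable dual odd10.
exists f => u v; rewrite -joined_edge => /existsP[e /andP[eE]].
case/orP=> /andP[/eqP<- /eqP<-]; apply: near5_C5; first rewrite near5C; exact: fP.
Qed.
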